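(* Let $(M,g)$ and $(M,g')$ be space-times (on the same manifold $M$), with $(M,g)$ of holonomy type $R_{10}$, $R_{11}$ or $R_{13}$ and of curvature class $\mathbf{D}$ at every point of $M$ (so that $\mathrm{Riem}$ is nowhere zero on $M$ and at each $m\in M$ one has $R_{abcd}=\alpha F_{ab}F_{cd}$ with $0\ne\alpha\in\mathbb{R}$ and $F$ a simple bivector). Suppose that the nature (timelike, spacelike or null) of the bivector $F$ is constant on $M$, and that $g$ and $g'$ are projectively related, with associated 1-form $\lambda$. (1) If $F$ is non-null (always timelike or always spacelike), then either $\lambda=0$ on $M$ or $\lambda$ is nowhere vanishing on $M$. (2) If $F$ is null, then $\lambda=0$ on $M$.
   Context: A space-time $(M,g)$ is a 4-dimensional, Hausdorff, connected, smooth manifold $M$ with a smooth metric $g$ of Lorentz signature $(-,+,+,+)$. Projectively related: $g$ and $g'$, with Levi-Civita connections $\nabla$ and $\nabla'$, are projectively related if the sets of unparametrised geodesics of $\nabla$ and $\nabla'$ coincide; equivalently there is a (unique) global smooth 1-form $\psi$ on $M$ with $\Gamma'^a_{bc}-\Gamma^a_{bc}=\delta^a_b\psi_c+\delta^a_c\psi_b$ in every coordinate domain. The 1-form $\psi$ is then a global gradient $\psi=d\chi$. The associated 1-form $\lambda$ is $\lambda_a=-e^{2\chi}\psi_b\,g'^{bc}g_{ac}$, where $g'^{bc}$ is the inverse of $g'_{bc}$ ($\chi$ is determined up to an additive constant, so $\lambda$ up to a positive constant factor). Bivectors: for $m\in M$ and $p,q\in T_mM$, $p\wedge q$ denotes the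 bivector $F^{ab}=p^aq^b-q^ap^b$, identified (using $g(m)$) with the skew-self-adjoint endomorphism $F^a{}_b=F^{ac}g_{cb}$ of $T_mM$. A non-zero bivector of this form is simple, and its blade is the 2-space spanned by $p,q$; it is timelike, spacelike or null according as its blade is a timelike, spacelike or null 2-space (i.e. $g$ restricted to the blade is Lorentzian, positive definite, or degenerate). A null tetrad at $m$ is a basis $l,n,x,y$ of $T_mM$ whose only non-vanishing inner products are $g(l,n)=g(x,x)=g(y,y)=1$; an orthonormal tetrad is a basis $u,x,y,z$ whose only non-vanishing inner products are $-g(u,u)=g(x,x)=g(y,y)=g(z,z)=1$. Holonomy type: let $\phi$ be the Lie algebra of the holonomy group of $\nabla$ at a point $m\in M$, regarded as a Lie algebra of skew-self-adjoint endomorphisms (bivectors) of $T_mM$. $(M,g)$ is of holonomy type: $R_{10}$ if $\phi$ is the 3-dimensional algebra spanned by $l\wedge n,\ l\wedge x,\ n\wedge x$ for some null tetrad $l,n,x,y$ at $m$; $R_{11}$ if $\phi$ is spanned by $l\wedge x,\ l\wedge y,\ x\wedge y$ for some null tetrad $l,n,x,y$ at $m$; $R_{13}$ if $\phi$ is spanned by $x\wedge y,\ y\wedge z,\ x\wedge z$ for some orthonormal tetrad $u,x,y,z$ at $m$. (The type does not depend on the choice of $m$.) Curvature class $\mathbf{D}$ at $m$: the linear map $F^{ab}\mapsto R^{ab}{}_{cd}F^{cd}$ on bivectors at $m$ has rank 1; then $R_{abcd}=\alpha F_{ab}F_{cd}$ at $m$ for some $\alpha\neq0$ and some necessarily simple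 bivector $F$, unique up to scaling. *)

(* Defs.v *)
From HB Require Import structures.
From mathcomp Require Import all_boot all_order all_algebra.
From mathcomp Require Import all_classical all_reals all_analysis.

Set Implicit Arguments.
Unset Strict Implicit.
Unset Printing Implicit Defensive.

Import Order.TTheory GRing.Theory Num.Theory.
Import numFieldNormedType.Exports.

Local Open Scope classical_set_scope.
Local Open Scope ring_scope.

(** * Smooth 4-manifolds *)

(** [coord] and [par] are total functions: only the values of [coord] on [dom]
    and of [par] on [coord @` dom] are meaningful, and [par] is the inverse of
    [coord] there. *)
Record chart (R : realType) (M : topologicalType) := Chart {
  dom : set M;
  coord : M -> 'rV[R]_4;
  par : 'rV[R]_4 -> M;
  dom_open : open dom;
  img_open : open (coord @` dom);
  coordK : forall p, dom p -> par (coord p) = p;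
  coord_continuous : forall p, dom p -> {for p, continuous coord};
  par_continuous : forall x, (coord @` dom) x -> {for x, continuous par}
}.

Section Manifold.
Variables (R : realType) (M : topologicalType).
Implicit Types (c : chart R M) (p : M) (f : M -> R).

(** The coordinate derivative [d f / d x^a] in the chart [c], again as a
    function on [M] so that it can be iterated (meaningful on [dom c]). *)
Definition pd c (a : 'I_4) f : M -> R :=
  fun p => 'D_(delta_mx ord0 a) (f \o par c) (coord c p).

(** All iterated coordinate derivatives of [f] exist and are continuous on the
    open set [U], a subset of [dom c]. *)
Definition smooth_on c (U : set M) f :=
  forall (s : seq 'I_4) p, U p ->
    {for p, continuous (foldr (pd c) f s)} /\
    forall a, derivable (foldr (pd c) f s \o par c) (coord c p)
                        (delta_mx ord0 a).

(** An atlas: the smooth structure is the one it generates (every notion below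
    is insensitive to enlarging the atlas by compatible charts). *)
Definition is_atlas (A : set (chart R M)) :=
  (forall p, exists2 c, A c & dom c p) /\
  (forall c c', A c -> A c' ->
     forall a, smooth_on c (dom c `&` dom c') (fun p => coord c' p ord0 a)).

(** [jac c c' p] has entries [d x'^a / d x^b] at [p]. *)
Definition jac c c' p : 'M[R]_4 :=
  \matrix_(a, b) pd c b (fun q => coord c' q ord0 a) p.

Definition smooth_fun (A : set (chart R M)) f :=
  forall c, A c -> smooth_on c (dom c) f.

(** Tensor fields are given by their components in the charts of the atlas:
    [T c p] is meaningful when [c] is in the atlas and [dom c p]. *)
Definition covector_field := chart R M -> M -> 'rV[R]_4.
Definition tensor2_field := chart R M -> M -> 'M[R]_4.

Definition smooth_covector (A : set (chart R M)) (w : covector_field) :=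
  (forall c, A c -> forall a, smooth_on c (dom c) (fun p => w c p ord0 a)) /\
  (forall c c' p, A c -> A c' -> dom c p -> dom c' p ->
     w c p = w c' p *m jac c c' p).

Definition smooth_covariant2 (A : set (chart R M)) (h : tensor2_field) :=
  (forall c, A c -> forall a b, smooth_on c (dom c) (fun p => h c p a b)) /\
  (forall c c' p, A c -> A c' -> dom c p -> dom c' p ->
     h c p = (jac c c' p)^T *m h c' p *m jac c c' p).

Definition differential f : covector_field :=
  fun c p => \row_a pd c a f p.

Definition vanishes_everywhere (A : set (chart R M)) (w : covector_field) :=
  forall c p, A c -> dom c p -> w c p = 0.

Definition vanishes_nowhere (A : set (chart R M)) (w : covector_field) :=
  forall c p, A c -> dom c p -> w c p != 0.

End Manifold.

(** * Lorentzian linear algebra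

    Tangent vectors at a point are columns of components in a chart, and [G] is
    the matrix of components of the metric in the same chart. *)
Section LinearAlgebra.
Variable R : realType.
Implicit Types (G F : 'M[R]_4) (p q u v l n x y z : 'cV[R]_4).

Definition ip G p q : R := (p^T *m G *m q) ord0 ord0.

(** For both kinds of tetrad, linear independence is automatic: the Gram matrix
    is invertible. *)
Definition null_tetrad G l n x y :=
  [/\ ip G l n = 1, ip G x x = 1 & ip G y y = 1] /\
  [/\ ip G l l = 0, ip G n n = 0, ip G l x = 0 & ip G l y = 0] /\
  [/\ ip G n x = 0, ip G n y = 0 & ip G x y = 0].

Definition orthonormal_tetrad G u x y z :=
  [/\ ip G u u = -1, ip G x x = 1, ip G y y = 1 & ip G z z = 1] /\
  [/\ ip G u x = 0, ip G u y = 0 & ip G u z = 0] /\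
  [/\ ip G x y = 0, ip G y z = 0 & ip G x z = 0].

(** Symmetric of signature (-,+,+,+). *)
Definition lorentz_form G :=
  G^T = G /\ exists u x y z, orthonormal_tetrad G u x y z.

(** [p /\ q], with both indices up. *)
Definition wedge p q : 'M[R]_4 := p *m q^T - q *m p^T.

(** [F^a_b = F^{ac} g_{cb}]. *)
Definition endo_of G F : 'M[R]_4 := F *m G.

(** [F_{ab} = g_{ac} g_{bd} F^{cd}]. *)
Definition lower2 G F : 'M[R]_4 := G *m F *m G^T.

Definition blade p q : set 'cV[R]_4 :=
  [set v | exists a b : R, v = a *: p + b *: q].

Inductive nature := Timelike | Spacelike | Null.

(** Causal nature of a 2-space [B]: [g] restricted to [B] is Lorentzian
    (has an orthonormal basis [u], [x] with [u] timelike), positive definite, or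
    degenerate. *)
Definition has_nature G (B : set 'cV[R]_4) (N : nature) : Prop :=
  match N with
  | Timelike => exists u x, [/\ B u, B x & [/\ ip G u u = -1, ip G x x = 1
                                             & ip G u x = 0]]
  | Spacelike => forall v, B v -> v != 0 -> 0 < ip G v v
  | Null => exists v, [/\ B v, v != 0 & forall w, B w -> ip G v w = 0]
  end.

Definition span3 (E1 E2 E3 : 'M[R]_4) : set 'M[R]_4 :=
  [set E | exists a b d : R, E = a *: E1 + b *: E2 + d *: E3].

Definition expmx (E : 'M[R]_4) : 'M[R]_4 :=
  limn (series (fun k : nat => (k`!%:R : R)^-1 *: E ^+ k)).

End LinearAlgebra.

(** * Levi-Civita connection, curvature, geodesics and holonomy *)
Section Geometry.
Variables (R : realType) (M : topologicalType) (A : set (chart R M)).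
Implicit Types (c : chart R M) (p m : M) (g : tensor2_field R M).

Definition spacetime g :=
  [/\ hausdorff_space M, connected [set: M], is_atlas A,
      smooth_covariant2 A g &
      forall c p, A c -> dom c p -> lorentz_form (g c p)].

(** [christoffel g c a b d] is the component [Gamma^a_{bd}]. *)
Definition christoffel g c (a b d : 'I_4) : M -> R := fun p =>
  2^-1 * \sum_e invmx (g c p) a e *
    (pd c b (fun q => g c q e d) p + pd c d (fun q => g c q e b) p
     - pd c e (fun q => g c q b d) p).

(** [riemann g c a b k d] is the component [R^a_{bkd}]. *)
Definition riemann g c (a b k d : 'I_4) : M -> R := fun p =>
  pd c k (christoffel g c a d b) p - pd c d (christoffel g c a k b) p
  + \sum_e (christoffel g c a k e p * christoffel g c e d b p
            - christoffel g c a d e p * christoffel g c e k b p).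

(** [R_{abkd}]. *)
Definition riemann_down g c (a b k d : 'I_4) : M -> R := fun p =>
  \sum_e g c p a e * riemann g c e b k d p.

(** [F^{ab} |-> R^{ab}_{kd} F^{kd}]. *)
Definition curvature_map g c p (F : 'M[R]_4) : 'M[R]_4 :=
  \matrix_(a, b) \sum_k \sum_d
    (\sum_e invmx (g c p) b e * riemann g c a e k d p) * F k d.

(** Rank 1 of the curvature map on bivectors. Bivectors are exactly the
    matrices [X - X^T], whence the precomposition below. *)
Definition curvature_class_D g c p : Prop :=
  \rank (lin_mx (fun X : 'M[R]_4 => curvature_map g c p (X - X^T))) = 1%N.

(** [R_{abkd} = alpha F_{ab} F_{kd}] at [p] with [alpha != 0] and [F] a
    (non-zero) simple bivector whose blade has nature [N]. *)
Definition curvature_nature g c p (N : nature) : Prop :=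
  exists (alpha : R) (v w : 'cV[R]_4),
    [/\ alpha != 0, wedge v w != 0,
        forall a b k d, riemann_down g c a b k d p =
          alpha * lower2 (g c p) (wedge v w) a b
                * lower2 (g c p) (wedge v w) k d &
        has_nature (g c p) (blade v w) N].

(** Curves are parametrised by the whole real line; a smooth curve on a smaller
    interval is, up to reparametrisation, (a restriction of) such a curve. *)
Definition smooth_curve (gam : R -> M) :=
  continuous gam /\
  forall c t, A c -> dom c (gam t) -> forall (a : 'I_4) (k : nat),
    derivable (derive1n k (fun s => coord c (gam s) ord0 a)) t 1.

Definition velocity c (gam : R -> M) (t : R) : 'cV[R]_4 :=
  \col_a derive1 (fun s => coord c (gam s) ord0 a) t.

(** Covariant derivative along [gam] of a vector field with components [X]. *)
Definition cov_along g c (gam : R -> M) (X : R -> 'cV[R]_4) (t : R) :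
    'cV[R]_4 :=
  \col_a (derive1 (fun s => X s a ord0) t
          + \sum_b \sum_d christoffel g c a b d (gam t)
                          * velocity c gam t b ord0 * X t d ord0).

(** Unparametrised geodesics: regular curves whose acceleration is everywhere
    proportional to the velocity. *)
Definition unparam_geodesic g (gam : R -> M) :=
  smooth_curve gam /\
  forall c t, A c -> dom c (gam t) ->
    velocity c gam t != 0 /\
    exists k : R, cov_along g c gam (velocity c gam) t = k *: velocity c gam t.

Definition projectively_related g g' :=
  forall gam, unparam_geodesic g gam <-> unparam_geodesic g' gam.

(** [lambda] is associated with the projectively related [g], [g'] through the
    1-form [psi = d chi]; it depends on the choice of [chi] only by a positive
    constant factor. *)
Definition associated_form g g' (lambda : covector_field R M) : Prop :=
  exists (psi : covector_field R M) (chi : M -> R),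
    [/\ smooth_covector A psi /\
          (forall c p, A c -> dom c p -> forall a b d : 'I_4,
             christoffel g' c a b d p - christoffel g c a b d p =
               (a == b)%:R * psi c p ord0 d + (a == d)%:R * psi c p ord0 b),
        smooth_fun A chi,
        forall c p, A c -> dom c p -> psi c p = differential chi c p &
        forall c p, A c -> dom c p -> forall a,
          lambda c p ord0 a =
            - expR (2 * chi p) *
              \sum_b \sum_d psi c p ord0 b * invmx (g' c p) b d * g c p a d].

(** The columns of [X c t] are the components in [c] of four vector fields
    along [gam], each of them parallel. *)
Definition parallel_frame g (gam : R -> M) (X : chart R M -> R -> 'M[R]_4) :=
  (forall c c' t, A c -> A c' -> dom c (gam t) -> dom c' (gam t) ->
     X c' t = jac c c' (gam t) *m X c t) /\
  (forall c t, A c -> dom c (gam t) -> forall k : 'I_4,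
     (forall a, derivable (fun s => X c s a k) t 1) /\
     cov_along g c gam (fun s => col k (X c s)) t = 0).

(** [P] is the matrix, with respect to [c] at the start [p] and [c'] at the end
    [p'], of the parallel transport from time 0 to time 1 along some smooth
    curve. *)
Definition smooth_transport g c p c' p' (P : 'M[R]_4) : Prop :=
  exists (gam : R -> M) (X : chart R M -> R -> 'M[R]_4),
    [/\ A c /\ dom c p, A c' /\ dom c' p',
        smooth_curve gam /\ (gam 0 = p /\ gam 1 = p'),
        parallel_frame g gam X &
        X c 0 = 1%:M /\ X c' 1 = P].

(** Parallel transport along piecewise smooth curves. *)
Inductive transport g c p : chart R M -> M -> 'M[R]_4 -> Prop :=
| transport_nil : transport g c p c p 1%:M
| transport_rcons c' p' c'' p'' P Q :
    transport g c p c' p' P -> smooth_transport g c' p' c'' p'' Q ->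
    transport g c p c'' p'' (Q *m P).

Definition holonomy_group g c m : set 'M[R]_4 :=
  [set P | transport g c m c m P].

(** The Lie algebra of a Lie subgroup [H] of the general linear group (here
    with countably many components) consists of the [E] with [exp (t E)] in [H]
    for all [t]. *)
Definition holonomy_algebra g c m : set 'M[R]_4 :=
  [set E | forall t : R, holonomy_group g c m (expmx (t *: E))].

Definition holonomy_type_R10 g : Prop :=
  exists c m l n x y, [/\ A c, dom c m, null_tetrad (g c m) l n x y &
    let E v w := endo_of (g c m) (wedge v w) in
    holonomy_algebra g c m = span3 (E l n) (E l x) (E n x)].

Definition holonomy_type_R11 g : Prop :=
  exists c m l n x y, [/\ A c, dom c m, null_tetrad (g c m) l n x y &
    let E v w := endo_of (g c m) (wedge v w) in
    holonomy_algebra g c m = span3 (E l x) (E l y) (E x y)].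

Definition holonomy_type_R13 g : Prop :=
  exists c m u x y z, [/\ A c, dom c m, orthonormal_tetrad (g c m) u x y z &
    let E v w := endo_of (g c m) (wedge v w) in
    holonomy_algebra g c m = span3 (E x y) (E y z) (E x z)].

End Geometry.

(* Main.v *)
Require Import Defs.
From HB Require Import structures.
From mathcomp Require Import all_boot all_order all_algebra.
From mathcomp Require Import all_classical all_reals all_analysis.
From mathcomp Require Import ring lra.
Import Order.TTheory GRing.Theory Num.Theory.
Import numFieldNormedType.Exports.

Set Implicit Arguments.
Unset Strict Implicit.
Unset Printing Implicit Defensive.
Local Open Scope classical_set_scope.
Local Open Scope ring_scope.

Local Notation coord := Defs.coord.

(** In chart coordinates put [a = exp (2 chi) g'^-1] and
    [l = - a psi], so that [lambda] is [l] with its index lowered by [g].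
    Sinjukov's equation [a^{ab}_{;c} = delta^a_c l^b + delta^b_c l^a] and the
    Ricci identities for [a] and [l], for a curvature of rank one, force
    [l^a_{;b} = C delta^a_b] with [C] locally constant (the function [dil]),
    [R l = 0], and the curvature endomorphisms to be skew for [a].

    If [l] vanishes at a point, differentiating [R l = 0] there gives [C R = 0],
    so [C = 0]; then [l] is parallel and vanishes nearby. Hence the zero set of
    [lambda] is open and closed.

    Let [F] be null and [l] nowhere zero. Any two vectors of [ker F] span a
    degenerate plane. If [C = 0] then [a l] also lies in [ker F] and has
    covariant derivative [(l.l) 1 + l (x) l]; this is contradictory when
    [l.l <> 0], and when [l.l = 0] the eigenvalue of [a] on the blade of [F] has
    gradient both [lambda] and [0]. If [C <> 0], the holonomy group normalises
    its Lie algebra, hence preserves the common kernel of the latter, which is a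
    line for each of the three types. Parallel transport spreads it to a line
    field; its section [k] with [l.k = 1] satisfies [k_{a;b} = - C k_a k_b], so
    that [R k = 0], [(k.k) (l.l) = 1], then [l = k / (k.k)], and [C 1] has rank
    one. *)

(** * Differentiation in coordinates *)

(** The holonomy hypothesis concerns one-parameter groups of loop matrices, while the argument needs
    vectors killed by the curvature. The bridge is not a theorem on generators of the holonomy
    algebra. Holonomy yields a line preserved by every reversible loop, and the Ricci identity for
    the differential equation of [k] then gives [R k = 0].

    That equation comes from normalisation: for parallel [v] the derivative of [l.v] is [C v_a], so
    [k = v / (l.v)] has covariant derivative [- C k_a k]. Where [l.v] vanishes identically, the same
    derivative forces [C v_a = 0].

    The line is obtained by choosing transports pointwise, so its regularity has to be earned.
    Normalising removes the choice, uniform estimates on transports along the axes give continuity,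
    the axes give the partial derivatives, and the equation then raises the order of smoothness.

    The eigenvalue of [a] in the case [l.l = 0] is not known to be differentiable either;
    multiplying it by a nonzero component of [l] replaces it by a component of [a l], which is
    smooth. *)

Section Cubes.
Variables (R : realType) (n : nat).
Implicit Types x y z : 'rV[R]_n.
Local Notation e a := (delta_mx ord0 a : 'rV[R]_n).

Definition cube x (r : R) : set 'rV[R]_n :=
  [set y | forall i, `|y ord0 i - x ord0 i| < r].

Lemma cube_refl x (r : R) : 0 < r -> cube x r x.
Proof. by move=> r0 i; rewrite subrr normr0. Qed.

Lemma cube_nbhs x (r : R) : 0 < r -> nbhs x (cube x r).
Proof.
move=> r0; apply/nbhs_ballP; exists r => //= y [_ xy] i.
by rewrite distrC; exact: xy.
Qed.

Lemma cube_open x (r : R) : 0 < r -> open (cube x r).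
Proof.
move=> r0; have -> : cube x r = ball x r; last exact: ball_open.
apply/seteqP; split=> y; last by move=> [_ xy] i; rewrite distrC; exact: xy.
by move=> xy; split=> // i j; rewrite ord1 /ball /= distrC; exact: xy.
Qed.

Lemma nbhs_cube x (W : set 'rV[R]_n) :
  nbhs x W -> exists2 r : R, 0 < r & cube x r `<=` W.
Proof.
move=> /nbhs_ballP[r /= r0 rW]; exists r => // y xy; apply: rW; split => // i j.
by rewrite ord1 /ball /= distrC; exact: xy.
Qed.

Lemma open_cube (V : set 'rV[R]_n) x :
  open V -> V x -> exists2 r : R, 0 < r & cube x r `<=` V.
Proof. by move=> oV Vx; apply: nbhs_cube; exact: open_nbhs_nbhs. Qed.

Lemma near_axis x (a : 'I_n) (W : set 'rV[R]_n) :
  nbhs x W -> \forall s \near (0 : R), W (x + s *: e a).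
Proof.
move=> /nbhs_cube[r r0 rW]; near=> s; apply: rW => i; rewrite !mxE addrAC subrr add0r.
rewrite eqxx /= normrM; apply: (@le_lt_trans _ _ `|s|).
  by case: (i == a); rewrite ?normr1 ?mulr1 ?normr0 ?mulr0.
near: s; exact: (@nbhs0_lt R R^o r r0).
Unshelve. all: by end_near. Qed.

(* The corners of the staircase from [x] to [y] that changes one coordinate at
   a time. *)
Definition stair x y (k : nat) : 'rV[R]_n :=
  \row_j if (j < k)%N then y ord0 j else x ord0 j.

Lemma stair0 x y : stair x y 0 = x.
Proof. by apply/rowP => j; rewrite !mxE. Qed.

Lemma stairn x y : stair x y n = y.
Proof. by apply/rowP => j; rewrite !mxE ltn_ord. Qed.

Lemma stairS x y (k : 'I_n) :
  stair x y k.+1 = stair x y k + (y ord0 k - x ord0 k) *: e k.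
Proof.
apply/rowP => j; rewrite !mxE ltnS leq_eqVlt eqxx /=.
have [->|jk] := eqVneq j k; first by rewrite eqxx ltnn /= mulr1 addrC subrK.
by rewrite -(inj_eq val_inj) in jk; rewrite (negbTE jk) /= mulr0 addr0.
Qed.

Lemma stair_cube x y z (r : R) k :
  cube z r x -> cube z r y -> cube z r (stair x y k).
Proof. by move=> zx zy i; rewrite mxE; case: ifP. Qed.

Lemma stair_cube_between x y z (r : R) (k : 'I_n) (t : R) :
  cube z r x -> cube z r y ->
  t \in `[Order.min (x ord0 k) (y ord0 k), Order.max (x ord0 k) (y ord0 k)]%R ->
  cube z r (stair x y k + (t - x ord0 k) *: e k).
Proof.
move=> zx zy; rewrite in_itv /= => /andP[t1 t2] i; rewrite !mxE eqxx /=.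
have [->|jk] := eqVneq i k; last first.
  by rewrite mulr0 addr0; case: ifP.
rewrite ltnn mulr1 addrC subrK.
have := zx k; have := zy k; rewrite !ltr_norml => /andP[h1 h2] /andP[h3 h4].
move: t1 t2; rewrite /Order.min /Order.max; case: ifP => _ t1 t2; lra.
Qed.

(** The staircase between two points of a cube stays in the cube. Local statements about parallel
    fields and transports thereby reduce to ordinary differential equations along coordinate
    lines. *)
Lemma cube_ind (P : 'rV[R]_n -> Prop) x (r : R) :
  (forall y a (s : R), cube x r y -> cube x r (y + s *: e a) -> P y ->
     P (y + s *: e a)) ->
  forall y z, cube x r y -> cube x r z -> P y -> P z.
Proof.
move=> Pstep y z cy cz Py; rewrite -(stairn y z).
suff: forall k, (k <= n)%N -> P (stair y z k) by apply.
elim=> [|k IH] kn; first by rewrite stair0.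
rewrite (stairS y z (Ordinal kn)) /=; apply: Pstep; last exact/IH/ltnW.
- exact: stair_cube.
- by rewrite -(stairS y z (Ordinal kn)) /=; exact: stair_cube.
Qed.

End Cubes.

Section AxisDerivatives.
Variables (R : realType) (U : normedModType R).
Implicit Types (x v : U) (f : U -> R).

Lemma is_derive_line f x v (t df : R) :
  is_derive (x + t *: v) v f df -> is_derive t 1 (fun s : R => f (x + s *: v)) df.
Proof.
have E : (fun h : R => h^-1 *: (f (x + (h *: 1 + t) *: v) - f (x + t *: v))) =
         (fun h : R => h^-1 *: (f (h *: v + (x + t *: v)) - f (x + t *: v))).
  apply/funext => h; congr (_ *: (f _ - _)).
  by rewrite [h *: 1]mulr1 scalerDl addrCA.
by move=> [d <-]; split; rewrite /derivable /derive E.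
Qed.

Lemma is_derive_line0 f x v (df : R) :
  is_derive (0 : R) 1 (fun s : R => f (x + s *: v)) df -> is_derive x v f df.
Proof.
have E : (fun h : R => h^-1 *: (f (x + (h *: (1 : R^o) + 0 : R) *: v) - f (x + 0 *: v))) =
         (fun h : R => h^-1 *: (f (h *: v + x) - f x)).
  by apply/funext => h; rewrite scale0r !addr0 [h *: 1]mulr1 [x + _]addrC.
by move=> [d <-]; split; [move: d|]; rewrite /derivable /derive E.
Qed.

Lemma is_derive_unique f x v (d1 d2 : R) :
  is_derive x v f d1 -> is_derive x v f d2 -> d1 = d2.
Proof. by move=> [_ <-] [_ <-]. Qed.

Lemma is_derive_near f g x v (df : R) :
  (\forall y \near x, f y = g y) -> is_derive x v g df -> is_derive x v f df.
Proof.
by move=> fg; apply: near_eq_is_derive; apply: filterS fg => y ->. Qed.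

Lemma is_derive_continuous1 (f : R -> R) (t df : R) :
  is_derive t 1 f df -> {for t, continuous f}.
Proof. by move=> [d _]; apply/differentiable_continuous/derivable1_diffP. Qed.

Lemma mvt_abs (f df : R -> R) (a b : R) :
  (forall t, t \in `[Order.min a b, Order.max a b]%R -> is_derive t 1 f (df t)) ->
  exists2 t, t \in `[Order.min a b, Order.max a b]%R & f b - f a = df t * (b - a).
Proof.
wlog ab : a b / a <= b => [H|].
  have [|ba] := orP (le_total a b); first exact: H.
  rewrite minC maxC => hd; have [t tab E] := H b a ba hd.
  by exists t => //; rewrite -opprB E -mulrN opprB.
rewrite (min_idPl ab) (max_idPr ab) => hd.
have hd' t : t \in `]a, b[%R -> is_derive t 1 f (df t).
  by move=> tab; apply: hd; apply: subset_itv_oo_cc tab.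
have cf : {within `[a, b], continuous f}.
  by apply: derivable_within_continuous => t tab; have [] := hd t tab.
by have [t tab E] := MVT_segment ab hd' cf; exists t.
Qed.

End AxisDerivatives.

(* The library states these rules for the functions [f + g], [f * g], etc. *)
Section PointwiseRules.
Variables (R : realType) (U : normedModType R).
Implicit Types (x v : U) (f g : U -> R) (df dg : R).

Lemma pder_cst (k : R) x v : is_derive x v (fun=> k) 0.
Proof. exact: is_derive_cst. Qed.

Lemma pderD f g x v df dg : is_derive x v f df -> is_derive x v g dg ->
  is_derive x v (fun y => f y + g y) (df + dg).
Proof. by move=> hf hg; exact: (@is_deriveD R U R^o f g). Qed.

Lemma pderN f x v df : is_derive x v f df -> is_derive x v (fun y => - f y) (- df).
Proof. by move=> hf; exact: (@is_deriveN R U R^o f). Qed.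

Lemma pderB f g x v df dg : is_derive x v f df -> is_derive x v g dg ->
  is_derive x v (fun y => f y - g y) (df - dg).
Proof. by move=> hf hg; exact: (@is_deriveB R U R^o f g). Qed.

Lemma pderM f g x v df dg : is_derive x v f df -> is_derive x v g dg ->
  is_derive x v (fun y => f y * g y) (df * g x + f x * dg).
Proof.
move=> hf hg; have := @is_deriveM R U f g x v df dg hf hg.
by move/is_derive_eq; apply; rewrite addrC [g x *: _]mulrC.
Qed.

Lemma pder_sum (I : Type) (s : seq I) (P : pred I) (f : I -> U -> R)
    (df : I -> R) x v :
  (forall i, is_derive x v (f i) (df i)) ->
  is_derive x v (fun y => \sum_(i <- s | P i) f i y) (\sum_(i <- s | P i) df i).
Proof.
move=> hf; elim: s => [|i s IH].
  under eq_fun do rewrite big_nil.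
  by rewrite big_nil; exact: pder_cst.
under eq_fun do rewrite big_cons; rewrite big_cons.
by case: ifP => _; [exact: pderD|].
Qed.

Lemma pderV f x v df : f x != 0 -> is_derive x v f df ->
  is_derive x v (fun y => (f y)^-1) (- (f x) ^- 2 * df).
Proof.
move=> fx0 [d <-]; split; first exact: (@derivableV R U f).
exact: (@deriveV R U f).
Qed.

Lemma pder_comp (h : R -> R) f x v df dh :
  is_derive x v f df -> is_derive (f x) 1 h dh ->
  is_derive x v (fun y => h (f y)) (dh * df).
Proof.
move=> hf hh; apply: is_derive_line0.
have hl : is_derive (0 : R) 1 (fun s : R => f (x + s *: v)) df.
  by apply: is_derive_line; rewrite scale0r addr0.
have hh' : is_derive (f (x + (0 : R) *: v)) 1 h dh by rewrite scale0r addr0.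
exact: (@is_derive1_comp R h (fun s => f (x + s *: v))).
Qed.

End PointwiseRules.

(** * Symmetry of mixed second derivatives *)

Section Schwarz.
Variables (R : realType) (U : normedModType R).
Implicit Types (x v w : U) (f : U -> R).

Lemma near_plane x v w (W : set U) : nbhs x W ->
  exists2 d : R, 0 < d &
    forall s r : R, `|s| < d -> `|r| < d -> W (x + s *: v + r *: w).
Proof.
move=> /nbhs_normP[eps /= eps0 epsW].
have N0 : 0 < `|v| + `|w| + 1 by rewrite ltr_wpDl // addr_ge0.
exists (eps / (`|v| + `|w| + 1)) => [|s r sd rd]; first exact: divr_gt0.
apply: epsW; rewrite /= -addrA opprD addrA subrr add0r normrN.
apply: le_lt_trans (ler_normD _ _) _; rewrite !normrZ.
have := ler_wpM2r (normr_ge0 v) (ltW sd); have := ler_wpM2r (normr_ge0 w) (ltW rd).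
set q := eps / _ => h1 h2.
have E : q * (`|v| + `|w| + 1) = eps by rewrite /q divfK // gt_eqF.
have q0 : 0 < q by exact: divr_gt0.
rewrite -[ltRHS]E; lra.
Qed.

(** The mean value theorem is applied in the direction [v] to a difference in the direction [w], and
    then in the direction [w] to [fv]. The left side of the resulting equation is symmetric in [v]
    and [w]. *)
Lemma double_difference f (fv fvw : U -> R) x v w (t : R) (V : set U) :
  0 < t ->
  (forall s r : R, `|s| <= t -> `|r| <= t -> V (x + s *: v + r *: w)) ->
  (forall y, V y -> is_derive y v f (fv y)) ->
  (forall y, V y -> is_derive y w fv (fvw y)) ->
  exists s r : R, [/\ `|s| <= t, `|r| <= t &
    f (x + t *: v + t *: w) - f (x + t *: v) - f (x + t *: w) + f x =
    fvw (x + s *: v + r *: w) * t * t].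
Proof.
move=> t0 Vst hf hfv.
have ineq (s : R) : s \in `[Order.min 0 t, Order.max 0 t]%R -> `|s| <= t.
  rewrite (min_idPl (ltW t0)) (max_idPr (ltW t0)) in_itv /= => /andP[s0 st].
  by rewrite ger0_norm.
have t_le : `|t| <= t by rewrite gtr0_norm.
have zero_le : `|0 : R| <= t by rewrite normr0 ltW.
have [|s /ineq sI Es] := @mvt_abs R (fun s => f (x + s *: v + t *: w) - f (x + s *: v))
  (fun s => fv (x + s *: v + t *: w) - fv (x + s *: v)) 0 t; last first.
  have [|r /ineq rI Er] := @mvt_abs R (fun r => fv (x + s *: v + r *: w))
    (fun r => fvw (x + s *: v + r *: w)) 0 t; last first.
    exists s, r; split => //; move: Es Er; rewrite !scale0r !addr0 !subr0 => Es Er.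
    by rewrite -Er -Es; ring.
  move=> r /ineq rI; apply: is_derive_line.
  by apply: hfv; exact: Vst.
move=> s /ineq sI; apply: pderB.
  have -> : (fun s => f (x + s *: v + t *: w)) = (fun s => f (x + t *: w + s *: v)).
    by apply/funext => s'; rewrite addrAC.
  apply: (@is_derive_line R U f); rewrite addrAC.
  by apply: hf; exact: Vst.
apply: (@is_derive_line R U f); apply: hf.
by rewrite -[x + _]addr0 -(scale0r w); exact: Vst.
Qed.

Lemma schwarz f (fv fw fvw fwv : U -> R) x v w (V : set U) : nbhs x V ->
  (forall y, V y -> is_derive y v f (fv y)) ->
  (forall y, V y -> is_derive y w f (fw y)) ->
  (forall y, V y -> is_derive y w fv (fvw y)) ->
  (forall y, V y -> is_derive y v fw (fwv y)) ->
  {for x, continuous fvw} -> {for x, continuous fwv} -> fvw x = fwv x.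
Proof.
move=> xV hv hw hvw hwv cvw cwv; apply/eqP; rewrite -subr_eq0 -normr_eq0.
apply/negPn/negP => ne0; set d0 := `|_| in ne0.
have d00 : 0 < d0 / 2 by rewrite divr_gt0 // lt_neqAle eq_sym ne0 /d0 normr_ge0.
have H : nbhs x (fun y => [/\ V y, `|fvw x - fvw y| < d0 / 2 & `|fwv x - fwv y| < d0 / 2]).
  move: cvw cwv => /cvgrPdist_lt/(_ _ d00) c1 /cvgrPdist_lt/(_ _ d00) c2.
  by near=> y; split; near: y.
have [d dgt0 dH] := near_plane v w H.
have t0 : 0 < d / 2 by rewrite divr_gt0.
have lt_d (s : R) : `|s| <= d / 2 -> `|s| < d by move=> hs; lra.
have H1 (s r : R) : `|s| <= d / 2 -> `|r| <= d / 2 -> V (x + s *: v + r *: w).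
  by move=> /lt_d h1 /lt_d h2; have [] := dH _ _ h1 h2.
have H2 (s r : R) : `|s| <= d / 2 -> `|r| <= d / 2 -> V (x + s *: w + r *: v).
  by move=> h1 h2; rewrite addrAC; exact: H1.
have [s [r [sd rd E1]]] := double_difference t0 H1 hv hvw.
have [s' [r' [sd' rd' E2]]] := double_difference t0 H2 hw hwv.
have := dH _ _ (lt_d _ sd) (lt_d _ rd); have := dH _ _ (lt_d _ rd') (lt_d _ sd').
(* Both mixed derivatives, at different intermediate points, represent the same double difference;
   continuity at [x] then contradicts the gap [d0]. *)
have E3 : fvw (x + s *: v + r *: w) = fwv (x + r' *: v + s' *: w).
  apply: (@mulIf _ (d / 2)); first by rewrite gt_eqF.
  apply: (@mulIf _ (d / 2)); first by rewrite gt_eqF.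
  rewrite -E1 [x + r' *: v + _]addrAC -E2 [x + _ *: w + _ *: v]addrAC; ring.
rewrite E3; set z := fwv (_ + _) => -[_ _ h1] [_ h2 _].
suff : d0 < d0 by rewrite ltxx.
rewrite {1}/d0 (_ : _ - _ = (fvw x - z) + - (fwv x - z)); last by ring.
by apply: le_lt_trans (ler_normD _ _) _; rewrite normrN [ltRHS]splitr ltrD.
Unshelve. all: by end_near. Qed.

End Schwarz.

(** * Chain rule from continuous partial derivatives *)

Section ChainRule.
Variables (R : realType) (n : nat).
Local Notation e a := (delta_mx ord0 a : 'rV[R]_n).

(** The increment telescopes along the staircase from [y0] to [y], and [q k y] is a partial
    derivative at a mean value point of the [k]-th step. This form of total differentiability
    composes directly with a curve. *)
Lemma caratheodory_partials (F : 'rV[R]_n -> R) (F' : 'I_n -> 'rV[R]_n -> R)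
    (y0 : 'rV[R]_n) :
  (\forall y \near y0, forall k, is_derive y (e k) F (F' k y)) ->
  (forall k, {for y0, continuous (F' k)}) ->
  exists2 q : 'I_n -> 'rV[R]_n -> R,
    (\forall y \near y0,
       F y - F y0 = \sum_k q k y * (y ord0 k - y0 ord0 k)) &
    forall k, q k y @[y --> y0] --> F' k y0.
Proof.
move=> hF cF.
(* The clause on all radii places the intermediate point [z] in every cube around [y0] that contains
   [y]. Hence [z] tends to [y0] with [y], and continuity of [F'] applies. *)
pose good (k : 'I_n) y (c : R) (z : 'rV[R]_n) :=
  (forall r, cube y0 r y -> cube y0 r z) /\ c = F' k z /\
  F (stair y0 y k.+1) - F (stair y0 y k) = c * (y ord0 k - y0 ord0 k).
have [r r0 rF] := nbhs_cube hF.
have ex k y : exists cz : R * 'rV[R]_n, cube y0 r y -> good k y cz.1 cz.2.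
  have [cy|] := pselect (cube y0 r y); last by exists (0, 0).
  have [|t tI E] := @mvt_abs R (fun t => F (stair y0 y k + (t - y0 ord0 k) *: e k))
    (fun t => F' k (stair y0 y k + (t - y0 ord0 k) *: e k)) (y0 ord0 k) (y ord0 k).
  - move=> t tI.
    have -> : (fun s => F (stair y0 y k + (s - y0 ord0 k) *: e k)) =
              (fun s => F (stair y0 y k - y0 ord0 k *: e k + s *: e k)).
      by apply/funext => s; rewrite scalerBl addrCA addrC.
    have E : stair y0 y k + (t - y0 ord0 k) *: e k =
             stair y0 y k - y0 ord0 k *: e k + t *: e k.
      by rewrite scalerBl addrCA addrC.
    rewrite E; apply: is_derive_line; rewrite -E; apply: rF.
    exact: stair_cube_between (cube_refl _ r0) cy tI.
  - pose z := stair y0 y k + (t - y0 ord0 k) *: e k.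
    exists (F' k z, z) => _; split; first last.
      by split=> //=; rewrite -E subrr scale0r addr0 stairS.
    move=> r' cy' /=.
    have r'0 : 0 < r' by apply: le_lt_trans (cy' k); exact: normr_ge0.
    exact: stair_cube_between (cube_refl _ r'0) cy' tI.
pose cz k y := sval (cid (ex k y)).
have czP k y : cube y0 r y -> good k y (cz k y).1 (cz k y).2.
  exact: (svalP (cid (ex k y))).
exists (fun k y => (cz k y).1).
  near=> y.
  have cy : cube y0 r y by near: y; exact: cube_nbhs.
  rewrite -{1}(stairn y0 y) -{2}(stair0 y0 y).
  rewrite -(telescope_sumr (fun k => F (stair y0 y k)) (leq0n n)) big_mkord.
  by apply: eq_bigr => k _; have [_ [_ ->]] := czP k y cy.
move=> k; apply: (@cvgrPdist_lt R R^o _ (nbhs y0) (nbhs_filter y0) _ _).2 => eps eps0.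
have /nbhs_cube[d d0 dF] : nbhs y0 (fun z => `|F' k y0 - F' k z| < eps).
  by have /cvgrPdist_lt/(_ _ eps0) := cF k.
near=> y.
have cy : cube y0 r y by near: y; exact: cube_nbhs.
have cy' : cube y0 d y by near: y; exact: cube_nbhs.
by have [h1 [-> _]] := czP k y cy; apply: dF; exact: h1.
Unshelve. all: by end_near. Qed.

Lemma is_derive_comp_partials (F : 'rV[R]_n -> R) (F' : 'I_n -> 'rV[R]_n -> R)
    (U : normedModType R) (y : U -> 'rV[R]_n) (t v : U) (y' : 'I_n -> R) :
  (\forall z \near y t, forall k, is_derive z (e k) F (F' k z)) ->
  (forall k, {for y t, continuous (F' k)}) ->
  {for (0 : R), continuous (fun h : R => y (h *: v + t))} ->
  (forall k, is_derive t v (fun s => y s ord0 k) (y' k)) ->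
  is_derive t v (F \o y) (\sum_k F' k (y t) * y' k).
Proof.
move=> hF cF cy dy.
have [q qE qc] := caratheodory_partials hF cF.
have cvy : y (h *: v + t) @[h --> (0 : R)^'] --> y t.
  have : y (h *: v + t) @[h --> (0 : R)] --> y t.
    by have := cy; rewrite /prop_for /continuous_at scale0r add0r.
  by apply: cvg_trans; apply: cvg_app; exact: nbhs_dnbhs.
have C : h^-1 *: ((F \o y) (h *: v + t) - (F \o y) t) @[h --> (0 : R)^'] -->
    \sum_k F' k (y t) * y' k.
  apply: (@cvg_trans _ ((\sum_k q k (y (h *: v + t)) * (h^-1 *: (y (h *: v + t) ord0 k - y t ord0 k))) @[h --> (0 : R)^'])).
    apply: near_eq_cvg; near=> h.
    rewrite /= (_ : F (y (h *: v + t)) - F (y t) = \sum_k q k (y (h *: v + t)) * (y (h *: v + t) ord0 k - y t ord0 k)).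
      by rewrite scaler_sumr; apply: eq_bigr => k _; rewrite scalerAr.
    by near: h; exact: (cvy _ qE).
  apply: cvg_big => [|k _]; [exact: add_continuous|apply: cvgM].
    exact: cvg_comp cvy (qc k).
  have [d1 <-] := dy k; exact: d1.
split; first by apply/cvg_ex; exists (\sum_k F' k (y t) * y' k).
exact/cvg_lim.
Unshelve. all: by end_near. Qed.

End ChainRule.

Section PointwiseContinuity.
Variables (R : realType) (T : topologicalType).
Implicit Types (f g : T -> R) (x : T).

Lemma cont_near f g x : (\forall y \near x, f y = g y) ->
  {for x, continuous f} -> {for x, continuous g}.
Proof.
move=> fg cf; rewrite /prop_for /continuous_at -(nbhs_singleton fg).
by apply: cvg_trans cf; exact: near_eq_cvg.
Qed.

Lemma cont_cst (c : R) x : {for x, continuous (fun _ : T => c)}.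
Proof. exact: cvg_cst. Qed.

Lemma contD f g x : {for x, continuous f} -> {for x, continuous g} ->
  {for x, continuous (fun y => f y + g y)}.
Proof. by move=> hf hg; apply: (@cvgD _ R^o). Qed.

Lemma contM f g x : {for x, continuous f} -> {for x, continuous g} ->
  {for x, continuous (fun y => f y * g y)}.
Proof. by move=> hf hg; apply: cvgM. Qed.

Lemma contV f x : f x != 0 -> {for x, continuous f} ->
  {for x, continuous (fun y => (f y)^-1)}.
Proof. by move=> f0 hf; apply: cvgV. Qed.

Lemma cont_comp (h : R -> R) f x : {for x, continuous f} ->
  {for f x, continuous h} -> {for x, continuous (fun y => h (f y))}.
Proof. by move=> hf hh; apply: continuous_comp. Qed.

Lemma cont_lt f x (c : R) : {for x, continuous f} -> f x < c ->
  \forall y \near x, f y < c.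
Proof. by move=> cf fx; apply: (cvgr_lt (f x)). Qed.

Lemma cont_distP f x : {for x, continuous f} <->
  (forall eps : R, 0 < eps -> \forall y \near x, `|f x - f y| < eps).
Proof. exact: (@cvgrPdist_lt R R^o _ (nbhs x) (nbhs_filter x) f (f x)). Qed.

Lemma cont_neq0 f x : {for x, continuous f} -> f x != 0 ->
  \forall y \near x, f y != 0.
Proof.
by move=> cf fx; apply: (@cvgr_neq0 R R^o T (nbhs x) _ f (f x)).
Qed.

End PointwiseContinuity.

(** * Functions of class C^k on an open set of coordinates *)

Section ContinuouslyDifferentiable.
Variables (R : realType) (n : nat).
Implicit Types (V W : set 'rV[R]_n) (f g : 'rV[R]_n -> R) (k : nat).
Local Notation e a := (delta_mx ord0 a : 'rV[R]_n).

(** Continuity is demanded at every order, since derivatives along the axes alone do not imply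
    it. *)
Fixpoint Ck k V f : Prop :=
  (forall x, V x -> {for x, continuous f}) /\
  if k is k'.+1 then
    (forall x a, V x -> derivable f x (e a)) /\
    forall a, Ck k' V (fun x => 'D_(e a) f x)
  else True.

Lemma Ck_continuous k V f x : Ck k V f -> V x -> {for x, continuous f}.
Proof. by case: k => [|k] [h _]; exact: h. Qed.

Lemma Ck_derive k V f x a : Ck k.+1 V f -> V x ->
  is_derive x (e a) f ('D_(e a) f x).
Proof. by move=> [_ [h _]] Vx; exact/derivableP/h. Qed.

Lemma CkS_D k V f a : Ck k.+1 V f -> Ck k V (fun x => 'D_(e a) f x).
Proof. by move=> [_ [_ h]]; exact: h. Qed.

Lemma CkW k V f : Ck k.+1 V f -> Ck k V f.
Proof.
elim: k f => [|k IH] f [h1 [h2 h3]]; first by split.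
by split=> //; split=> // a; apply: IH; exact: h3.
Qed.

Lemma Ck_sub k V W f : V `<=` W -> Ck k W f -> Ck k V f.
Proof.
move=> VW; elim: k f => [|k IH] f; first by move=> [h _]; split => // x /VW; exact: h.
move=> [h1 [h2 h3]]; split; first by move=> x /VW; exact: h1.
by split=> [x a /VW|a]; [exact: h2|exact/IH/h3].
Qed.

Lemma open_near_eq (T : Type) V (f g : 'rV[R]_n -> T) x : open V -> (forall y, V y -> f y = g y) -> V x ->
  \forall y \near x, f y = g y.
Proof.
move=> oV fg Vx; have : nbhs x V by exact: open_nbhs_nbhs.
by apply: filterS => y /fg.
Qed.

Lemma Ck_ext k V f g : open V -> (forall x, V x -> f x = g x) ->
  Ck k V f -> Ck k V g.
Proof.
move=> oV; have C (f' g' : 'rV[R]_n -> R) : (forall x, V x -> f' x = g' x) ->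
    (forall x, V x -> {for x, continuous f'}) -> forall x, V x -> {for x, continuous g'}.
  by move=> fg cf x Vx; apply: cont_near (cf x Vx); exact: open_near_eq oV fg Vx.
elim: k f g => [|k IH] f g fg; first by move=> [h _]; split => //; exact: C fg h.
move=> [h1 [h2 h3]]; split; first exact: C fg h1.
split=> [x a Vx|a].
  apply: near_eq_derivable (h2 x a Vx).
  exact: open_near_eq oV fg Vx.
apply: IH (h3 a) => x Vx; apply: near_eq_derive.
exact: open_near_eq oV fg Vx.
Qed.

Lemma CkS_intro k V f (f' : 'I_n -> 'rV[R]_n -> R) : open V ->
  (forall x, V x -> {for x, continuous f}) ->
  (forall x a, V x -> is_derive x (e a) f (f' a x)) ->
  (forall a, Ck k V (f' a)) -> Ck k.+1 V f.
Proof.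
move=> oV cf df hf'; split=> //; split=> [x a Vx|a]; first by have [] := df x a Vx.
by apply: Ck_ext (hf' a) => // x Vx; have [_ ->] := df x a Vx.
Qed.

Lemma Ck_cst k V (c : R) : open V -> Ck k V (fun=> c).
Proof.
move=> oV; elim: k c => [|k IH] c.
  by split => // x _; exact: cont_cst.
apply: (@CkS_intro _ _ _ (fun _ _ => 0)) => // x _; exact: cont_cst.
Qed.

Lemma Ck_add k V f g : open V -> Ck k V f -> Ck k V g ->
  Ck k V (fun x => f x + g x).
Proof.
move=> oV; elim: k f g => [|k IH] f g hf hg.
  split => // x Vx; apply: contD; [exact: (Ck_continuous hf)|exact: (Ck_continuous hg)].
apply: (@CkS_intro _ _ _ (fun a x => 'D_(e a) f x + 'D_(e a) g x)) => // [x Vx|x a Vx|a].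
- apply: contD; [exact: (Ck_continuous hf)|exact: (Ck_continuous hg)].
- by apply: pderD; [exact: (Ck_derive _ hf)|exact: (Ck_derive _ hg)].
- by apply: IH; exact: CkS_D.
Qed.

Lemma Ck_mul k V f g : open V -> Ck k V f -> Ck k V g ->
  Ck k V (fun x => f x * g x).
Proof.
move=> oV; elim: k f g => [|k IH] f g hf hg.
  split => // x Vx; apply: contM; [exact: (Ck_continuous hf)|exact: (Ck_continuous hg)].
apply: (@CkS_intro _ _ _ (fun a x => 'D_(e a) f x * g x + f x * 'D_(e a) g x))
    => // [x Vx|x a Vx|a].
- apply: contM; [exact: (Ck_continuous hf)|exact: (Ck_continuous hg)].
- by apply: pderM; [exact: (Ck_derive _ hf)|exact: (Ck_derive _ hg)].
- by apply: Ck_add => //; apply: IH; (exact: CkS_D || exact: CkW).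
Qed.

Lemma Ck_opp k V f : open V -> Ck k V f -> Ck k V (fun x => - f x).
Proof.
move=> oV hf; apply: (@Ck_ext _ _ (fun x => -1 * f x)) => // [x _|]; first by rewrite mulN1r.
by apply: Ck_mul => //; exact: Ck_cst.
Qed.

Lemma Ck_sum k V (I : Type) (s : seq I) (P : pred I) (f : I -> 'rV[R]_n -> R) :
  open V -> (forall i, P i -> Ck k V (f i)) ->
  Ck k V (fun x => \sum_(i <- s | P i) f i x).
Proof.
move=> oV hf; elim: s => [|i s IH].
  by apply: Ck_ext (Ck_cst k 0 oV) => // x _; rewrite big_nil.
case Pi : (P i); last by apply: Ck_ext IH => // x _; rewrite big_cons Pi.
by apply: Ck_ext (Ck_add oV (hf i Pi) IH) => // x _; rewrite big_cons Pi.
Qed.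

Lemma Ck_prod k V (I : Type) (s : seq I) (P : pred I) (f : I -> 'rV[R]_n -> R) :
  open V -> (forall i, P i -> Ck k V (f i)) ->
  Ck k V (fun x => \prod_(i <- s | P i) f i x).
Proof.
move=> oV hf; elim: s => [|i s IH].
  by apply: Ck_ext (Ck_cst k 1 oV) => // x _; rewrite big_nil.
case Pi : (P i); last by apply: Ck_ext IH => // x _; rewrite big_cons Pi.
by apply: Ck_ext (Ck_mul oV (hf i Pi) IH) => // x _; rewrite big_cons Pi.
Qed.

Lemma Ck_inv k V f : open V -> (forall x, V x -> f x != 0) -> Ck k V f ->
  Ck k V (fun x => (f x)^-1).
Proof.
move=> oV f0; elim: k => [|k IH] hf.
  by split => // x Vx; apply: contV; [exact: f0|exact: (Ck_continuous hf)].
apply: (@CkS_intro _ _ _ (fun a x => - ((f x)^-1 * (f x)^-1) * 'D_(e a) f x))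
    => // [x Vx|x a Vx|a].
- by apply: contV; [exact: f0|exact: (Ck_continuous hf)].
- rewrite -invfM -expr2; apply: pderV; [exact: f0|exact: (Ck_derive _ hf)].
- have hV := IH (CkW hf).
  apply: Ck_mul => //; last exact: CkS_D.
  by apply: Ck_opp => //; exact: Ck_mul.
Qed.

Lemma Ck_expR k V f : open V -> Ck k V f -> Ck k V (fun x => expR (f x)).
Proof.
move=> oV; elim: k => [|k IH] hf.
  split => // x Vx; apply: cont_comp; first exact: (Ck_continuous hf).
  exact: continuous_expR.
apply: (@CkS_intro _ _ _ (fun a x => expR (f x) * 'D_(e a) f x)) => // [x Vx|x a Vx|a].
- apply: cont_comp; first exact: (Ck_continuous hf).
  exact: continuous_expR.
- by apply: pder_comp; exact: (Ck_derive _ hf).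
- by apply: Ck_mul => //; [exact/IH/CkW|exact: CkS_D].
Qed.

Lemma Ck_schwarz V f x a b : open V -> Ck 2 V f -> V x ->
  'D_(e b) (fun y => 'D_(e a) f y) x = 'D_(e a) (fun y => 'D_(e b) f y) x.
Proof.
move=> oV hf Vx; have xV : nbhs x V by exact: open_nbhs_nbhs.
apply: (@schwarz R _ f (fun y => 'D_(e a) f y) (fun y => 'D_(e b) f y)
  (fun y => 'D_(e b) (fun y => 'D_(e a) f y) y)
  (fun y => 'D_(e a) (fun y => 'D_(e b) f y) y) x (e a) (e b) V xV) => [y Vy|y Vy|y Vy|y Vy||].
- exact: (Ck_derive _ hf).
- exact: (Ck_derive _ hf).
- exact: (Ck_derive _ (CkS_D a hf)).
- exact: (Ck_derive _ (CkS_D b hf)).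
- exact: (Ck_continuous (CkS_D b (CkS_D a hf))).
- exact: (Ck_continuous (CkS_D a (CkS_D b hf))).
Qed.

End ContinuouslyDifferentiable.

(** * Entrywise calculus of matrix-valued functions *)

Section MatrixDerivatives.
Variables (R : realType) (U : normedModType R).
Implicit Types (x v : U).

Definition mder m p (X : U -> 'M[R]_(m, p)) x v (X' : 'M[R]_(m, p)) :=
  forall i j, is_derive x v (fun y => X y i j) (X' i j).

Lemma mder_eq m p (X : U -> 'M[R]_(m, p)) x v X' X'' :
  mder X x v X' -> X' = X'' -> mder X x v X''.
Proof. by move=> h <-. Qed.

Lemma mder_unique m p (X : U -> 'M[R]_(m, p)) x v X' X'' :
  mder X x v X' -> mder X x v X'' -> X' = X''.
Proof. by move=> h1 h2; apply/matrixP => i j; exact: is_derive_unique (h1 i j) (h2 i j). Qed.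

Lemma mder_near m p (X Y : U -> 'M[R]_(m, p)) x v X' :
  (\forall y \near x, X y = Y y) -> mder Y x v X' -> mder X x v X'.
Proof.
move=> XY h i j; apply: is_derive_near (h i j).
by apply: filterS XY => y ->.
Qed.

Lemma mder_cst m p (C : 'M[R]_(m, p)) x v : mder (fun=> C) x v 0.
Proof. by move=> i j; rewrite mxE; exact: pder_cst. Qed.

Lemma mderD m p (X Y : U -> 'M[R]_(m, p)) x v X' Y' :
  mder X x v X' -> mder Y x v Y' -> mder (fun y => X y + Y y) x v (X' + Y').
Proof.
move=> hX hY i j; under eq_fun do rewrite mxE; rewrite mxE; exact: pderD.
Qed.

Lemma mderN m p (X : U -> 'M[R]_(m, p)) x v X' :
  mder X x v X' -> mder (fun y => - X y) x v (- X').
Proof.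
move=> hX i j; under eq_fun do rewrite mxE; rewrite mxE; exact: pderN.
Qed.

Lemma mderB m p (X Y : U -> 'M[R]_(m, p)) x v X' Y' :
  mder X x v X' -> mder Y x v Y' -> mder (fun y => X y - Y y) x v (X' - Y').
Proof. by move=> hX hY; apply: mderD => //; exact: mderN. Qed.

Lemma mderM m p q (X : U -> 'M[R]_(m, p)) (Y : U -> 'M[R]_(p, q)) x v X' Y' :
  mder X x v X' -> mder Y x v Y' ->
  mder (fun y => X y *m Y y) x v (X' *m Y x + X x *m Y').
Proof.
move=> hX hY i j; under eq_fun do rewrite mxE; rewrite !mxE -big_split /=.
by apply: pder_sum => k; exact: pderM.
Qed.

Lemma mderZ m p (f : U -> R) (X : U -> 'M[R]_(m, p)) x v f' X' :
  is_derive x v f f' -> mder X x v X' ->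
  mder (fun y => f y *: X y) x v (f' *: X x + f x *: X').
Proof.
by move=> hf hX i j; under eq_fun do rewrite mxE; rewrite !mxE; exact: pderM.
Qed.

Lemma mderT m p (X : U -> 'M[R]_(m, p)) x v X' :
  mder X x v X' -> mder (fun y => (X y)^T) x v X'^T.
Proof. by move=> hX i j; under eq_fun do rewrite mxE; rewrite mxE. Qed.

(** Differentiating [invmx (X y) *m X y = 1] determines the derivative once it exists; existence
    comes from the cofactor formula, through [mCk_invmx]. *)
Lemma mder_invmx m (X : U -> 'M[R]_m) x v X' Y' :
  (\forall y \near x, X y \in unitmx) -> mder X x v X' ->
  mder (fun y => invmx (X y)) x v Y' -> Y' = - invmx (X x) *m X' *m invmx (X x).
Proof.
move=> uX hX hY; have ux := nbhs_singleton uX.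
have h1 : mder (fun y => invmx (X y) *m X y) x v 0.
  apply: mder_near (mder_cst 1%:M x v).
  by apply: filterS uX => y uy; rewrite mulVmx.
have /(congr1 (mulmxr (invmx (X x)))) := mder_unique h1 (mderM hY hX).
rewrite /= mul0mx mulmxDl mulmxK // => /eqP; rewrite eq_sym addr_eq0 => /eqP ->.
by rewrite !mulNmx.
Qed.

End MatrixDerivatives.

Lemma mder_line (R : realType) (U : normedModType R) m p (X : U -> 'M[R]_(m, p))
    (x v : U) (t : R) X' :
  mder X (x + t *: v) v X' -> mder (fun s : R => X (x + s *: v)) t 1 X'.
Proof.
by move=> h i j; exact: (@is_derive_line R U (fun y => X y i j)).
Qed.

Section MatrixCk.
Variables (R : realType) (n : nat) (V : set 'rV[R]_n).
Hypothesis oV : open V.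
Local Notation e a := (delta_mx ord0 a : 'rV[R]_n).

Definition mCk k m p (X : 'rV[R]_n -> 'M[R]_(m, p)) :=
  forall i j, Ck k V (fun x => X x i j).

Definition pdmx m p (a : 'I_n) (X : 'rV[R]_n -> 'M[R]_(m, p)) (x : 'rV[R]_n) :
    'M[R]_(m, p) := \matrix_(i, j) 'D_(e a) (fun y => X y i j) x.

Lemma mCk_mder k m p (X : 'rV[R]_n -> 'M[R]_(m, p)) x a :
  mCk k.+1 X -> V x -> mder X x (e a) (pdmx a X x).
Proof. by move=> hX Vx i j; rewrite mxE; exact: (Ck_derive _ (hX i j)). Qed.

Lemma mCk_pdmx k m p (X : 'rV[R]_n -> 'M[R]_(m, p)) a :
  mCk k.+1 X -> mCk k (pdmx a X).
Proof.
move=> hX i j; apply: Ck_ext (CkS_D a (hX i j)) => // x _.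
by rewrite mxE.
Qed.

Lemma mCk_ext k m p (X Y : 'rV[R]_n -> 'M[R]_(m, p)) :
  (forall x, V x -> X x = Y x) -> mCk k X -> mCk k Y.
Proof. by move=> XY hX i j; apply: Ck_ext (hX i j) => // x Vx; rewrite XY. Qed.

Lemma mCk_cst k m p (C : 'M[R]_(m, p)) : mCk k (fun=> C).
Proof. by move=> i j; exact: Ck_cst. Qed.

Lemma mCkD k m p (X Y : 'rV[R]_n -> 'M[R]_(m, p)) :
  mCk k X -> mCk k Y -> mCk k (fun x => X x + Y x).
Proof.
move=> hX hY i j; apply: Ck_ext (Ck_add oV (hX i j) (hY i j)) => // x _.
by rewrite mxE.
Qed.

Lemma mCkN k m p (X : 'rV[R]_n -> 'M[R]_(m, p)) :
  mCk k X -> mCk k (fun x => - X x).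
Proof.
move=> hX i j; apply: Ck_ext (Ck_opp oV (hX i j)) => // x _.
by rewrite mxE.
Qed.

Lemma mCkM k m p q (X : 'rV[R]_n -> 'M[R]_(m, p)) (Y : 'rV[R]_n -> 'M[R]_(p, q)) :
  mCk k X -> mCk k Y -> mCk k (fun x => X x *m Y x).
Proof.
move=> hX hY i j.
apply: (@Ck_ext _ _ _ _ (fun x => \sum_l X x i l * Y x l j)) => // [x _|].
  by rewrite mxE.
by apply: Ck_sum => // l _; exact: Ck_mul.
Qed.

Lemma mCkZ k m p (f : 'rV[R]_n -> R) (X : 'rV[R]_n -> 'M[R]_(m, p)) :
  Ck k V f -> mCk k X -> mCk k (fun x => f x *: X x).
Proof.
move=> hf hX i j; apply: Ck_ext (Ck_mul oV hf (hX i j)) => // x _.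
by rewrite mxE.
Qed.

Lemma mCkT k m p (X : 'rV[R]_n -> 'M[R]_(m, p)) :
  mCk k X -> mCk k (fun x => (X x)^T).
Proof.
by move=> hX i j; apply: Ck_ext (hX j i) => // x _; rewrite mxE.
Qed.

Lemma Ck_det k m (X : 'rV[R]_n -> 'M[R]_m) : mCk k X -> Ck k V (fun x => \det (X x)).
Proof.
move=> hX; apply: Ck_sum => // s _; apply: Ck_mul => //; first exact: Ck_cst.
by apply: Ck_prod => // i _; exact: hX.
Qed.

Lemma mCk_invmx k m (X : 'rV[R]_n -> 'M[R]_m) :
  (forall x, V x -> X x \in unitmx) -> mCk k X -> mCk k (fun x => invmx (X x)).
Proof.
move=> uX hX.
apply: (@mCk_ext _ _ _ (fun x => (\det (X x))^-1 *: \adj (X x))) => [x Vx|].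
  by rewrite /invmx uX.
apply: mCkZ.
  apply: Ck_inv => //; last exact: Ck_det.
  by move=> x Vx; move: (uX x Vx); rewrite unitmxE unitfE.
move=> i j.
apply: (@Ck_ext _ _ _ _ (fun x => (-1) ^+ (j + i) * \det (row' j (col' i (X x))))) => // [x _|].
  by rewrite mxE.
apply: Ck_mul => //; first exact: Ck_cst.
apply: Ck_det => a b; apply: Ck_ext (hX (lift j a) (lift i b)) => // x _.
by rewrite !mxE.
Qed.

Lemma mschwarz m p (X : 'rV[R]_n -> 'M[R]_(m, p))
    (X' : 'I_n -> 'rV[R]_n -> 'M[R]_(m, p)) x a b P Q :
  mCk 2 X -> (forall a y, V y -> mder X y (e a) (X' a y)) -> V x ->
  mder (X' a) x (e b) P -> mder (X' b) x (e a) Q -> P = Q.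
Proof.
move=> hX dX Vx ha hb; apply/matrixP => i j.
have E c y : V y -> X' c y i j = 'D_(e c) (fun y => X y i j) y.
  by move=> Vy; have [_ ->] := dX c y Vy i j.
have N c : \forall y \near x, 'D_(e c) (fun y => X y i j) y = X' c y i j.
  by apply: (open_near_eq oV) Vx => y Vy; rewrite E.
have [_ <-] := is_derive_near (N a) (ha i j).
have [_ <-] := is_derive_near (N b) (hb i j).
exact: (Ck_schwarz _ _ oV).
Qed.

End MatrixCk.

(** * Tensor calculus in a coordinate domain *)

Lemma trmxD (R : realType) m p (A B : 'M[R]_(m, p)) : (A + B)^T = A^T + B^T.
Proof. exact: linearD. Qed.
Lemma trmxN (R : realType) m p (A : 'M[R]_(m, p)) : (- A)^T = - A^T.
Proof. exact: linearN. Qed.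
Lemma trmxZ (R : realType) m p (c : R) (A : 'M[R]_(m, p)) : (c *: A)^T = c *: A^T.
Proof. exact: linearZ. Qed.

(* Reduces an equation between matrices to one in the free module on the
   products occurring in it. *)
Ltac mxexpand :=
  repeat rewrite ?trmxD ?trmxN ?trmxZ ?trmx_mul ?trmxK;
  repeat rewrite ?mulmxDl ?mulmxDr ?mulNmx ?mulmxN ?mul0mx ?mulmx0
    ?mul1mx ?mulmx1 -?scalemxAl -?scalemxAr;
  rewrite ?mulmxA.
Ltac mxatoms :=
  repeat match goal with
  | |- context [@mulmx ?S ?m ?n ?p ?A ?B] =>
      let X := fresh "X" in set X := @mulmx S m n p A B; clearbody X
  end.
Ltac mxlin := mxatoms; apply/matrixP => ? ?; rewrite !mxE; ring.

(** * Tensor equations contracted with a kernel vector of a 2-form *)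

Section LinearAlgebra.
Variable R : realType.
Implicit Types (G W K L T : 'M[R]_4) (v w k : 'cV[R]_4).

Definition ec (a : 'I_4) : 'cV[R]_4 := delta_mx a ord0.

Lemma mul_ec m (X : 'M[R]_(m, 4)) a : X *m ec a = col a X.
Proof. by rewrite colE. Qed.

Lemma mul_ecE m (X : 'M[R]_(m, 4)) a i j : (X *m ec a) i j = X i a.
Proof. by rewrite mul_ec mxE. Qed.

Lemma ecE (a i : 'I_4) (j : 'I_1) : ec a i j = (i == a)%:R.
Proof. by rewrite mxE ord1 eqxx andbT. Qed.

Lemma col_ec_ext m (X Y : 'M[R]_(m, 4)) : (forall a, X *m ec a = Y *m ec a) -> X = Y.
Proof.
move=> h; apply/matrixP => i j; have := congr1 (fun Z : 'M[R]_(m, 1) => Z i ord0) (h j).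
by rewrite !mul_ec !mxE.
Qed.

Lemma sum_ec (p : 'cV[R]_4) : p = \sum_a p a ord0 *: ec a.
Proof.
apply/matrixP => i j; rewrite ord1 summxE (bigD1 i) //= mxE ecE eqxx mulr1.
by rewrite big1 ?addr0 // => a ai; rewrite mxE ecE eq_sym (negbTE ai) mulr0.
Qed.

Lemma exists_entry_neq0 m p (X : 'M[R]_(m, p)) : X != 0 -> exists i j, X i j != 0.
Proof.
move=> /eqP X0; apply: contrapT => h; apply: X0; apply/matrixP => i j; rewrite mxE.
by apply/eqP/negPn/negP => Xij; apply: h; exists i, j.
Qed.

(** The right side is unchanged when [L] is replaced by its traceless part [L0]. Contracting [a]
    with [c] expresses [4 L0] through [F], so [L0 nu = 0]; contracting [d] with [nu] then leaves
    [nu_a L0_bc + nu_b L0_ac = 0]. *)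
Lemma traceless_part_eq0 (F : 'M[R]_4) T L (nu : 'cV[R]_4) :
  F *m nu = 0 -> nu != 0 ->
  (forall a b c d, F c d * T a b =
     (a == c)%:R * L b d + (b == c)%:R * L a d
     - (a == d)%:R * L b c - (b == d)%:R * L a c) ->
  L = (4^-1 * \tr L)%:M.
Proof.
move=> Fnu nu0 H.
have cont (a : 'I_4) (f : 'I_4 -> R) : \sum_c (a == c)%:R * f c = f a.
  rewrite (bigD1 a) //= eqxx mul1r big1 ?addr0 // => c ca.
  by rewrite eq_sym (negbTE ca) mul0r.
have tr_eq b d : 4 * (L b d - 4^-1 * \tr L * (b == d)%:R) = \sum_c F c d * T c b.
  transitivity (\sum_c ((c == c)%:R * L b d + (b == c)%:R * L c d
     - (c == d)%:R * L b c - (b == d)%:R * L c c)); last by apply: eq_bigr => c _; rewrite H.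
  have S1 : \sum_(c < 4) (c == c)%:R * L b d = 4 * L b d.
    under eq_bigr do rewrite eqxx mul1r.
    by rewrite sumr_const card_ord mulr_natl.
  have S3 : \sum_(c < 4) (c == d)%:R * L b c = L b d.
    under eq_bigr do rewrite eq_sym.
    by rewrite cont.
  have S4 : \sum_(c < 4) (b == d)%:R * L c c = (b == d)%:R * \tr L by rewrite -mulr_sumr.
  by rewrite !sumrB big_split /= S1 S3 S4 cont; field.
set L0 := L - (4^-1 * \tr L)%:M.
have L0E b d : L0 b d = L b d - 4^-1 * \tr L * (b == d)%:R.
  by rewrite !mxE mulr_natr.
have L0nu : L0 *m nu = 0.
  apply/matrixP => b j; rewrite ord1 [RHS]mxE; apply: (@mulfI _ 4); first by rewrite pnatr_eq0.
  rewrite mulr0 mxE mulr_sumr.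
  transitivity (\sum_c T c b * (F *m nu) c ord0); last first.
    by rewrite Fnu big1 // => c _; rewrite mxE mulr0.
  under eq_bigr do rewrite mulrA L0E tr_eq mulr_suml.
  rewrite exchange_big /=; apply: eq_bigr => c _.
  by rewrite mxE mulr_sumr; apply: eq_bigr => d _; ring.
have key a b c : nu a ord0 * L0 b c + nu b ord0 * L0 a c = 0.
  have E : \sum_d (F c d * T a b) * nu d ord0 = 0.
    transitivity (T a b * (F *m nu) c ord0); last by rewrite Fnu mxE mulr0.
    by rewrite mxE mulr_sumr; apply: eq_bigr => d _; ring.
  have E2 : \sum_d ((a == c)%:R * L0 b d + (b == c)%:R * L0 a d
     - (a == d)%:R * L0 b c - (b == d)%:R * L0 a c) * nu d ord0 = 0.
    rewrite -[RHS]E; apply: eq_bigr => d _; congr (_ * _); rewrite H !L0E.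
    have bw (p q r s : 'I_4) : (p == q)%:R * (r == s)%:R = ((p == q) && (r == s))%:R :> R.
      by rewrite -natrM mulnb.
    rewrite !mulrBr ![(_ == _)%:R * (_ * _)]mulrCA !bw.
    by rewrite [(a == d) && _]andbC [(b == d) && _]andbC; ring.
  have L0nuE b' : \sum_d L0 b' d * nu d ord0 = 0.
    by have := congr1 (fun Z : 'cV[R]_4 => Z b' ord0) L0nu; rewrite !mxE.
  move: E2; under eq_bigr do rewrite !mulrBl !mulrDl.
  rewrite !sumrB big_split /=.
  under eq_bigr do rewrite -mulrA.
  rewrite -mulr_sumr L0nuE mulr0 add0r.
  under eq_bigr do rewrite -mulrA.
  rewrite -mulr_sumr L0nuE mulr0 sub0r.
  under eq_bigr do rewrite -mulrA.
  rewrite (cont a (fun d => L0 b c * nu d ord0)).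
  under eq_bigr do rewrite -mulrA.
  rewrite (cont b (fun d => L0 a c * nu d ord0)) -opprD => /eqP.
  by rewrite oppr_eq0 ![nu _ _ * _]mulrC => /eqP.
(* At an index [i] with [nu_i] nonzero, [a = b = i] kills row [i] of [L0], and then [a = i] kills
   every other row. *)
have [i [j]] := exists_entry_neq0 nu0; rewrite ord1 => nui.
have row0 c : L0 i c = 0.
  have /eqP := key i i c; rewrite -mulr2n mulrn_eq0 /= mulf_eq0 (negbTE nui) /=.
  by move/eqP.
suff : L0 = 0 by rewrite /L0 => /eqP; rewrite subr_eq0 => /eqP.
apply/matrixP => b c; rewrite [RHS]mxE; have /eqP := key i b c.
by rewrite row0 mulr0 addr0 mulf_eq0 (negbTE nui) /= => /eqP.
Qed.

(** Contraction with [nu] gives [c_b nu_a = s delta_ab] with [s = c.nu]. Its trace is [s = 4 s], so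
    [s = 0], and a nonzero component of [nu] finishes. *)
Lemma gradient_eq0 (F : 'M[R]_4) (u : 'cV[R]_4) (c : 'I_4 -> R) (nu : 'cV[R]_4) :
  F *m nu = 0 -> nu != 0 ->
  (forall a b d, F b d * u a ord0 = c b * (a == d)%:R - c d * (a == b)%:R) ->
  forall d, c d = 0.
Proof.
move=> Fnu nu0 H.
have cont (a : 'I_4) (f : 'I_4 -> R) : \sum_d f d * (a == d)%:R = f a.
  rewrite (bigD1 a) //= eqxx mulr1 big1 ?addr0 // => d da.
  by rewrite eq_sym (negbTE da) mulr0.
pose s := \sum_d c d * nu d ord0.
have key a b : c b * nu a ord0 = s * (a == b)%:R.
  apply/eqP; rewrite -subr_eq0; apply/eqP.
  transitivity (\sum_d (F b d * u a ord0) * nu d ord0).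
    under eq_bigr do rewrite H mulrBl.
    rewrite sumrB; congr (_ - _).
      under eq_bigr do rewrite mulrAC.
      by rewrite cont.
    by rewrite mulr_suml; apply: eq_bigr => d _; rewrite mulrAC.
  transitivity (u a ord0 * (F *m nu) b ord0); last by rewrite Fnu mxE mulr0.
  by rewrite mxE mulr_sumr; apply: eq_bigr => d _; ring.
have s0 : s = 0.
  have : \sum_a c a * nu a ord0 = 4 * s.
    under eq_bigr do rewrite key eqxx mulr1.
    by rewrite sumr_const card_ord mulr_natl.
  by rewrite -/s => h; lra.
have [i [j]] := exists_entry_neq0 nu0; rewrite ord1 => nui d.
have /eqP := key i d; rewrite s0 mul0r mulf_eq0 (negbTE nui) orbF.
by move/eqP.
Qed.

End LinearAlgebra.

(** * Ricci identities for a torsion-free connection *)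

Section LocalGeometry.
Variables (R : realType) (V : set 'rV[R]_4).
Hypothesis oV : open V.
Local Notation e a := (delta_mx ord0 a : 'rV[R]_4).
Local Notation ec := (@ec R).

(* [Gam a] has entries [(i, j) |-> Gamma^i_{aj}], so that covariant derivatives
   are matrix equations and [curv k d] has entries [(a, b) |-> R^a_{bkd}]. *)
Variable (Gam : 'I_4 -> 'rV[R]_4 -> 'M[R]_4).
Hypothesis Gam_smooth : forall k a, mCk V k (Gam a).
Hypothesis Gam_sym : forall a b x, V x -> Gam a x *m ec b = Gam b x *m ec a.

Definition curv (k d : 'I_4) (x : 'rV[R]_4) : 'M[R]_4 :=
  pdmx k (Gam d) x - pdmx d (Gam k) x + Gam k x *m Gam d x - Gam d x *m Gam k x.

Lemma curv_smooth i k d : mCk V i (curv k d).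
Proof.
have H a b : mCk V i (pdmx a (Gam b)) by apply: (mCk_pdmx oV); exact: Gam_smooth.
have M a b : mCk V i (fun x => Gam a x *m Gam b x) by exact: (mCkM oV).
by apply: (mCkD oV); [apply: (mCkD oV) => //; apply: (mCkD oV) => //|]; exact: (mCkN oV).
Qed.

Let Gam_der a b x : V x -> mder (Gam a) x (e b) (pdmx b (Gam a) x).
Proof. by move=> Vx; exact: mCk_mder (Gam_smooth 1 a) Vx. Qed.

(** [Z a] stands for the covariant derivative of [X] along the axis [a]. Equality of the mixed
    partial derivatives of [X], with first derivatives substituted, is the identity. *)
Lemma ricci_vector (X : 'rV[R]_4 -> 'cV[R]_4) (Z : 'I_4 -> 'rV[R]_4 -> 'cV[R]_4)
    (Z' : 'I_4 -> 'I_4 -> 'cV[R]_4) x a b :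
  mCk V 2 X -> V x ->
  (forall a y, V y -> mder X y (e a) (- Gam a y *m X y + Z a y)) ->
  (forall a b, mder (Z a) x (e b) (Z' a b)) ->
  curv b a x *m X x = (Z' a b + Gam b x *m Z a x) - (Z' b a + Gam a x *m Z b x).
Proof.
move=> hX Vx dX dZ.
have D : forall a b, mder (fun y => - Gam a y *m X y + Z a y) x (e b)
    (- pdmx b (Gam a) x *m X x + - Gam a x *m (- Gam b x *m X x + Z b x) + Z' a b).
  move=> {a b} a b; apply: mderD => //; apply: mderM; last exact: dX.
  by apply: mderN; exact: Gam_der.
have /eqP := mschwarz oV hX dX Vx (D a b) (D b a).
rewrite -subr_eq0 => /eqP E; apply/eqP; rewrite -subr_eq0; apply/eqP.
rewrite -[RHS]oppr0 -[in RHS]E /curv; mxexpand; mxlin.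
Qed.

Lemma ricci_bivector (A : 'rV[R]_4 -> 'M[R]_4) (l : 'rV[R]_4 -> 'cV[R]_4)
    (L : 'rV[R]_4 -> 'M[R]_4) x a b :
  mCk V 2 A -> V x ->
  (forall a y, V y -> mder A y (e a)
     (- Gam a y *m A y - A y *m (Gam a y)^T + ec a *m (l y)^T + l y *m (ec a)^T)) ->
  (forall a, mder l x (e a) (- Gam a x *m l x + L x *m ec a)) ->
  curv b a x *m A x + A x *m (curv b a x)^T =
  ec a *m (L x *m ec b)^T + (L x *m ec b) *m (ec a)^T
  - ec b *m (L x *m ec a)^T - (L x *m ec a) *m (ec b)^T.
Proof.
move=> hA Vx dA dl.
have D : forall a b, mder (fun y => - Gam a y *m A y - A y *m (Gam a y)^T
      + ec a *m (l y)^T + l y *m (ec a)^T) x (e b)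
    (- pdmx b (Gam a) x *m A x + - Gam a x *m (- Gam b x *m A x - A x *m (Gam b x)^T
        + ec b *m (l x)^T + l x *m (ec b)^T)
     - ((- Gam b x *m A x - A x *m (Gam b x)^T + ec b *m (l x)^T
         + l x *m (ec b)^T) *m (Gam a x)^T + A x *m (pdmx b (Gam a) x)^T)
     + (0 *m (l x)^T + ec a *m (- Gam b x *m l x + L x *m ec b)^T)
     + ((- Gam b x *m l x + L x *m ec b) *m (ec a)^T + l x *m 0)).
  move=> {a b} a b; apply: mderD; last by apply: mderM; [exact: dl|exact: mder_cst].
  apply: mderD; last by apply: mderM; [exact: mder_cst|apply: mderT; exact: dl].
  apply: mderB.
    by apply: mderM; [apply: mderN; exact: Gam_der|exact: dA].
  by apply: mderM; [exact: dA|apply: mderT; exact: Gam_der].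
have /eqP := mschwarz oV hA dA Vx (D a b) (D b a).
rewrite -subr_eq0 => /eqP E; apply/eqP; rewrite -subr_eq0; apply/eqP.
rewrite -[RHS]oppr0 -[in RHS]E /curv; mxexpand.
(* The terms in which the connection acts on a constant basis vector are symmetric in [a] and [b] by
   [Gam_sym], and cancel. *)
rewrite -[_ *m (ec a)^T *m (Gam b x)^T]mulmxA -[_ *m (ec b)^T *m (Gam a x)^T]mulmxA.
rewrite -!trmx_mul (Gam_sym a b Vx) !trmx_mul; mxlin.
Qed.

End LocalGeometry.

Section LinearAlgebraD.
Variable R : realType.
Implicit Types (G : 'M[R]_4) (v w nu : 'cV[R]_4).

Lemma exists_annihilated (r1 r2 : 'rV[R]_4) :
  exists nu : 'cV[R]_4, [/\ nu != 0, r1 *m nu = 0 & r2 *m nu = 0].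
Proof.
pose M := (col_mx r1 r2)^T.
have K0 : kermx M != 0.
  rewrite -mxrank_eq0 mxrank_ker -lt0n subn_gt0.
  by apply: leq_ltn_trans (rank_leq_col _) _.
exists (nz_row (kermx M))^T; split.
- apply: contra K0 => /eqP/(congr1 trmx); rewrite trmxK trmx0 => /eqP.
  by rewrite nz_row_eq0.
- have /sub_kermxP := nz_row_sub (kermx M).
  rewrite /M tr_col_mx mul_mx_row -row_mx0 => /eq_row_mx[h _].
  by apply: trmx_inj; rewrite trmx_mul trmxK trmx0.
- have /sub_kermxP := nz_row_sub (kermx M).
  rewrite /M tr_col_mx mul_mx_row -row_mx0 => /eq_row_mx[_ h].
  by apply: trmx_inj; rewrite trmx_mul trmxK trmx0.
Qed.

Lemma wedge_tr v w : (wedge v w)^T = - wedge v w.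
Proof. by rewrite /wedge; mxexpand; mxlin. Qed.

Lemma lower2_tr G v w : (lower2 G (wedge v w))^T = - lower2 G (wedge v w).
Proof. by rewrite /lower2 !trmx_mul wedge_tr trmxK; mxexpand. Qed.

Lemma lower2_neq0 G v w : G \in unitmx -> wedge v w != 0 -> lower2 G (wedge v w) != 0.
Proof.
move=> uG; apply: contra => /eqP; rewrite /lower2 => h.
have uGT : G^T \in unitmx by rewrite unitmx_tr.
by rewrite -(mulKmx uG (wedge v w)) -(mulmxK uGT (G *m _)) h mul0mx mulmx0.
Qed.

(** The lowered bivector is built from two covectors, which have a common zero in dimension 4. This
    [nu] feeds the two contraction lemmas. *)
Lemma lower2_ker G v w :
  exists nu : 'cV[R]_4, nu != 0 /\ lower2 G (wedge v w) *m nu = 0.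
Proof.
have [nu [nu0 h1 h2]] := exists_annihilated (v^T *m G^T) (w^T *m G^T).
exists nu; split=> //; rewrite /lower2 -!mulmxA /wedge mulmxBl -!mulmxA !(mulmxA v^T).
by rewrite (mulmxA w^T) h1 h2 !mulmx0 subrr mulmx0.
Qed.

End LinearAlgebraD.

(** * Consequences of Sinjukov's equation when the curvature has rank one *)

Section RankOneCurvature.
Variables (R : realType) (V : set 'rV[R]_4).
Hypothesis oV : open V.
Local Notation e a := (delta_mx ord0 a : 'rV[R]_4).
Local Notation ec := (@ec R).
Variables (G : 'rV[R]_4 -> 'M[R]_4) (Gam : 'I_4 -> 'rV[R]_4 -> 'M[R]_4).
Hypothesis Gam_smooth : forall k a, mCk V k (Gam a).
Hypothesis Gam_sym : forall a b x, V x -> Gam a x *m ec b = Gam b x *m ec a.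
Hypothesis G_unit : forall x, V x -> G x \in unitmx.

Definition curv_rank1 (x : 'rV[R]_4) := exists (alpha : R) (v w : 'cV[R]_4),
  [/\ alpha != 0, wedge v w != 0 & forall k d, curv Gam k d x =
    (alpha * lower2 (G x) (wedge v w) k d) *: (wedge v w *m G x)].

Hypothesis curvD : forall x, V x -> curv_rank1 x.

Lemma curv_rank1_neq0 x : V x -> exists k d, curv Gam k d x != 0.
Proof.
move=> Vx; have [al [v [w [al0 W0 H]]]] := curvD Vx.
have /exists_entry_neq0[k [d kd]] := lower2_neq0 (G_unit Vx) W0.
exists k, d; rewrite H scaler_eq0 mulf_eq0 (negbTE al0) (negbTE kd) /=.
apply: contra W0 => /eqP h.
by rewrite -(mulmxK (G_unit Vx) (wedge v w)) h mul0mx.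
Qed.

Variables (A : 'rV[R]_4 -> 'M[R]_4) (l : 'rV[R]_4 -> 'cV[R]_4).
Hypothesis A_smooth : forall k, mCk V k A.
Hypothesis l_smooth : forall k, mCk V k l.
Hypothesis A_der : forall a y, V y -> mder A y (e a)
  (- Gam a y *m A y - A y *m (Gam a y)^T + ec a *m (l y)^T + l y *m (ec a)^T).

Let L (x : 'rV[R]_4) : 'M[R]_4 :=
  \matrix_(b, d) (pdmx d l x + Gam d x *m l x) b ord0.

(** A quarter of the divergence of [l]. As a trace it is visibly smooth, before it is known to be
    the factor in [l^a_{;b} = C delta^a_b]. *)
Definition dilation (x : 'rV[R]_4) : R := 4^-1 * \tr (L x).

Let L_ec x d : L x *m ec d = pdmx d l x + Gam d x *m l x.
Proof. by rewrite mul_ec; apply/matrixP => i j; rewrite ord1 !mxE. Qed.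

Let l_der0 a x : V x -> mder l x (e a) (- Gam a x *m l x + L x *m ec a).
Proof.
move=> Vx; apply: mder_eq (mCk_mder a (l_smooth 1) Vx) _.
by rewrite L_ec; mxexpand; mxlin.
Qed.

(** In the Ricci identity for [A] the curvature side is [F_{dc}] times a fixed tensor [T_{ab}],
    which is the shape treated by [traceless_part_eq0]; the transpose of [F] accounts for the order
    of [c] and [d]. *)
Let L_scalar x : V x -> L x = (dilation x)%:M.
Proof.
move=> Vx; have [al [v [w [al0 W0 H]]]] := curvD Vx.
have [nu [nu0 Fnu]] := lower2_ker (G x) v w.
set F := lower2 (G x) (wedge v w) in H Fnu.
pose T := al *: (wedge v w *m G x *m A x + A x *m (wedge v w *m G x)^T).
apply: (@traceless_part_eq0 _ F^T T (L x) nu) => //.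
  by rewrite lower2_tr mulNmx Fnu oppr0.
move=> a b c d.
have := ricci_bivector oV Gam_smooth Gam_sym c d (A_smooth 2) Vx A_der (fun a => l_der0 a Vx).
move=> /(congr1 (fun Z : 'M[R]_4 => Z a b)).
rewrite H trmxZ -scalemxAl -scalemxAr -scalerDr !mul_ec !mxE !big_ord1 !mxE !eqxx !andbT.
rewrite -!/(F _ _) => h; transitivity (al * F d c * ((wedge v w *m G x *m A x) a b + (A x *m (wedge v w *m G x)^T) a b)).
  by rewrite !mxE; ring.
by rewrite !mxE h; ring.
Qed.

Let dilation_smooth k : Ck k V dilation.
Proof.
apply: Ck_mul => //; first exact: Ck_cst.
apply: Ck_sum => // i _.
apply: (@Ck_ext _ _ _ _ (fun x => (pdmx i l x + Gam i x *m l x) i ord0)) => // [x _|].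
  by rewrite !mxE.
apply: (mCkD oV); first by apply: (mCk_pdmx oV); exact: l_smooth.
exact: (mCkM oV).
Qed.

Lemma l_der a x : V x -> mder l x (e a) (- Gam a x *m l x + dilation x *: ec a).
Proof.
by move=> Vx; apply: mder_eq (l_der0 a Vx) _; rewrite L_scalar // mul_scalar_mx.
Qed.

Let ricci_l x a b : V x -> curv Gam b a x *m l x =
  'D_(e b) dilation x *: ec a - 'D_(e a) dilation x *: ec b.
Proof.
move=> Vx.
rewrite (ricci_vector (Z := fun a y => dilation y *: ec a)
  (Z' := fun a b => 'D_(e b) dilation x *: ec a + dilation x *: 0) oV Gam_smooth a b
  (l_smooth 2) Vx (fun a y Vy => l_der a Vy)).
  by rewrite -!scalemxAr (Gam_sym b a Vx) !scaler0 !addr0; mxatoms;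
    move: (ec a) (ec b) ('D_(e b) _ _) ('D_(e a) _ _) (dilation x) => ? ? ? ? ?; mxlin.
move=> a' b'; apply: mderZ; last exact: mder_cst.
exact: (Ck_derive _ (dilation_smooth 1)).
Qed.

(** Once the derivative of [l] is pure trace, its Ricci identity has only the gradient of [dilation]
    on the right and [F] times a fixed vector on the left, so [gradient_eq0] applies. *)
Lemma dilation_der x a : V x -> is_derive x (e a) dilation 0.
Proof.
move=> Vx; have [al [v [w [al0 W0 H]]]] := curvD Vx.
have [nu [nu0 Fnu]] := lower2_ker (G x) v w.
have := Ck_derive a (dilation_smooth 1) Vx.
rewrite (gradient_eq0 (u := al *: (wedge v w *m G x *m l x)) Fnu nu0
  (c := fun a => 'D_(e a) dilation x)) // => a' b d.
have /(congr1 (fun Z : 'cV[R]_4 => Z a' ord0)) := ricci_l d b Vx.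
rewrite H -scalemxAl !mxE !eqxx !andbT => h.
by rewrite mulrCA mulrA.
Qed.

Lemma curv_l x k d : V x -> curv Gam k d x *m l x = 0.
Proof.
move=> Vx; rewrite ricci_l //.
by have [_ ->] := dilation_der k Vx; have [_ ->] := dilation_der d Vx; rewrite !scale0r subrr.
Qed.

Lemma curv_A x k d : V x -> curv Gam k d x *m A x + A x *m (curv Gam k d x)^T = 0.
Proof.
move=> Vx.
rewrite (ricci_bivector oV Gam_smooth Gam_sym d k (A_smooth 2) Vx A_der (fun a => l_der0 a Vx)).
by rewrite L_scalar // !mul_scalar_mx; mxexpand; mxlin.
Qed.

End RankOneCurvature.

(** * Sinjukov's equation for a projective change of connection *)

Section ProjectiveChange.
Variables (R : realType) (V : set 'rV[R]_4).
Hypothesis oV : open V.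
Local Notation e a := (delta_mx ord0 a : 'rV[R]_4).
Local Notation ec := (@ec R).
Variables (Gam Gam' : 'I_4 -> 'rV[R]_4 -> 'M[R]_4) (G' : 'rV[R]_4 -> 'M[R]_4).
Variables (psi : 'rV[R]_4 -> 'rV[R]_4) (chi : 'rV[R]_4 -> R).
Hypothesis G'_smooth : forall k, mCk V k G'.
Hypothesis G'_unit : forall x, V x -> G' x \in unitmx.
Hypothesis G'_der : forall a x, V x ->
  mder G' x (e a) ((Gam' a x)^T *m G' x + G' x *m Gam' a x).
Hypothesis G'_sym : forall x, V x -> (G' x)^T = G' x.
Hypothesis psi_smooth : forall k, mCk V k psi.
Hypothesis chi_smooth : forall k, Ck k V chi.
Hypothesis chi_der : forall a x, V x -> is_derive x (e a) chi (psi x ord0 a).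
Hypothesis Gam'E : forall a x, V x ->
  Gam' a x = Gam a x + psi x ord0 a *: 1%:M + ec a *m psi x.

Definition sinjukov_tensor (x : 'rV[R]_4) : 'M[R]_4 :=
  expR (2 * chi x) *: invmx (G' x).
Definition sinjukov_vector (x : 'rV[R]_4) : 'cV[R]_4 :=
  - sinjukov_tensor x *m (psi x)^T.

Lemma sinjukov_tensor_smooth k : mCk V k sinjukov_tensor.
Proof.
apply: (mCkZ oV); last exact: (mCk_invmx oV).
by apply: Ck_expR => //; apply: Ck_mul => //; exact: Ck_cst.
Qed.

Lemma sinjukov_vector_smooth k : mCk V k sinjukov_vector.
Proof.
apply: (mCkM oV); last exact: (mCkT oV).
by apply: (mCkN oV); exact: sinjukov_tensor_smooth.
Qed.

(** The inverse of [G'] is parallel for [Gam']. Rewritten with [Gam], this leaves [-2 psi_a] times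
    the inverse, which the derivative of [expR (2 * chi)] cancels, and a symmetrised product with
    [ec a] whose other factor is [sinjukov_vector]. *)
Lemma sinjukov_tensor_der a x : V x -> mder sinjukov_tensor x (e a)
  (- Gam a x *m sinjukov_tensor x - sinjukov_tensor x *m (Gam a x)^T
   + ec a *m (sinjukov_vector x)^T + sinjukov_vector x *m (ec a)^T).
Proof.
move=> Vx; have nV : nbhs x V by exact: open_nbhs_nbhs.
have hinv := mCk_mder a (mCk_invmx oV (k := 1) G'_unit (G'_smooth 1)) Vx.
have := mder_invmx (filterS G'_unit nV) (G'_der a Vx) hinv => Einv.
have hexp : is_derive x (e a) (fun y => expR (2 * chi y))
    (expR (2 * chi x) * (0 * chi x + 2 * psi x ord0 a)).
  by apply: pder_comp; apply: pderM; exact: chi_der.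
apply: mder_eq (mderZ hexp hinv) _.
rewrite Einv /sinjukov_vector /sinjukov_tensor mul0r add0r.
have tinv : (invmx (G' x))^T = invmx (G' x) by rewrite trmx_inv G'_sym.
rewrite mulmxDr mulmxDl !mulNmx !mulmxA mulmxK ?G'_unit // mulVmx ?G'_unit // mul1mx Gam'E //.
move: (expR _) (psi x ord0 a) => E p.
mxexpand; rewrite trmx1 tinv; mxexpand; mxlin.
Qed.

End ProjectiveChange.

(** * The metric in a chart *)

Section Charts.
Variables (R : realType) (M : topologicalType).
Implicit Types (c : chart R M) (p : M) (U : set M) (f : M -> R).
Local Notation e a := (delta_mx ord0 a : 'rV[R]_4).

Definition img c : set 'rV[R]_4 := coord c @` dom c.
Definition cset c U : set 'rV[R]_4 := [set x | img c x /\ U (par c x)].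

Lemma parK c x : img c x -> coord c (par c x) = x.
Proof. by move=> [p dp <-]; rewrite coordK. Qed.

Lemma dom_par c x : img c x -> dom c (par c x).
Proof. by move=> [p dp <-]; rewrite coordK. Qed.

Lemma img_coord c p : dom c p -> img c (coord c p).
Proof. by move=> dp; exists p. Qed.

Lemma open_img c : open (img c).
Proof. exact: img_open. Qed.

Lemma par_near c x U : img c x -> open U -> U (par c x) ->
  \forall y \near x, img c y /\ U (par c y).
Proof.
move=> Vx oU Ux; have h1 : nbhs x (img c).
  by apply: open_nbhs_nbhs; split; [exact: open_img|].
have h2 : nbhs x (par c @^-1` U).
  by apply: (par_continuous Vx); exact: open_nbhs_nbhs.
by move: h1 h2; exact: filterS2.
Qed.

Lemma open_cset c U : open U -> open (cset c U).
Proof. by move=> oU; rewrite openE => x [Vx Ux]; exact: par_near. Qed.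

Lemma img_cset c : img c `<=` cset c (dom c).
Proof. by move=> x Vx; split=> //; exact: dom_par. Qed.

Lemma pd_par c a f x : img c x -> pd c a f (par c x) = 'D_(e a) (f \o par c) x.
Proof. by move=> Vx; rewrite /pd parK. Qed.

Lemma pd_smooth_on c U f a : smooth_on c U f -> smooth_on c U (pd c a f).
Proof. by move=> hf s p Up; have := hf (rcons s a) p Up; rewrite foldr_rcons. Qed.

Lemma smooth_on_Ck c U f k : open U -> smooth_on c U f ->
  Ck k (cset c U) (fun x => f (par c x)).
Proof.
move=> oU; elim: k f => [|k IH] f hf.
  split=> // x [Vx Ux]; have [cf _] := hf [::] _ Ux.
  by apply: continuous_comp => //; exact: par_continuous.
split=> [x [Vx Ux]|].
  have [cf _] := hf [::] _ Ux.
  by apply: continuous_comp => //; exact: par_continuous.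
split=> [x a [Vx Ux]|a].
  by have [_ /(_ a)] := hf [::] _ Ux; rewrite parK.
apply: (@Ck_ext _ _ _ _ (fun x => pd c a f (par c x))); first exact: open_cset.
  by move=> x [Vx _]; rewrite pd_par.
by apply: IH; exact: pd_smooth_on.
Qed.

Lemma smooth_dom_Ck c f k : smooth_on c (dom c) f ->
  Ck k (img c) (fun x => f (par c x)).
Proof.
move=> hf; apply: (Ck_sub (@img_cset c)); apply: smooth_on_Ck => //.
exact: dom_open.
Qed.

End Charts.

(** * Gram matrices and null vectors *)

Section InnerProduct.
Variable R : realType.
Implicit Types (G : 'M[R]_4) (p q r v w : 'cV[R]_4) (a : R).

Lemma ipDl G p q r : ip G (p + q) r = ip G p r + ip G q r.
Proof. by rewrite /ip trmxD !mulmxDl mxE. Qed.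
Lemma ipDr G p q r : ip G r (p + q) = ip G r p + ip G r q.
Proof. by rewrite /ip !mulmxDr mxE. Qed.
Lemma ipZl G a p r : ip G (a *: p) r = a * ip G p r.
Proof. by rewrite /ip trmxZ -!scalemxAl mxE. Qed.
Lemma ipZr G a p r : ip G r (a *: p) = a * ip G r p.
Proof. by rewrite /ip -scalemxAr mxE. Qed.
Lemma ipNl G p r : ip G (- p) r = - ip G p r.
Proof. by rewrite -scaleN1r ipZl mulN1r. Qed.
Lemma ipNr G p r : ip G r (- p) = - ip G r p.
Proof. by rewrite -scaleN1r ipZr mulN1r. Qed.
Lemma ip0l G r : ip G 0 r = 0.
Proof. by rewrite -(scale0r 0) ipZl mul0r. Qed.
Lemma ip0r G r : ip G r 0 = 0.
Proof. by rewrite -(scale0r 0) ipZr mul0r. Qed.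

Lemma ipC G p q : G^T = G -> ip G p q = ip G q p.
Proof.
by move=> sG; rewrite /ip -[in LHS](trmxK (p^T *m G *m q)) [in LHS]mxE !trmx_mul trmxK sG mulmxA.
Qed.

Lemma ip_mx G p q : p^T *m G *m q = (ip G p q)%:M.
Proof. exact: mx11_scalar. Qed.

Lemma ip_eq0 G r : G \in unitmx -> (forall p, ip G p r = 0) -> r = 0.
Proof.
move=> uG h; rewrite -(mulKmx uG r); suff -> : G *m r = 0 by rewrite mulmx0.
apply/matrixP => i j; rewrite ord1; have := h (ec R i).
rewrite /ip -mulmxA /ec trmx_delta -rowE !mxE => {2}<-.
by [].
Qed.

Lemma mul_wedge v w p G : wedge v w *m G *m p = ip G w p *: v - ip G v p *: w.
Proof.
rewrite /wedge !mulmxBl -!mulmxA !(mulmxA _ G p) !ip_mx !mul_mx_scalar //.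
Qed.

Lemma wedge_indep v w (s t : R) : wedge v w != 0 -> s *: v + t *: w = 0 ->
  s = 0 /\ t = 0.
Proof.
move=> W0 h; split; apply/eqP/negPn/negP => s0; move/negP: W0; apply.
- have -> : v = (- t / s) *: w.
    apply: (scalerI s0); rewrite scalerA mulrC divfK //.
    by apply/eqP; rewrite scaleNr -addr_eq0 h.
  by rewrite /wedge trmxZ -scalemxAl -scalemxAr subrr.
- have -> : w = (- s / t) *: v.
    apply: (scalerI s0); rewrite scalerA mulrC divfK //.
    by apply/eqP; rewrite scaleNr -addr_eq0 addrC h.
  by rewrite /wedge trmxZ -scalemxAl -scalemxAr subrr.
Qed.

Lemma wedge_ker G v w p : wedge v w != 0 -> wedge v w *m G *m p = 0 ->
  ip G v p = 0 /\ ip G w p = 0.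
Proof.
move=> W0; rewrite mul_wedge -scaleNr => /(wedge_indep W0)[h1 /eqP].
by rewrite oppr_eq0 => /eqP.
Qed.

Definition frame (q : 'I_4 -> 'cV[R]_4) : 'M[R]_4 := \matrix_(i, j) q j i ord0.
Definition gram G (q : 'I_4 -> 'cV[R]_4) : 'M[R]_4 := \matrix_(i, j) ip G (q i) (q j).
Definition four v w p r : 'I_4 -> 'cV[R]_4 := fun i => nth 0 [:: v; w; p; r] i.

Lemma frame_mul (q : 'I_4 -> 'cV[R]_4) (z : 'cV[R]_4) :
  frame q *m z = \sum_i z i ord0 *: q i.
Proof.
apply/matrixP => i j; rewrite ord1 mxE summxE; apply: eq_bigr => k _.
by rewrite !mxE mulrC.
Qed.

Lemma frame_ip G (q : 'I_4 -> 'cV[R]_4) r i :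
  ((frame q)^T *m G *m r) i ord0 = ip G (q i) r.
Proof.
have -> : q i = col i (frame q) by apply/matrixP => a b; rewrite ord1 !mxE.
rewrite /ip tr_col -row_mul [LHS]mxE [RHS]mxE.
by apply: eq_bigr => k _; rewrite [row _ _ _ _]mxE.
Qed.

Lemma gramE G (q : 'I_4 -> 'cV[R]_4) : gram G q = (frame q)^T *m G *m frame q.
Proof.
apply/matrixP => i j; rewrite mxE -frame_ip [RHS]mxE [LHS]mxE.
by apply: eq_bigr => k _; rewrite [frame _ _ _]mxE.
Qed.

Lemma gram_ext G (q : 'I_4 -> 'cV[R]_4) r r' : gram G q \in unitmx ->
  (forall i, ip G (q i) r = ip G (q i) r') -> r = r'.
Proof.
rewrite gramE unitmx_mul => /andP[uB _] h; rewrite -(mulKmx uB r) -(mulKmx uB r').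
by congr (_ *m _); apply/matrixP => i j; rewrite ord1 !frame_ip.
Qed.

Lemma gram_orthonormal G u x y z : G^T = G -> orthonormal_tetrad G u x y z ->
  gram G (four u x y z) \in unitmx.
Proof.
move=> sG [[uu xx yy zz] [[ux uy uz] [xy yz xz]]].
have [xu yu zu] : [/\ ip G x u = 0, ip G y u = 0 & ip G z u = 0] by rewrite !(ipC _ u) .
have [yx zy zx] : [/\ ip G y x = 0, ip G z y = 0 & ip G z x = 0].
  by split; rewrite ipC.
(* This Gram matrix is diagonal with entries of square one, hence its own inverse; for a null tetrad
   it is likewise an involution, exchanging [l] and [n]. *)
suff E : gram G (four u x y z) *m gram G (four u x y z) = 1%:M by case/mulmx1_unit: E.
apply/matrixP => i j; rewrite mxE !big_ord_recl big_ord0 !mxE.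
by case: i j => [[|[|[|[|i]]]] hi] [[|[|[|[|j]]]] hj] //=;
  rewrite /four /= ?(uu, xx, yy, zz, ux, uy, uz, xy, yz, xz, xu, yu, zu, yx, zy, zx);
  rewrite ?mulr0n ?mulr1n; ring.
Qed.

Lemma gram_null G l n x y : G^T = G -> null_tetrad G l n x y ->
  gram G (four l n x y) \in unitmx.
Proof.
move=> sG [[ln xx yy] [[ll nn lx ly] [nx ny xy]]].
have nl : ip G n l = 1 by rewrite ipC.
have [xl yl xn] : [/\ ip G x l = 0, ip G y l = 0 & ip G x n = 0].
  by split; rewrite ipC.
have [yn yx] : ip G y n = 0 /\ ip G y x = 0 by split; rewrite ipC.
suff E : gram G (four l n x y) *m gram G (four l n x y) = 1%:M by case/mulmx1_unit: E.
apply/matrixP => i j; rewrite mxE !big_ord_recl big_ord0 !mxE.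
by case: i j => [[|[|[|[|i]]]] hi] [[|[|[|[|j]]]] hj] //=;
  rewrite /four /= ?(ll, nn, xx, yy, ln, nl, lx, ly, xy, nx, ny, xl, yl, xn, yn, yx);
  rewrite ?mulr0n ?mulr1n; ring.
Qed.

(** A null vector orthogonal to the timelike [u] vanishes, because the orthogonal complement of [u]
    is positive definite. This is applied to the combination of [p] and [q] that is orthogonal to
    [u]. *)
Lemma null_orthogonal_proportional G p q : lorentz_form G -> p != 0 ->
  ip G p p = 0 -> ip G q q = 0 -> ip G p q = 0 -> exists t : R, q = t *: p.
Proof.
move=> [sG [u [x [y [z T]]]]] p0 pp qq pq; have ug := gram_orthonormal sG T.
have [[uu xx yy zz] [[ux uy uz] [xy yz xz]]] := T.
have def r : ip G u r = 0 -> ip G r r = 0 -> r = 0.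
  move=> ur rr.
  pose r' := ip G x r *: x + ip G y r *: y + ip G z r *: z.
  have E : r = r'.
    apply: (gram_ext ug) => i; rewrite /r' !ipDr !ipZr.
    case: i => [[|[|[|[|i]]]] hi] //=; rewrite /four /=.
    - by rewrite ur ux uy uz; ring.
    - by rewrite xx xy xz; ring.
    - by rewrite (ipC y x) // xy yy yz; ring.
    - by rewrite (ipC z x) // xz (ipC z y) // yz zz; ring.
  have : ip G x r ^+ 2 + ip G y r ^+ 2 + ip G z r ^+ 2 = 0.
    by have := rr; rewrite {1}E /r' !ipDl !ipZl => <-; ring.
  move=> /eqP; rewrite !paddr_eq0 ?addr_ge0 ?sqr_ge0 // !sqrf_eq0.
  move=> /andP[/andP[/eqP h1 /eqP h2] /eqP h3].
  by rewrite E /r' h1 h2 h3 !scale0r !addr0.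
have up : ip G u p != 0 by apply: contra p0 => /eqP /def ->.
exists (ip G u q / ip G u p); apply/eqP; rewrite -subr_eq0; apply/eqP; apply: def.
  by rewrite ipDr ipNr ipZr divfK // subrr.
rewrite ipDl !ipDr !ipNl !ipNr !ipZl !ipZr pp qq (ipC q p) // pq; ring.
Qed.

End InnerProduct.

Section Metric.
Variables (R : realType) (M : topologicalType) (A : set (chart R M)).
Variable g : tensor2_field R M.
Hypothesis Hg : spacetime A g.
Variable c : chart R M.
Hypothesis Ac : A c.
Local Notation e a := (delta_mx ord0 a : 'rV[R]_4).
Local Notation ec := (@ec R).

Lemma lorentz_unit (G : 'M[R]_4) : lorentz_form G -> G \in unitmx.
Proof.
move=> [sG [u [x [y [z /(gram_orthonormal sG)]]]]].
by rewrite gramE !unitmx_mul => /andP[/andP[]].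
Qed.

Definition Gm (x : 'rV[R]_4) : 'M[R]_4 := g c (par c x).
Definition Gam (a : 'I_4) (x : 'rV[R]_4) : 'M[R]_4 :=
  \matrix_(i, j) christoffel g c i a j (par c x).

Let V := img c.
Let oV : open V := @open_img R M c.

Lemma Gm_smooth k : mCk V k Gm.
Proof.
move=> i j; have [_ _ _ [sg _] _] := Hg.
exact: smooth_dom_Ck (sg c Ac i j).
Qed.

Lemma Gm_sym x : V x -> (Gm x)^T = Gm x.
Proof.
move=> Vx; have [_ _ _ _ lg] := Hg.
by have [] := lg c (par c x) Ac (dom_par Vx).
Qed.

Lemma Gm_unit x : V x -> Gm x \in unitmx.
Proof.
move=> Vx; have [_ _ _ _ lg] := Hg.
exact: lorentz_unit (lg c (par c x) Ac (dom_par Vx)).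
Qed.

Let Gd k i j x := 'D_(e k) (fun y => Gm y i j) x.

Let Gd_sym k i j x : V x -> Gd k i j x = Gd k j i x.
Proof.
move=> Vx; apply: near_eq_derive; apply: (open_near_eq oV) Vx => y Vy.
by rewrite -[in LHS](Gm_sym Vy) mxE.
Qed.

Let Cm (a : 'I_4) (x : 'rV[R]_4) : 'M[R]_4 := \matrix_(b, j)
  (2^-1 * (Gd a b j x + Gd j b a x - Gd b a j x)).

Let GamE a x : V x -> Gam a x = invmx (Gm x) *m Cm a x.
Proof.
move=> Vx; apply/matrixP => i j; rewrite !mxE /christoffel mulr_sumr.
by apply: eq_bigr => k _; rewrite !mxE !pd_par // mulrCA.
Qed.

Lemma Gam_smooth k a : mCk V k (Gam a).
Proof.
apply: (@mCk_ext _ _ _ oV _ _ _ (fun x => invmx (Gm x) *m Cm a x)) => [x Vx|].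
  by rewrite GamE.
have hd i j l : Ck k V (Gd i j l) by exact: CkS_D (Gm_smooth k.+1 j l).
apply: (mCkM oV); first exact: (mCk_invmx oV Gm_unit (Gm_smooth k)).
move=> b j; apply: (@Ck_ext _ _ _ _
  (fun x => 2^-1 * (Gd a b j x + Gd j b a x + - Gd b a j x))) => // [x _|].
  by rewrite mxE.
apply: Ck_mul => //; first exact: Ck_cst.
by apply: Ck_add => //; [exact: Ck_add|exact: Ck_opp].
Qed.

Lemma Gam_sym a b x : V x -> Gam a x *m ec b = Gam b x *m ec a.
Proof.
move=> Vx; rewrite !GamE // -!mulmxA; congr (_ *m _); rewrite !mul_ec.
apply/matrixP => i j; rewrite !mxE (Gd_sym i a b Vx); ring.
Qed.

Lemma Gm_der a x : V x ->
  mder Gm x (e a) ((Gam a x)^T *m Gm x + Gm x *m Gam a x).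
Proof.
move=> Vx; have E : Gm x *m Gam a x = Cm a x by rewrite GamE // mulKVmx ?Gm_unit.
have ET : (Gam a x)^T *m Gm x = (Cm a x)^T by rewrite -E trmx_mul Gm_sym.
rewrite E ET; apply: mder_eq (mCk_mder a (Gm_smooth 1) Vx) _.
apply/matrixP => i j; rewrite !mxE -/(Gd a i j x).
by rewrite (Gd_sym a j i Vx) (Gd_sym j i a Vx) (Gd_sym i j a Vx); field.
Qed.

Lemma riemannE a b k d x : V x ->
  riemann g c a b k d (par c x) = curv Gam k d x a b.
Proof.
move=> Vx; rewrite /riemann !pd_par // !mxE.
have E i j l : christoffel g c i j l \o par c = (fun y => Gam j y i l).
  by apply/funext => y; rewrite mxE.
rewrite !E sumrB -addrA; congr (_ + (_ - _)).
  by apply: eq_bigr => i _; rewrite !mxE.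
by apply: eq_bigr => i _; rewrite !mxE.
Qed.

Definition curv_nature (N : nature) (x : 'rV[R]_4) :=
  exists (alpha : R) (v w : 'cV[R]_4),
  [/\ alpha != 0, wedge v w != 0, has_nature (Gm x) (blade v w) N &
    forall k d, curv Gam k d x =
      (alpha * lower2 (Gm x) (wedge v w) k d) *: (wedge v w *m Gm x)].

Lemma curv_natureP N x : V x -> curvature_nature g c (par c x) N -> curv_nature N x.
Proof.
move=> Vx [al [v [w [al0 W0 H HN]]]]; exists al, v, w; split=> // k d.
have -> : wedge v w *m Gm x = invmx (Gm x) *m lower2 (Gm x) (wedge v w).
  by rewrite /lower2 -mulmxA mulKmx ?Gm_unit // Gm_sym.
rewrite scalemxAr -[LHS](mulKmx (Gm_unit Vx)); congr (_ *m _).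
apply/matrixP => a b; rewrite [RHS]mxE mulrAC -H /riemann_down [LHS]mxE.
by apply: eq_bigr => i _; rewrite -riemannE.
Qed.

Lemma curv_nature_rank1 N x : curv_nature N x -> curv_rank1 Gm Gam x.
Proof. by move=> [al [v [w [h1 h2 _ h3]]]]; exists al, v, w. Qed.

End Metric.

(** * Uniqueness for linear differential equations *)

Section Uniqueness.
Variable R : realType.

(** Gronwall's argument: the squared length [f] of [h] satisfies [f' <= K f], so [f] times
    [expR (- K * t)] does not increase from its initial value 0. Summing
    [2 C |p| |q| <= C (p^2 + q^2)] over all pairs of entries gives [K = 2 C n]. *)
Lemma linear_ode_zero n (h : R -> 'cV[R]_n) (B : R -> 'M[R]_n) (C : R) :
  (forall t : R, t \in `[0, 1]%R -> mder h t 1 (B t *m h t)) ->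
  (forall (t : R) i j, t \in `[0, 1]%R -> `|B t i j| <= C) ->
  h 0 = 0 -> h 1 = 0.
Proof.
move=> dh hB h0.
pose f t := \sum_i h t i ord0 * h t i ord0.
pose f' t := \sum_i ((B t *m h t) i ord0 * h t i ord0 + h t i ord0 * (B t *m h t) i ord0).
pose K := 2 * C * n%:R.
have f_ge0 t : 0 <= f t by apply: sumr_ge0 => i _; rewrite -expr2 sqr_ge0.
have df (t : R) : t \in `[0, 1]%R -> is_derive t 1 f (f' t).
  by move=> tI; apply: pder_sum => i; apply: pderM; exact: dh.
have f'_le (t : R) : t \in `[0, 1]%R -> f' t <= K * f t.
  move=> tI; have E : K * f t = \sum_i \sum_j (C * (h t i ord0 ^+ 2 + h t j ord0 ^+ 2)).
    have -> : f t = \sum_i h t i ord0 ^+ 2 by apply: eq_bigr => i _; rewrite expr2.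
    under [RHS]eq_bigr do rewrite -mulr_sumr big_split /= sumr_const card_ord.
    rewrite -mulr_sumr big_split /= sumr_const card_ord sumrMnl /K.
    by move: (\sum_i _) => S; rewrite -(mulr_natr S n); ring.
  rewrite E; apply: ler_sum => i _.
  rewrite [h t i ord0 * _]mulrC -mulr2n mxE mulr_suml -sumrMnl; apply: ler_sum => j _.
  have := hB t i j tI; set b := B t i j; set p := h t i ord0; set q := h t j ord0 => bC.
  have C0 : 0 <= C by apply: le_trans bC.
  have h1 : b * q * p <= C * (`|q| * `|p|).
    by apply: le_trans (ler_norm _) _; rewrite -mulrA normrM [`|q * p|]normrM ler_wpM2r // mulr_ge0.
  have h3 : 2 * (`|q| * `|p|) <= p ^+ 2 + q ^+ 2.
    rewrite -subr_ge0 -(real_normK (num_real p)) -(real_normK (num_real q)).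
    have := sqr_ge0 (`|p| - `|q|); rewrite sqrrB; lra.
  by have := ler_wpM2l C0 h3; rewrite mulr2n; lra.
pose F t := f t * expR (- K * t).
pose F' t := f' t * expR (- K * t) + f t * (expR (- K * t) * (0 * t + - K * 1)).
have dF (t : R) : t \in `[0, 1]%R -> is_derive t 1 F (F' t).
  move=> tI; apply: pderM; first exact: df.
  apply: pder_comp; apply: pderM; exact: is_derive_id.
have dF' (t : R) : t \in `[Order.min 0 1, Order.max 0 1]%R -> is_derive t 1 F (F' t).
  by rewrite (min_idPl ler01) (max_idPr ler01); exact: dF.
have [t tI E] := @mvt_abs R F F' 0 1 dF'.
have F0 : F 0 = 0.
  by rewrite /F /f h0 big1 ?mul0r // => i _; rewrite mxE mul0r.
rewrite (min_idPl ler01) (max_idPr ler01) in tI.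
have F1 : f 1 * expR (- K * 1) <= 0.
  have -> : f 1 * expR (- K * 1) = F' t by rewrite -/(F 1) -[F 1]subr0 -F0 E subr0 mulr1.
  have := f'_le t tI; have := expR_gt0 (- K * t); rewrite /F'; set x := expR _ => x0 h1.
  have -> : f' t * x + f t * (x * (0 * t + - K * 1)) = - ((K * f t - f' t) * x) by ring.
  by rewrite oppr_le0; apply: mulr_ge0; [rewrite subr_ge0|exact: ltW].
have f1 : f 1 = 0.
  apply/eqP; rewrite eq_le f_ge0 andbT.
  by rewrite pmulr_lle0 ?expR_gt0 in F1.
apply/matrixP => i j; rewrite ord1 [RHS]mxE; apply/eqP; rewrite -sqrf_eq0 expr2.
move: f1; rewrite /f => /eqP; rewrite psumr_eq0; last by move=> k _; rewrite -expr2 sqr_ge0.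
by move=> /allP/(_ i); rewrite mem_index_enum => /(_ isT).
Qed.

End Uniqueness.

Section BoundedCube.
Variables (R : realType) (m p : nat).

Lemma near_bounded (T : topologicalType) (I : finType) (X : I -> T -> 'M[R]_(m, p)) x :
  (forall a i j, {for x, continuous (fun y => X a y i j)}) ->
  exists2 C : R, 0 < C & \forall y \near x, forall a i j, `|X a y i j| < C.
Proof.
move=> cX; pose C := \sum_a \sum_i \sum_j `|X a x i j| + 1.
have S0 a i : 0 <= \sum_j `|X a x i j| by apply: sumr_ge0.
have S1 a : 0 <= \sum_i \sum_j `|X a x i j| by apply: sumr_ge0.
have C0 : 0 < C by rewrite /C ltr_wpDl // sumr_ge0.
exists C => //; apply: filter_forall => a; apply: filter_forall => i.
apply: filter_forall => j; apply: (@cont_lt _ _ (fun y => `|X a y i j|)).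
  by apply: (@cont_comp _ _ (fun t => `|t|)) => //; exact: norm_continuous.
rewrite /C ltr_pwDr // (bigD1 a) //= (bigD1 i) //= (bigD1 j) //= -!addrA ler_wpDr //.
rewrite addr_ge0 ?sumr_ge0 // addr_ge0 ?sumr_ge0 //.
Qed.

End BoundedCube.

Lemma bounded_cube (R : realType) (V : set 'rV[R]_4) m p (I : finType)
    (X : I -> 'rV[R]_4 -> 'M[R]_(m, p)) x :
  open V -> (forall a, mCk V 0 (X a)) -> V x ->
  exists C r : R, [/\ 0 < C, 0 < r, cube x r `<=` V &
    forall y a i j, cube x r y -> `|X a y i j| <= C].
Proof.
move=> oV sX Vx.
have [C C0 hC] := @near_bounded R m p _ I X x (fun a i j => Ck_continuous (sX a i j) Vx).
have nV : nbhs x V by exact: open_nbhs_nbhs.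
have [r r0 hr] := nbhs_cube (filterI nV hC).
exists C, r; split=> // [y /hr[]//|y a i j /hr[_ h]].
exact/ltW/h.
Qed.

Lemma cube_segment (R : realType) n (x y : 'rV[R]_n) (r s t : R) a :
  cube x r y -> cube x r (y + s *: delta_mx ord0 a) -> t \in `[0, 1]%R ->
  cube x r (y + (t * s) *: delta_mx ord0 a).
Proof.
move=> cy cys /[!in_itv] /andP[t0 t1] i; have := cys i; have := cy i; rewrite !mxE eqxx /=.
case: (i == a); rewrite ?mulr0 ?addr0 ?mulr1 // !ltr_norml => /andP[h1 h2] /andP[h3 h4].
have [s0|/ltW s0] := leP 0 s.
  have := mulr_ge0 t0 s0; have := ler_piMl s0 t1.
  by move: (t * s) => ts ? ?; apply/andP; split; lra.
have := mulr_ge0_le0 t0 s0; have := ler_niMl s0 t1.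
by move: (t * s) => ts ? ?; apply/andP; split; lra.
Qed.

Lemma pder_segment (R : realType) n (f : 'rV[R]_n -> R) y (s t : R) a f' :
  is_derive (y + (t * s) *: delta_mx ord0 a) (delta_mx ord0 a) f f' ->
  is_derive t 1 (fun t : R => f (y + (t * s) *: delta_mx ord0 a)) (f' * s).
Proof.
move=> h; have ht : is_derive t 1 (fun t : R => t * s) s.
  have := pderM (is_derive_id t 1) (pder_cst s t 1).
  by move/is_derive_eq; apply; rewrite mul1r mulr0 addr0.
apply: (@pder_comp _ _ (fun u => f (y + u *: delta_mx ord0 a))) ht _.
exact: is_derive_line h.
Qed.

Lemma mder_segment (R : realType) n m p (X : 'rV[R]_n -> 'M[R]_(m, p)) y (s t : R) a X' :
  mder X (y + (t * s) *: delta_mx ord0 a) (delta_mx ord0 a) X' ->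
  mder (fun t : R => X (y + (t * s) *: delta_mx ord0 a)) t 1 (s *: X').
Proof.
move=> h i j; rewrite mxE mulrC.
exact: (@pder_segment R n (fun z => X z i j)).
Qed.

Lemma derive0_cube_const (R : realType) n (f : 'rV[R]_n -> R) x (r : R) :
  (forall y a, cube x r y -> is_derive y (delta_mx ord0 a) f 0) ->
  forall y, cube x r y -> 0 < r -> f y = f x.
Proof.
move=> df y cy r0.
apply: (@cube_ind R n (fun z => f z = f x) x r _ x) => //; last exact: cube_refl.
move=> z a s cz czs <-; apply/eqP; rewrite -subr_eq0; apply/eqP.
have dseg (t : R) : t \in `[Order.min 0 1, Order.max 0 1]%R ->
    is_derive t 1 (fun t : R => f (z + (t * s) *: delta_mx ord0 a)) (0 * s).
  rewrite (min_idPl ler01) (max_idPr ler01) => tI; apply: pder_segment.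
  by apply: df; exact: cube_segment.
have [t _ E] := mvt_abs dseg.
by move: E; rewrite mul1r !mul0r scale0r addr0.
Qed.

(** * Linear algebra of null simple bivectors *)

Section NullBlade.
Variable R : realType.
Variables (G : 'M[R]_4) (v w : 'cV[R]_4).
Hypothesis LG : lorentz_form G.
Hypothesis W0 : wedge v w != 0.
Hypothesis nullW : has_nature G (blade v w) Null.

Let sG : G^T = G := LG.1.
Let uG : G \in unitmx := lorentz_unit LG.

(** The null direction [n] of the blade is orthogonal to the blade and, lying in it, to [k1] and
    [k2]. So [v], [w], [k1], [k2] all lie in the hyperplane orthogonal to [n] and are dependent. *)
Lemma null_blade_gram k1 k2 :
  wedge v w *m G *m k1 = 0 -> wedge v w *m G *m k2 = 0 ->
  ip G k1 k1 * ip G k2 k2 = ip G k1 k2 ^+ 2.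
Proof.
move=> /(wedge_ker W0)[v1 w1] /(wedge_ker W0)[v2 w2].
have [n [[s [t nE]] n0 nB]] := nullW.
have nv : ip G n v = 0 by apply: nB; exists 1, 0; rewrite scale1r scale0r addr0.
have nw : ip G n w = 0 by apply: nB; exists 0, 1; rewrite scale1r scale0r add0r.
pose B := frame (four v w k1 k2).
have : \det B = 0.
  apply/eqP/det0P; exists (n^T *m G).
    apply: contra n0 => /eqP h; apply/eqP/(ip_eq0 uG) => p.
    by rewrite ipC // /ip h mul0mx mxE.
  apply/trmx_inj; rewrite trmx_mul trmx0 trmx_mul trmxK sG mulmxA.
  apply/matrixP => i j; rewrite ord1 [RHS]mxE frame_ip.
  case: i => [[|[|[|[|i]]]] hi] //=; rewrite /four /=.
  - by rewrite ipC.
  - by rewrite ipC.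
  - by rewrite nE ipDr !ipZr ipC // v1 ipC // w1; ring.
  - by rewrite nE ipDr !ipZr ipC // v2 ipC // w2; ring.
rewrite -det_tr => /eqP/det0P[z z0 /(congr1 trmx)].
rewrite trmx_mul trmxK trmx0 frame_mul !big_ord_recl big_ord0 addr0 /four /=.
set z1 := z^T _ _; set z2 := z^T _ _; set z3 := z^T _ _; set z4 := z^T _ _ => E.
(* Pairing the relation with [k1] and [k2] puts [(z3, z4)] in the kernel of their Gram matrix. If
   both coefficients vanish, the relation contradicts the independence of [v] and [w]. *)
have Ek k : ip G v k = 0 -> ip G w k = 0 -> z3 * ip G k1 k + z4 * ip G k2 k = 0.
  move=> vk wk; have := congr1 (fun r => ip G r k) E.
  by rewrite ip0l !ipDl !ipZl vk wk => <-; ring.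
have E1 := Ek _ v1 w1; have E2 := Ek _ v2 w2; rewrite (ipC k2 k1) // in E1.
have [z30|z30] := eqVneq z3 0; last first.
  apply: (mulfI z30); rewrite expr2.
  transitivity ((z3 * ip G k1 k1) * ip G k2 k2); first by ring.
  transitivity ((z3 * ip G k1 k2) * ip G k1 k2); last by ring.
  move/eqP: E1; rewrite addr_eq0 => /eqP ->; move/eqP: E2; rewrite addr_eq0 => /eqP ->; ring.
have [z40|z40] := eqVneq z4 0; last first.
  apply: (mulfI z40); rewrite expr2.
  transitivity ((z4 * ip G k2 k2) * ip G k1 k1); first by ring.
  transitivity ((z4 * ip G k1 k2) * ip G k1 k2); last by ring.
  move/eqP: E1; rewrite addrC addr_eq0 => /eqP ->; move/eqP: E2.
  by rewrite addrC addr_eq0 => /eqP ->; ring.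
move: E; rewrite z30 z40 !scale0r !addr0 => /(wedge_indep W0)[z10 z20].
case/eqP: z0; apply/matrixP => i j; rewrite ord1 [RHS]mxE.
move: z10 z20 z30 z40; rewrite /z1 /z2 /z3 /z4 !mxE => z10 z20 z30 z40.
case: j => [[|[|[|[|j]]]] hj] //; [rewrite -[RHS]z10|rewrite -[RHS]z20|rewrite -[RHS]z30|
  rewrite -[RHS]z40]; congr (z _ _); exact/val_inj.
Qed.

(* A null vector annihilated by a null bivector spans the null direction of its
   blade. *)
Lemma null_kernel_blade (l : 'cV[R]_4) : l != 0 -> ip G l l = 0 -> wedge v w *m G *m l = 0 ->
  exists x : 'cV[R]_4, [/\ wedge v w = wedge l x, ip G l x = 0 & ip G x x != 0].
Proof.
move=> l0 ll Wl; have [vl wl] := wedge_ker W0 Wl.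
have [n [[s [t nE]] n0 nB]] := nullW.
have nn : ip G n n = 0 by apply: nB; exists s, t.
have nl : ip G l n = 0 by rewrite nE ipDr !ipZr ipC // vl ipC // wl; ring.
have [tau lE] := null_orthogonal_proportional LG l0 ll nn nl.
have tau0 : tau != 0 by apply: contra n0 => /eqP h; rewrite lE h scale0r.
have {}lE : l = (s / tau) *: v + (t / tau) *: w.
  apply: (scalerI tau0); rewrite -lE nE scalerDr !scalerA.
  by rewrite ![tau * _]mulrC !divfK.
suff [x xE lx] : exists2 x, wedge v w = wedge l x & ip G l x = 0.
  exists x; split=> //; apply/negP => /eqP xx.
  have [tau' xl] := null_orthogonal_proportional LG l0 ll xx lx.
  by move/eqP: W0; apply; rewrite xE xl /wedge trmxZ -scalemxAl -scalemxAr subrr.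
move: (s / tau) (t / tau) lE => p q lE.
have [p0|p0] := eqVneq p 0.
  have q0 : q != 0 by apply: contra l0 => /eqP h; rewrite lE p0 h !scale0r addr0.
  exists (- q^-1 *: v); last by rewrite ipZr ipC // vl mulr0.
  rewrite lE p0 scale0r add0r /wedge !trmxZ -!scalemxAl -!scalemxAr !scalerA.
  by rewrite mulNr mulVf // mulrN mulfV // !scaleN1r opprK addrC.
exists (p^-1 *: w); last by rewrite ipZr ipC // wl mulr0.
rewrite lE /wedge trmxD !trmxZ mulmxDl mulmxDr -!scalemxAl -!scalemxAr !scalerA.
rewrite mulfV // mulVf // !scale1r [q / p]mulrC opprD addrACA subrr addr0 //.
Qed.

(** With the blade spanned by [l] and [x], the bivector sends [x] to a nonzero multiple of [l].
    Commutation makes [l] an eigenvector of [Q = P G], and self-adjointness makes [x] one with the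
    same eigenvalue. The square of the bivector endomorphism survives because [x] is not null. *)
Lemma null_commutant (P : 'M[R]_4) (l : 'cV[R]_4) : P^T = P ->
  wedge v w *m G *m P = P *m G *m wedge v w ->
  l != 0 -> ip G l l = 0 -> wedge v w *m G *m l = 0 ->
  exists phi : R, [/\ P *m G *m l = phi *: l,
    P *m G *m wedge v w = phi *: wedge v w & wedge v w *m G *m wedge v w != 0].
Proof.
move=> sP com l0 ll Wl; have [x [WE lx xx]] := null_kernel_blade l0 ll Wl.
have xl : ip G x l = 0 by rewrite ipC.
pose Q (p : 'cV[R]_4) := P *m G *m p.
have QD p q : Q (p + q) = Q p + Q q by rewrite /Q mulmxDr.
have QZ a p : Q (a *: p) = a *: Q p by rewrite /Q -scalemxAr.
have QC p q : ip G (Q p) q = ip G p (Q q).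
  by rewrite /ip /Q !trmx_mul sP sG !mulmxA.
have WG p : wedge v w *m G *m p = ip G x p *: l - ip G l p *: x.
  by rewrite WE mul_wedge.
have comG p : Q (wedge v w *m G *m p) = wedge v w *m G *m Q p.
  by rewrite /Q !mulmxA -com.
have [m0 m0l] : exists m0, ip G l m0 != 0.
  apply: contrapT => h; move/eqP: l0; apply; apply: (ip_eq0 uG) => p.
  by rewrite ipC //; apply/eqP/negPn/negP => hp; apply: h; exists p.
have [m lm] : exists m, ip G l m = 1.
  by exists ((ip G l m0)^-1 *: m0); rewrite ipZr mulVf.
have indep a b : a *: l - b *: x = 0 -> a = 0 /\ b = 0.
  have W0' : wedge l x != 0 by rewrite -WE.
  rewrite -scaleNr => /(wedge_indep W0')[h1 /eqP].
  by rewrite oppr_eq0 => /eqP.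
have [xQl lQl] : ip G x (Q l) = 0 /\ ip G l (Q l) = 0.
  by apply: indep; rewrite -WG -comG Wl /Q mulmx0.
have Ql : Q l = (ip G x (Q x) / ip G x x) *: l.
  apply: (scalerI xx); rewrite scalerA mulrC divfK // -QZ.
  have := comG x; rewrite !WG lx scale0r subr0 => ->.
  by rewrite -[ip G l (Q x)]QC (ipC (Q l) x) // xQl scale0r subr0.
set phi := ip G x (Q x) / ip G x x in Ql.
have Qx0 : Q x = phi *: x + (phi * ip G x m - ip G x (Q m)) *: l.
  have := comG m; rewrite !WG lm scale1r -scaleN1r QD !QZ Ql.
  rewrite -[ip G l (Q m)]QC Ql ipZl lm mulr1 => h.
  have -> : Q x = ip G x m *: (phi *: l) - (ip G x m *: (phi *: l) + -1 *: Q x).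
    by rewrite opprD addrA subrr add0r scaleN1r opprK.
  rewrite h; apply/matrixP => i j; rewrite !mxE; ring.
(* Pairing [Qx0] with [m] equates the coefficient of [l] with its own opposite, since [Q] is
   self-adjoint and [l.m = 1]. *)
have Qx : Q x = phi *: x.
  have s0 : phi * ip G x m - ip G x (Q m) = 0.
    have := congr1 (fun p => ip G p m) Qx0; rewrite ipDl !ipZl lm QC; lra.
  by rewrite Qx0 s0 scale0r addr0.
exists phi; split => //.
  by rewrite WE /wedge mulmxBr !mulmxA -!/(Q _) Ql Qx -!scalemxAl -scalerBr.
have -> : wedge v w *m G *m wedge v w = - ip G x x *: (l *m l^T).
  rewrite {2}WE /wedge mulmxBr !mulmxA -/(wedge v w) !WG xl ll lx.
  by rewrite !scale0r subrr mul0mx sub0r subr0 -scalemxAl scaleNr.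
rewrite scaler_eq0 oppr_eq0 (negbTE xx) /=.
have [i [j lij]] := exists_entry_neq0 l0; apply/negP => /eqP.
move=> /matrixP/(_ i i); rewrite !mxE big_ord1 mxE => /eqP.
by rewrite mulf_eq0 orbb; rewrite ord1 in lij; rewrite (negbTE lij).
Qed.

End NullBlade.

(** * Projectively related metrics *)

Section ProjectivePair.
Variables (R : realType) (M : topologicalType) (A : set (chart R M)).
Variables (g g' : tensor2_field R M) (N : nature).
Hypothesis Hg : spacetime A g.
Hypothesis Hg' : spacetime A g'.
Hypothesis HN : forall c p, A c -> dom c p -> curvature_nature g c p N.
Variables (psi : covector_field R M) (chi : M -> R).
Hypothesis Hpsi : smooth_covector A psi.
Hypothesis Hgam : forall c p, A c -> dom c p -> forall a b d : 'I_4,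
  christoffel g' c a b d p - christoffel g c a b d p =
  (a == b)%:R * psi c p ord0 d + (a == d)%:R * psi c p ord0 b.
Hypothesis Hchi : smooth_fun A chi.
Hypothesis Hdchi : forall c p, A c -> dom c p -> psi c p = differential chi c p.
Local Notation e a := (delta_mx ord0 a : 'rV[R]_4).
Local Notation ec := (@ec R).

Definition At (c : chart R M) : 'rV[R]_4 -> 'M[R]_4 :=
  sinjukov_tensor (Gm g' c) (fun x => chi (par c x)).
Definition ell (c : chart R M) : 'rV[R]_4 -> 'cV[R]_4 :=
  sinjukov_vector (Gm g' c) (fun x => psi c (par c x)) (fun x => chi (par c x)).
Definition dil (c : chart R M) : 'rV[R]_4 -> R := dilation (Gam g c) (ell c).

Section InChart.
Variable c : chart R M.
Hypothesis Ac : A c.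
Let V := img c.
Let oV : open V := @open_img R M c.

Let psi_smooth k : mCk V k (fun x => psi c (par c x)).
Proof. by move=> i j; rewrite ord1; exact: smooth_dom_Ck (Hpsi.1 c Ac j). Qed.

Let chi_smooth k : Ck k V (fun x => chi (par c x)).
Proof. exact: smooth_dom_Ck (Hchi Ac). Qed.

Lemma At_smooth k : mCk V k (At c).
Proof. exact: (sinjukov_tensor_smooth oV (Gm_smooth Hg' Ac) (Gm_unit Hg' Ac) chi_smooth). Qed.

Lemma ell_smooth k : mCk V k (ell c).
Proof.
exact: (sinjukov_vector_smooth oV (Gm_smooth Hg' Ac) (Gm_unit Hg' Ac) psi_smooth chi_smooth).
Qed.

Lemma At_der a y : V y -> mder (At c) y (e a)
  (- Gam g c a y *m At c y - At c y *m (Gam g c a y)^T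
   + ec a *m (ell c y)^T + ell c y *m (ec a)^T).
Proof.
apply: (sinjukov_tensor_der oV (Gam' := Gam g' c)); first exact: (Gm_smooth Hg' Ac).
- exact: (Gm_unit Hg' Ac).
- move=> b x Vx; exact: (Gm_der Hg' Ac).
- exact: (Gm_sym Hg' Ac).
- move=> b x Vx; have := Ck_derive b (chi_smooth 1) Vx.
  by rewrite (Hdchi Ac (dom_par Vx)) mxE pd_par.
- move=> b x Vx; apply/matrixP => i j; rewrite !mxE big_ord1 ecE.
  have /eqP := Hgam Ac (dom_par Vx) i b j; rewrite subr_eq => /eqP ->.
  by rewrite -mulr_natr; ring.
Qed.

Let curvD x : V x -> curv_rank1 (Gm g c) (Gam g c) x.
Proof.
move=> Vx; apply: (curv_nature_rank1 (N := N)).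
by apply: (curv_natureP Hg Ac Vx); apply: HN => //; exact: dom_par.
Qed.

Lemma curv_neq0 x : V x -> exists k d, curv (Gam g c) k d x != 0.
Proof. exact: (curv_rank1_neq0 (Gm_unit Hg Ac) curvD). Qed.

Lemma ell_der a x : V x -> mder (ell c) x (e a)
  (- Gam g c a x *m ell c x + dil c x *: ec a).
Proof.
exact: (l_der oV (Gam_smooth Hg Ac) (Gam_sym Hg Ac) curvD At_smooth ell_smooth At_der).
Qed.

Lemma dil_der x a : V x -> is_derive x (e a) (dil c) 0.
Proof.
exact: (dilation_der oV (Gam_smooth Hg Ac) (Gam_sym Hg Ac) curvD At_smooth ell_smooth At_der).
Qed.

Lemma curv_ell x k d : V x -> curv (Gam g c) k d x *m ell c x = 0.
Proof.
exact: (curv_l oV (Gam_smooth Hg Ac) (Gam_sym Hg Ac) curvD At_smooth ell_smooth At_der).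
Qed.

Lemma curv_At x k d : V x ->
  curv (Gam g c) k d x *m At c x + At c x *m (curv (Gam g c) k d x)^T = 0.
Proof.
exact: (curv_A oV (Gam_smooth Hg Ac) (Gam_sym Hg Ac) curvD At_smooth ell_smooth At_der).
Qed.

Lemma dil_const x (r : R) : 0 < r -> cube x r `<=` V ->
  forall y, cube x r y -> dil c y = dil c x.
Proof.
move=> r0 rV y cy; apply: (@derive0_cube_const R 4 _ x r) => // z a /rV Vz.
exact: dil_der.
Qed.

(* Differentiating [curv *m ell = 0] where [ell] vanishes leaves
   [dil * curv = 0]. *)
Lemma dil_eq0 x : V x -> ell c x = 0 -> dil c x = 0.
Proof.
move=> Vx l0; have [k [d kd]] := curv_neq0 Vx.
apply/eqP/negPn/negP => dil0; move/negP: kd; apply; apply/eqP.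
apply: col_ec_ext => a; rewrite mul0mx.
have h1 := mderM (mCk_mder a (curv_smooth oV (Gam_smooth Hg Ac) 1 k d) Vx) (ell_der a Vx).
have h2 : mder (fun y => curv (Gam g c) k d y *m ell c y) x (e a) 0.
  apply: mder_near (mder_cst 0 x (e a)).
  by apply: (open_near_eq oV) Vx => y Vy; rewrite curv_ell.
have := mder_unique h1 h2; rewrite l0 !mulmx0 !add0r -scalemxAr => /eqP.
by rewrite scaler_eq0 (negbTE dil0) => /eqP.
Qed.

(** [dil] vanishes at [x] and is constant on a cube, so there [ell] is parallel. Along each axis
    segment it solves a homogeneous linear equation with bounded coefficients and starts from 0. *)
Lemma ell_eq0_near x : V x -> ell c x = 0 -> \forall y \near x, ell c y = 0.
Proof.
move=> Vx l0; have d0 := dil_eq0 Vx l0.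
have [C [r [C0 r0 rV hC]]] := bounded_cube oV (Gam_smooth Hg Ac 0) Vx.
suff H : forall y, cube x r y -> ell c y = 0.
  by have := cube_nbhs x r0; apply: filterS.
move=> y cy; apply: (@cube_ind R 4 (fun z => ell c z = 0) x r _ x) => //; last exact: cube_refl.
move=> z a s cz czs lz.
pose h t := ell c (z + (t * s) *: e a).
rewrite -[s]mul1r -/(h 1).
apply: (@linear_ode_zero R 4 h (fun t => - s *: Gam g c a (z + (t * s) *: e a)) (`|s| * C)).
- move=> t tI; have ct := cube_segment cz czs tI.
  apply: mder_eq; first by apply: mder_segment; exact: ell_der (rV _ ct).
  rewrite (dil_const r0 rV ct) d0 scale0r addr0.
  by rewrite mulNmx scalerN -scalemxAl scaleNr.
- move=> t i j tI; rewrite mxE normrM normrN ler_wpM2l //.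
  by apply: hC; exact: cube_segment.
- by rewrite /h mul0r scale0r addr0.
Qed.

Lemma ell_psi x : V x -> (ell c x == 0) = (psi c (par c x) == 0).
Proof.
move=> Vx; apply/eqP/eqP => [|p0]; last first.
  by rewrite /ell /sinjukov_vector p0 trmx0 mulmx0.
rewrite /ell /sinjukov_vector mulNmx /sinjukov_tensor -scalemxAl => /eqP.
rewrite oppr_eq0 scaler_eq0 gt_eqF ?expR_gt0 //= => /eqP h.
apply: trmx_inj; rewrite trmx0 -(mulKVmx (Gm_unit Hg' Ac Vx) (_^T)) h.
by rewrite mulmx0.
Qed.

Lemma At_sym y : V y -> (At c y)^T = At c y.
Proof.
by move=> Vy; rewrite /At /sinjukov_tensor trmxZ trmx_inv (Gm_sym Hg' Ac Vy).
Qed.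

Lemma der_ip (X Y : 'rV[R]_4 -> 'cV[R]_4) y a X' Y' : V y ->
  mder X y (e a) (- Gam g c a y *m X y + X') ->
  mder Y y (e a) (- Gam g c a y *m Y y + Y') ->
  is_derive y (e a) (fun z => ip (Gm g c z) (X z) (Y z))
    (ip (Gm g c y) X' (Y y) + ip (Gm g c y) (X y) Y').
Proof.
move=> Vy hX hY.
have h := mderM (mderM (mderT hX) (Gm_der Hg Ac a Vy)) hY.
apply: is_derive_eq (h ord0 ord0) _.
have addE (P Q : 'M[R]_1) : P ord0 ord0 + Q ord0 ord0 = (P + Q) ord0 ord0 by rewrite mxE.
by rewrite /ip addE; congr (fun_of_matrix _ _ _); mxexpand; mxlin.
Qed.

(** The hypothesis says that [f] times the identity has rank at most one; it is tested on a nonzero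
    vector killed by the row [s]. *)
Lemma scaled_basis_rank1 (f : R) (s : 'I_4 -> R) (k : 'cV[R]_4) :
  (forall a, f *: ec a = s a *: k) -> f = 0.
Proof.
move=> h; have [nu [nu0 snu _]] := exists_annihilated (\row_a s a) 0.
have : f *: nu = 0.
  rewrite (sum_ec nu) scaler_sumr.
  under eq_bigr do rewrite scalerA mulrC -scalerA h scalerA mulrC.
  suff S0 : \sum_a s a * nu a ord0 = 0 by rewrite -scaler_suml S0 scale0r.
  have /matrixP/(_ ord0 ord0) := snu; rewrite mxE [RHS]mxE => S0.
  by rewrite -[RHS]S0; apply: eq_bigr => a _; rewrite mxE.
by move/eqP; rewrite scaler_eq0 (negbTE nu0) orbF => /eqP.
Qed.

(** * The null case: excluding an invariant field and a parallel [ell] *)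

Section NullCurvature.
Hypothesis NNull : N = Null.

Lemma null_data y : V y -> exists v w : 'cV[R]_4,
  [/\ wedge v w != 0, has_nature (Gm g c y) (blade v w) Null,
      (forall k d, exists be : R, curv (Gam g c) k d y = be *: (wedge v w *m Gm g c y)) &
      exists k d, exists2 be : R, be != 0 &
        curv (Gam g c) k d y = be *: (wedge v w *m Gm g c y)].
Proof.
move=> Vy; have := curv_natureP Hg Ac Vy (HN Ac (dom_par Vy)).
rewrite NNull => -[al [v [w [al0 W0 HW H]]]].
exists v, w; split=> // [k d|]; first by exists (al * lower2 (Gm g c y) (wedge v w) k d).
have /exists_entry_neq0[k [d kd]] := lower2_neq0 (Gm_unit Hg Ac Vy) W0.
by exists k, d, (al * lower2 (Gm g c y) (wedge v w) k d); rewrite ?mulf_neq0.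
Qed.

Lemma curv_gram y (k1 k2 : 'cV[R]_4) : V y ->
  (forall k d, curv (Gam g c) k d y *m k1 = 0) ->
  (forall k d, curv (Gam g c) k d y *m k2 = 0) ->
  ip (Gm g c y) k1 k1 * ip (Gm g c y) k2 k2 = ip (Gm g c y) k1 k2 ^+ 2.
Proof.
move=> Vy h1 h2; have [v [w [W0 HW _ [k [d [be be0 E]]]]]] := null_data Vy.
have LG : lorentz_form (Gm g c y).
  by have [_ _ _ _ lg] := Hg; exact: (lg c (par c y) Ac (dom_par Vy)).
apply: (null_blade_gram LG W0 HW).
- move: (h1 k d); rewrite E -scalemxAl => /eqP.
  by rewrite scaler_eq0 (negbTE be0) => /eqP.
- move: (h2 k d); rewrite E -scalemxAl => /eqP.
  by rewrite scaler_eq0 (negbTE be0) => /eqP.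
Qed.

Section InvariantField.
Variables (W : set 'rV[R]_4) (k : 'rV[R]_4 -> 'cV[R]_4).
Hypothesis oW : open W.
Hypothesis WV : W `<=` V.
Hypothesis k_cont : mCk W 0 k.
Hypothesis k_der : forall a y, W y -> mder k y (e a) (- Gam g c a y *m k y
  - (dil c y * ip (Gm g c y) (k y) (ec a)) *: k y).

Let Gam_smoothW i a : mCk W i (Gam g c a).
Proof. by move=> p q; exact: Ck_sub WV (Gam_smooth Hg Ac i a p q). Qed.

Let G_smoothW i : mCk W i (Gm g c).
Proof. by move=> p q; exact: Ck_sub WV (Gm_smooth Hg Ac i p q). Qed.

Let dil_smoothW i : Ck i W (dil c).
Proof.
case: i => [|i].
  split=> // x Wx.
  have [r r0 rV] := open_cube oW Wx.
  apply: (@cont_near _ _ (fun=> dil c x)); last exact: cont_cst.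
  have := cube_nbhs x r0; apply: filterS => y cy.
  by rewrite (@dil_const x r) // => z /rV /WV.
apply: (@CkS_intro _ _ _ _ _ (fun _ _ => 0)) => // [x Wx|x a Wx|a].
- have [r r0 rV] := open_cube oW Wx.
  apply: (@cont_near _ _ (fun=> dil c x)); last exact: cont_cst.
  have := cube_nbhs x r0; apply: filterS => y cy.
  by rewrite (@dil_const x r) // => z /rV /WV.
- by apply: dil_der; exact: WV.
- exact: Ck_cst.
Qed.

(** Bootstrap: [k_der] expresses the partial derivatives of [k] through [k] and smooth data, so each
    order of regularity yields the next. The Ricci identity requires order 2. *)
Let k_smooth i : mCk W i k.
Proof.
elim: i => [//|i IH] p q.
apply: (@CkS_intro _ _ _ _ _ (fun a y => (- Gam g c a y *m k y
  - (dil c y * ip (Gm g c y) (k y) (ec a)) *: k y) p q)) => // [x Wx|x a Wx|a].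
- exact: (Ck_continuous (IH p q)).
- exact: k_der.
- suff : mCk W i (fun y => - Gam g c a y *m k y
      - (dil c y * ip (Gm g c y) (k y) (ec a)) *: k y) by exact.
  apply: (mCkD oW); first by apply: (mCkM oW) => //; exact: (mCkN oW).
  apply: (mCkN oW); apply: (mCkZ oW) => //; apply: Ck_mul => //.
  suff : mCk W i (fun y => (k y)^T *m Gm g c y *m ec a) by exact.
  apply: (mCkM oW); last exact: mCk_cst.
  by apply: (mCkM oW) => //; exact: (mCkT oW).
Qed.

(** Since [k_{a;b} = - C k_a k_b] and [C] is locally constant, the second covariant derivative of
    [k] is a multiple of [k_a k_b k], symmetric in [a] and [b], so the commutator in the Ricci
    identity vanishes. *)
Lemma curv_invariant_field y k' d : W y -> curv (Gam g c) k' d y *m k y = 0.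
Proof.
move=> Wy; have Vy := WV Wy.
pose s a z := ip (Gm g c z) (k z) (ec a).
have ds a b : is_derive y (e b) (s a)
    (- (dil c y * s b y) * s a y + ip (Gm g c y) (k y) (Gam g c b y *m ec a)).
  apply: is_derive_eq.
    apply: (der_ip (X' := - (dil c y * s b y) *: k y) (Y := fun=> ec a)
      (Y' := Gam g c b y *m ec a) Vy).
      by apply: mder_eq (k_der b Wy) _; rewrite scaleNr.
    by apply: mder_eq (mder_cst _ _ _) _; rewrite mulNmx addNr.
  by rewrite ipZl.
rewrite (ricci_vector (Z := fun a z => - (dil c z * s a z) *: k z)
  (Z' := fun a b => - (0 * s a y + dil c y * (- (dil c y * s b y) * s a y
     + ip (Gm g c y) (k y) (Gam g c b y *m ec a))) *: k y
   + - (dil c y * s a y) *: (- Gam g c b y *m k y - (dil c y * s b y) *: k y))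
  oW Gam_smoothW d k' (k_smooth 2) Wy).
- rewrite (Gam_sym Hg Ac k' d Vy) mulNmx -!scalemxAr.
  move: (s k' y) (s d y) (dil c y) (ip _ _ _) => p q r t.
  by rewrite mulNmx; mxlin.
- by move=> a z Wz; apply: mder_eq (k_der a Wz) _; rewrite scaleNr.
- move=> a b; apply: mderZ; last exact: k_der.
  by apply: pderN; apply: pderM => //; exact: dil_der.
Qed.

(* [ker F] is a degenerate plane containing both fields, so
   [(k.k) (ell.ell) = 1]; differentiating gives [ell = k / (k.k)], and
   differentiating again makes [dil * 1] a matrix of rank one. *)
Lemma no_invariant_field x : W x -> dil c x != 0 ->
  ~ (forall y, W y -> ip (Gm g c y) (ell c y) (k y) = 1).
Proof.
move=> Wx d0 lk.
have sGm y : W y -> (Gm g c y)^T = Gm g c y by move=> /WV; exact: (Gm_sym Hg Ac).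
pose f y := ip (Gm g c y) (k y) (k y).
pose h y := ip (Gm g c y) (ell c y) (ell c y).
pose s y a := ip (Gm g c y) (k y) (ec a).
have kl y : W y -> ip (Gm g c y) (k y) (ell c y) = 1.
  by move=> Wy; rewrite ipC ?lk // sGm.
have fh y : W y -> f y * h y = 1.
  move=> Wy; rewrite /f /h curv_gram ?kl ?expr1n //; first exact: WV.
  - by move=> i j; exact: curv_invariant_field.
  - by move=> i j; apply: curv_ell => //; exact: WV.
have k_der' a y : W y -> mder k y (e a) (- Gam g c a y *m k y + - (dil c y * s y a) *: k y).
  by move=> Wy; apply: mder_eq (k_der a Wy) _; rewrite scaleNr.
have df a y : W y -> is_derive y (e a) f (- 2 * dil c y * s y a * f y).
  move=> Wy; have Vy := WV Wy.
  apply: is_derive_eq; first exact: (der_ip Vy (k_der' a y Wy) (k_der' a y Wy)).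
  by rewrite ipZl ipZr -/(f y); ring.
have dh a y : W y -> is_derive y (e a) h (2 * dil c y * ip (Gm g c y) (ell c y) (ec a)).
  move=> Wy; have Vy := WV Wy.
  apply: is_derive_eq; first exact: (der_ip Vy (ell_der a Vy) (ell_der a Vy)).
  by rewrite ipZl ipZr (ipC (ec a)) ?sGm //; ring.
have [r r0 rW] := open_cube oW Wx.
have dily y : cube x r y -> dil c y != 0.
  by move=> cy; rewrite (@dil_const x r) // => z /rW /WV.
have f0 y : W y -> f y != 0.
  by move=> Wy; apply/eqP => fy; have /eqP := fh y Wy; rewrite fy mul0r eq_sym oner_eq0.
have kE y : cube x r y -> k y = f y *: ell c y.
  move=> cy; have Wy := rW _ cy; have Vy := WV Wy.
  apply/eqP; rewrite -subr_eq0; apply/eqP; apply: (ip_eq0 (Gm_unit Hg Ac Vy)) => p.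
  (* Differentiating [f h = 1] gives [-2 C k_a + 2 C f l_a = 0]; [C] is nonzero throughout the
     cube. *)
  have E a : ip (Gm g c y) (ec a) (k y - f y *: ell c y) = 0.
    rewrite ipDr ipNr ipZr !(ipC (ec a)) ?sGm // -/(s y a).
    have D1 := pderM (df a y Wy) (dh a y Wy).
    have D2 : is_derive y (e a) (fun z => f z * h z) 0.
      apply: is_derive_near (pder_cst 1 y (e a)).
      exact: (open_near_eq oW fh Wy).
    have := is_derive_unique D1 D2.
    have -> : - 2 * dil c y * s y a * f y * h y = - 2 * dil c y * s y a * (f y * h y) by ring.
    rewrite fh // => D3; apply: (mulfI (dily y cy)); rewrite mulr0; lra.
  rewrite (sum_ec p); elim/big_rec: _ => [|a z _ IH]; first by rewrite ip0l.
  by rewrite ipDl ipZl E IH mulr0 addr0.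
(* Now [k = f l] is differentiated covariantly in two ways: [- C k_a k] from [k_der], and
   [-2 C k_a k + f C e_a] by the product rule. Dividing by [C] leaves [f e_a = k_a k]. *)
have := f0 x Wx; rewrite (@scaled_basis_rank1 (f x) (s x) (k x)) ?eqxx // => a.
have Vx := WV Wx; have cx : cube x r x by exact: cube_refl.
have D1 := mderZ (df a x Wx) (ell_der a Vx).
have D2 : mder (fun z => f z *: ell c z) x (e a) (- Gam g c a x *m k x + - (dil c x * s x a) *: k x).
  apply: mder_near (k_der' a x Wx).
  by have := cube_nbhs x r0; apply: filterS => y cy; rewrite kE.
have := mder_unique D1 D2; rewrite (kE x cx); move: (Gam g c a x) => B D3.
apply: (scalerI (dily x cx)).
have -> : dil c x *: (f x *: ec a) =
  (- 2 * dil c x * s x a * f x) *: ell c x + f x *: (- B *m ell c x + dil c x *: ec a)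
  + (2 * dil c x * s x a * f x) *: ell c x + f x *: (B *m ell c x).
  rewrite mulNmx; mxatoms; move: (ec a) (ell c x) (dil c x) (s x a) (f x) => ? ? ? ? ?; mxlin.
rewrite D3 mulNmx -scalemxAr; mxatoms; move: (ell c x) (dil c x) (s x a) (f x) => ? ? ? ?; mxlin.
Qed.

End InvariantField.

Lemma curv_skew y k d : V y ->
  (curv (Gam g c) k d y)^T *m Gm g c y = - (Gm g c y *m curv (Gam g c) k d y).
Proof.
move=> Vy; have [v [w [_ _ /(_ k d)[be ->] _]]] := null_data Vy.
rewrite trmxZ trmx_mul (Gm_sym Hg Ac Vy) wedge_tr.
by rewrite -scalemxAl -scalemxAr mulmxN mulNmx scalerN !mulmxA.
Qed.

(** If [dil] vanished at [x], [ell] would be parallel on a cube and [ka = l.l] constant there. The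
    vector [u = a l] is killed by the curvature too, because [a] commutes with the curvature
    endomorphisms, so the Gram identity [curv_gram] applies to [u] and [ell]. *)
Lemma parallel_ell_eq0 x : V x -> ell c x != 0 -> dil c x != 0.
Proof.
move=> Vx l0; apply/negP => /eqP d0.
have [r r0 rV] := open_cube oV Vx; have oW := @cube_open R 4 x r r0.
have cx := cube_refl x r0.
have dil0 y : cube x r y -> dil c y = 0 by move=> cy; rewrite (dil_const r0 rV cy).
have dell y a : cube x r y -> mder (ell c) y (e a) (- Gam g c a y *m ell c y + 0).
  by move=> cy; apply: mder_eq (ell_der a (rV _ cy)) _; rewrite dil0 // scale0r.
pose ka := ip (Gm g c x) (ell c x) (ell c x).
have kaE y : cube x r y -> ip (Gm g c y) (ell c y) (ell c y) = ka.
  move=> cy.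
  apply: (@derive0_cube_const R 4 (fun y => ip (Gm g c y) (ell c y) (ell c y)) x r) => //.
  move=> z a cz; apply: is_derive_eq.
    exact: (der_ip (rV _ cz) (dell z a cz) (dell z a cz)).
  by rewrite ip0l ip0r addr0.
pose u y := At c y *m Gm g c y *m ell c y.
pose s y a := ip (Gm g c y) (ell c y) (ec a).
have sE y a : cube x r y -> ip (Gm g c y) (ec a) (ell c y) = s y a.
  by move=> cy; rewrite ipC // (Gm_sym Hg Ac (rV _ cy)).
have du y a : cube x r y ->
    mder u y (e a) (- Gam g c a y *m u y + (ka *: ec a + s y a *: ell c y)).
  move=> cy; have Vy := rV _ cy.
  have := mderM (mderM (At_der a Vy) (Gm_der Hg Ac a Vy)) (dell y a cy).
  move/mder_eq; apply; rewrite -(kaE y cy) -(sE y a cy).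
  rewrite -[_ *: ec a]mul_mx_scalar -[_ *: ell c y]mul_mx_scalar -!ip_mx /u.
  by move: (At c y) (ell c y) (Gm g c y) (Gam g c a y) => ? ? ? ?; mxexpand; mxlin.
have cu y k d : cube x r y -> curv (Gam g c) k d y *m u y = 0.
  move=> cy; have Vy := rV _ cy.
  have /eqP := curv_At k d Vy; rewrite addr_eq0 => /eqP E.
  have := curv_ell k d Vy; rewrite /u; move: (ell c y) => l Cl.
  rewrite !mulmxA E !mulNmx -(mulmxA (At c y)) curv_skew // mulmxN mulNmx opprK.
  by rewrite -!mulmxA Cl !mulmx0.
(* For [ka] nonzero, let [w] be the part of [u] orthogonal to [ell]. The Gram identity makes [w]
   null; differentiating [w.w = 0] gives [ka w_a = 0], hence [w = 0], and the derivative
   [ka e_a - l_a l] of [w] must vanish, which no nonzero [ka] allows. *)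
have [ka0|ka0] := eqVneq ka 0; last first.
  pose t y := ip (Gm g c y) (u y) (ell c y).
  have dt y a : cube x r y -> is_derive y (e a) t (2 * ka * s y a).
    move=> cy; apply: is_derive_eq; first exact: (der_ip (rV _ cy) (du y a cy) (dell y a cy)).
    by rewrite ip0r addr0 ipDl !ipZl kaE // sE //; ring.
  pose w y := u y - (ka^-1 * t y) *: ell c y.
  have dw y a : cube x r y ->
      mder w y (e a) (- Gam g c a y *m w y + (ka *: ec a - s y a *: ell c y)).
    move=> cy; have dt' := pderM (pder_cst ka^-1 y (e a)) (dt y a cy).
    have := mderB (du y a cy) (mderZ dt' (dell y a cy)).
    move/mder_eq; apply; rewrite /w mul0r add0r.
    have -> : ka^-1 * (2 * ka * s y a) = 2 * s y a by field.
    rewrite mulmxBr !mulNmx addr0 -scalemxAr; mxatoms.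
    move: (ka^-1 * t y) (ec a) (ell c y) (s y a) => ? ? ? ?; mxlin.
  have wl y : cube x r y -> ip (Gm g c y) (w y) (ell c y) = 0.
    by move=> cy; rewrite ipDl ipNl ipZl kaE // -/(t y) mulrAC mulVf // mul1r subrr.
  have ww y : cube x r y -> ip (Gm g c y) (w y) (w y) = 0.
    move=> cy; rewrite {2}/w ipDr ipNr ipZr wl // mulr0 subr0 /w ipDl ipNl ipZl.
    rewrite (ipC (ell c y)) ?(Gm_sym Hg Ac (rV _ cy)) // -/(t y).
    have := curv_gram (rV _ cy) (fun k d => cu y k d cy) (fun k d => curv_ell k d (rV _ cy)).
    rewrite kaE // -/(t y) => h; apply: (mulIf ka0); rewrite mul0r mulrBl h.
    by field.
  have w0 y : cube x r y -> w y = 0.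
    move=> cy; apply: (ip_eq0 (Gm_unit Hg Ac (rV _ cy))) => p.
    have E a : ip (Gm g c y) (ec a) (w y) = 0.
      have D1 := der_ip (rV _ cy) (dw y a cy) (dw y a cy).
      have D2 : is_derive y (e a) (fun z => ip (Gm g c z) (w z) (w z)) 0.
        apply: is_derive_near (pder_cst 0 y (e a)).
        exact: (open_near_eq oW ww cy).
      have := is_derive_unique D1 D2; have := wl y cy; move: (w y) => p' wp.
      have sGy := Gm_sym Hg Ac (rV _ cy).
      rewrite !(ipDl, ipDr, ipNl, ipNr, ipZl, ipZr) wp (ipC (ell c y)) // wp.
      by rewrite (ipC p') // => D3; apply: (mulfI ka0); rewrite mulr0; lra.
    by rewrite (sum_ec p); elim/big_rec: _ => [|a z _ IH]; rewrite ?ip0l // ipDl ipZl E IH mulr0 addr0.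
  move/eqP: ka0; apply; apply: (@scaled_basis_rank1 ka (s x) (ell c x)) => a.
  have D : mder w x (e a) 0.
    by apply: mder_near (mder_cst 0 x (e a)); exact: (open_near_eq oW w0 cx).
  have := mder_unique (dw x a cx) D; rewrite w0 // mulmx0 add0r => /eqP.
  by rewrite subr_eq0 => /eqP.
have [k [d kd]] := curv_neq0 Vx.
have [i [j li]] := exists_entry_neq0 l0; rewrite ord1 in li.
have phi_ex y : cube x r y -> ell c y != 0 -> exists phi : R,
   [/\ At c y *m Gm g c y *m ell c y = phi *: ell c y,
     At c y *m Gm g c y *m curv (Gam g c) k d y = phi *: curv (Gam g c) k d y,
     curv (Gam g c) k d y *m (At c y *m Gm g c y) = phi *: curv (Gam g c) k d y &
     curv (Gam g c) k d y != 0 -> curv (Gam g c) k d y *m curv (Gam g c) k d y != 0].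
  move=> cy ly; have Vy := rV _ cy.
  have [v [w [W0 HW /(_ k d)[be Ebe] [k' [d' [be' be'0 E']]]]]] := null_data Vy.
  have com : wedge v w *m Gm g c y *m At c y = At c y *m Gm g c y *m wedge v w.
    have := curv_At k' d' Vy; move: (At c y) => P; rewrite E' trmxZ trmx_mul (Gm_sym Hg Ac Vy) wedge_tr.
    rewrite -scalemxAl -scalemxAr -scalerDr => /eqP; rewrite scaler_eq0 (negbTE be'0) /=.
    by rewrite !mulmxN mulmxA addr_eq0 opprK => /eqP.
  have LG : lorentz_form (Gm g c y).
    by have [_ _ _ _ lg] := Hg; exact: (lg c (par c y) Ac (dom_par Vy)).
  have Wl : wedge v w *m Gm g c y *m ell c y = 0.
    move: (curv_ell k' d' Vy); rewrite E' -scalemxAl => /eqP.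
    by rewrite scaler_eq0 (negbTE be'0) => /eqP.
  have ll : ip (Gm g c y) (ell c y) (ell c y) = 0 by rewrite kaE.
  have [phi [E1 E2 E3]] := null_commutant LG W0 HW (At_sym Vy) com ly ll Wl.
  exists phi; split=> //.
  - by rewrite Ebe -scalemxAr mulmxA E2 -scalemxAl !scalerA mulrC.
  - by rewrite Ebe -scalemxAl !mulmxA com E2 -scalemxAl !scalerA mulrC.
  - rewrite Ebe scaler_eq0 negb_or => /andP[be0 _].
    rewrite -scalemxAl -scalemxAr !scaler_eq0 (negbTE be0) /=.
    apply: contra E3 => /eqP h; rewrite mulmxA in h.
    by rewrite -(mulmxK (Gm_unit Hg Ac Vy) (_ *m wedge v w)) h mul0mx.
have [phi [Ex1 Ex2 Ex3 /(_ kd) C2]] := phi_ex x cx l0.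
pose C := curv (Gam g c) k d.
pose Q y := At c y *m Gm g c y.
(* [Z] is [l_i] times [Q] minus its eigenvalue [phi] on the blade, written with [u_i = phi l_i] so
   that it is differentiable without any regularity of [phi]. *)
pose Z y := ell c y i ord0 *: Q y - u y i ord0 *: 1%:M.
have CZC : \forall y \near x, C x *m Z y *m C y = 0.
  have cl : {for x, continuous (fun y => ell c y i ord0)}.
    exact: (Ck_continuous (ell_smooth 0 i ord0) Vx).
  have := cont_neq0 cl li; have := cube_nbhs x r0; apply: filterS2 => y cy lyi.
  have ly : ell c y != 0 by apply: contra lyi => /eqP ->; rewrite mxE.
  have [ph [Ey1 Ey2 _ _]] := phi_ex y cy ly.
  have uE : u y i ord0 = ph * ell c y i ord0 by rewrite /u Ey1 mxE.
  rewrite -mulmxA; suff -> : Z y *m C y = 0 by rewrite mulmx0.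
  rewrite /Z uE; move: Ey2; rewrite -/(Q y) -/(C y).
  move: (C y) (Q y) (ell c y i ord0) => C' Q' l' E'.
  by rewrite mulmxBl -!scalemxAl E' mul1mx scalerA mulrC subrr.
have CZ : C x *m Z x = 0.
  have uE : u x i ord0 = phi * ell c x i ord0 by rewrite /u Ex1 mxE.
  rewrite /Z uE; move: Ex3; rewrite -/(Q x) -/(C x).
  move: (C x) (Q x) (ell c x i ord0) => C' Q' l' E'.
  by rewrite mulmxBr -!scalemxAr E' mulmx1 scalerA mulrC subrr.
apply: (negP l0); apply/eqP; apply: (ip_eq0 (Gm_unit Hg Ac Vx)) => p.
suff E a : s x a = 0.
  rewrite (sum_ec p); elim/big_rec: _ => [|a z _ IH]; rewrite ?ip0l // ipDl ipZl sE //.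
  by rewrite E IH mulr0 addr0.
have D1 : mder (fun y => C x *m Z y *m C y) x (e a) 0.
  by apply: mder_near (mder_cst 0 x (e a)).
have Cl : C x *m ell c x = 0 by exact: curv_ell.
have lGC : (ell c x)^T *m Gm g c x *m C x = 0.
  have sk := curv_skew k d Vx; rewrite -/(C x) in sk.
  move: (ell c x) Cl => l Cl; apply: trmx_inj.
  rewrite trmx0 !trmx_mul trmxK (Gm_sym Hg Ac Vx) mulmxA sk.
  by rewrite mulNmx -mulmxA Cl mulmx0 oppr0.
pose q := (- Gam g c a x *m ell c x) i ord0.
pose t := phi * q + s x a * ell c x i ord0.
have dl : is_derive x (e a) (fun y => ell c y i ord0) q.
  by apply: is_derive_eq (dell x a cx i ord0) _; rewrite addr0.
have dui : is_derive x (e a) (fun y => u y i ord0) t.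
  apply: is_derive_eq (du x a cx i ord0) _.
  by rewrite ka0 scale0r add0r /t /q /u Ex1 -scalemxAr !mxE; ring.
have dQ := mderM (At_der a Vx) (Gm_der Hg Ac a Vx).
set dQ' := (X in mder _ _ _ X) in dQ.
have dZ : mder Z x (e a) (q *: Q x + ell c x i ord0 *: dQ' - t *: 1%:M).
  apply: mder_eq (mderB (mderZ dl dQ) (mderZ dui (mder_cst 1%:M x (e a)))) _.
  by rewrite scaler0 addr0.
have dC := mCk_mder a (curv_smooth oV (Gam_smooth Hg Ac) 1 k d) Vx.
(* Because [C x *m Z x = 0], the derivative of [C] drops out. Sinjukov's terms die on either side
   since [C] kills [ell], the connection terms cancel, and what remains is [- l_a l_i] times the
   square of [C x], which is nonzero. *)
have := mder_unique (mderM (mderM (mder_cst (C x) x (e a)) dZ) dC) D1.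
rewrite CZ mul0mx mul0mx add0r addr0 -/(C x).
have -> : C x *m (q *: Q x + ell c x i ord0 *: dQ' - t *: 1%:M) *m C x =
  (q * phi - t) *: (C x *m C x).
  transitivity (q *: (C x *m Q x *m C x) + ell c x i ord0 *: (
     - (C x *m Gam g c a x *m (Q x *m C x)) + C x *m Q x *m Gam g c a x *m C x
     + C x *m ec a *m ((ell c x)^T *m Gm g c x *m C x)
     + C x *m ell c x *m ((ec a)^T *m Gm g c x *m C x)) - t *: (C x *m C x)).
    rewrite /dQ' /Q; move: (At c x) (ell c x) (Gm g c x) (Gam g c a x) (C x) (q) (t) => ? ? ? ? ? ? ?.
    by mxexpand; mxlin.
  rewrite lGC Cl mulmx0 mul0mx.
  have -> : C x *m Q x = phi *: C x by [].
  have -> : Q x *m C x = phi *: C x by [].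
  rewrite -!scalemxAl -!scalemxAr.
  by move: (C x) (Gam g c a x) (ell c x i ord0) (q) (t) => ? ? ? ? ?; mxlin.
move=> /eqP; rewrite scaler_eq0 (negbTE C2) orbF /t => /eqP h.
by apply: (mulIf li); rewrite mul0r; lra.
Qed.

End NullCurvature.

End InChart.

(** * The zero set of [lambda] is open and closed *)

Definition psi_zero : set M := [set p | exists2 c, A c & dom c p /\ psi c p = 0].

Lemma psi_zeroE c p : A c -> dom c p -> psi_zero p <-> psi c p = 0.
Proof.
move=> Ac cp; split=> [[c' Ac' [cp' p0]]|p0]; last by exists c.
by rewrite (Hpsi.2 c c' p) // p0 mul0mx.
Qed.

Lemma psi_zero_open : open psi_zero.
Proof.
rewrite openE => p [c Ac [cp p0]].
have Vx := img_coord cp.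
have lx : ell c (coord c p) = 0.
  by apply/eqP; rewrite ell_psi // coordK // p0.
have h1 := ell_eq0_near Ac Vx lx.
have h2 : nbhs p (coord c @^-1` [set y | ell c y = 0]).
  by apply: (Defs.coord_continuous cp); exact: h1.
have h3 : nbhs p (dom c) by apply: open_nbhs_nbhs; split=> //; exact: dom_open.
move: h2 h3; apply: filterS2 => q /= lq cq; exists c => //; split=> //.
by apply/eqP; rewrite -(coordK cq) -ell_psi //; [exact/eqP|exact: img_coord].
Qed.

Lemma psi_zero_closed : closed psi_zero.
Proof.
have [_ _ [atlas _] _ _] := Hg.
rewrite -[psi_zero]setCK; apply: open_closedC; rewrite openE => p np.
have [c Ac cp] := atlas p.
have p0 : psi c p != 0 by apply/eqP => p0; apply: np; exists c.
have [i [j]] := exists_entry_neq0 p0; rewrite ord1 => pj.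
have cpsi : {for p, continuous (fun q => psi c q ord0 j)}.
  by have [h _] := Hpsi.1 c Ac j [::] p cp.
have h3 : nbhs p (dom c) by apply: open_nbhs_nbhs; split=> //; exact: dom_open.
move: (cont_neq0 cpsi pj) h3; apply: filterS2 => q qj cq.
by move=> /(psi_zeroE Ac cq) pq; move: qj; rewrite pq mxE eqxx.
Qed.

Lemma psi_zero_dichotomy : psi_zero = setT \/ psi_zero = set0.
Proof.
have [_ cM _ _ _] := Hg.
have [->|ne] := eqVneq psi_zero set0; [by right|left].
apply: cM; first exact/set0P.
- by exists psi_zero; [exact: psi_zero_open|rewrite setTI].
- by exists psi_zero; [exact: psi_zero_closed|rewrite setTI].
Qed.

Lemma lambda_eq0 (lambda : covector_field R M) :
  (forall c p, A c -> dom c p -> forall a, lambda c p ord0 a =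
     - expR (2 * chi p) *
       \sum_b \sum_d psi c p ord0 b * invmx (g' c p) b d * g c p a d) ->
  forall c p, A c -> dom c p -> (lambda c p == 0) = (psi c p == 0).
Proof.
move=> Hl c p Ac cp; have Vx := img_coord cp.
have uG : g c p \in unitmx by rewrite -(coordK cp); exact: (Gm_unit Hg Ac Vx).
have uG' : g' c p \in unitmx by rewrite -(coordK cp); exact: (Gm_unit Hg' Ac Vx).
have E : lambda c p = - expR (2 * chi p) *: (psi c p *m invmx (g' c p) *m (g c p)^T).
  apply/matrixP => i a; rewrite ord1 Hl // mxE; congr (_ * _); rewrite exchange_big mxE.
  by apply: eq_bigr => d _; rewrite !mxE mulr_suml.
rewrite E scaler_eq0 oppr_eq0 gt_eqF ?expR_gt0 //=.
apply/eqP/eqP => [h|->]; last by rewrite !mul0mx.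
have uGT : (g c p)^T \in unitmx by rewrite unitmx_tr.
by rewrite -(mulmxKV uG' (psi c p)) -(mulmxK uGT (_ *m invmx _)) h !mul0mx.
Qed.

End ProjectivePair.

(** * Change of chart *)

Section ChartChange.
Variables (R : realType) (M : topologicalType) (A : set (chart R M)).
Hypothesis HA : is_atlas A.
Variables c c' : chart R M.
Hypotheses (Ac : A c) (Ac' : A c').
Local Notation e a := (delta_mx ord0 a : 'rV[R]_4).
Local Notation ec := (@ec R).

Definition overlap : set 'rV[R]_4 := cset c (dom c `&` dom c').
Definition trans (x : 'rV[R]_4) : 'rV[R]_4 := coord c' (par c x).
Definition Jac (x : 'rV[R]_4) : 'M[R]_4 := jac c c' (par c x).

Lemma open_overlap : open overlap.
Proof. by apply: open_cset; apply: openI; exact: dom_open. Qed.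

Lemma overlap_img x : overlap x -> img c x.
Proof. by case. Qed.

Lemma trans_img x : overlap x -> img c' (trans x).
Proof. by move=> [_ [_ h]]; exact: img_coord. Qed.

Lemma par_trans x : overlap x -> par c' (trans x) = par c x.
Proof. by move=> [_ [_ h]]; rewrite coordK. Qed.

Lemma trans_smooth k i : Ck k overlap (fun x => trans x ord0 i).
Proof.
apply: (@smooth_on_Ck R M c (dom c `&` dom c') (fun p => coord c' p ord0 i)).
  by apply: openI; exact: dom_open.
exact: HA.2.
Qed.

Lemma JacE x i a : overlap x -> Jac x i a = 'D_(e a) (fun y => trans y ord0 i) x.
Proof. by move=> [Vx _]; rewrite mxE pd_par. Qed.

Lemma Jac_smooth k : mCk overlap k Jac.
Proof.
move=> i a; apply: (Ck_ext open_overlap) (CkS_D a (trans_smooth k.+1 i)) => x Wx.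
by rewrite JacE.
Qed.

Lemma trans_der x i a : overlap x -> is_derive x (e a) (fun y => trans y ord0 i) (Jac x i a).
Proof. by move=> Wx; rewrite JacE //; exact: (Ck_derive _ (trans_smooth 1 i)). Qed.

Lemma continuous_axis (x v : 'rV[R]_4) :
  {for (0 : R), continuous (fun h : R => h *: v + x)}.
Proof.
apply: (@cvgD R 'rV[R]_4 _ (nbhs (0 : R))); last exact: cvg_cst.
by apply: (@cvgZr_tmp R 'rV[R]_4 _ (nbhs (0 : R))); exact: cvg_id.
Qed.

Lemma chain_rule (f : M -> R) (W : set 'rV[R]_4) x b : overlap x ->
  open W -> W (trans x) -> Ck 1 W (fun y => f (par c' y)) ->
  is_derive x (e b) (fun y => f (par c y))
    (\sum_k 'D_(e k) (fun y => f (par c' y)) (trans x) * Jac x k b).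
Proof.
move=> Wx oW Wtx hf.
apply: (@is_derive_near _ _ _ ((fun y => f (par c' y)) \o trans)).
  by apply: (open_near_eq open_overlap) Wx => y Wy; rewrite /= par_trans.
apply: (@is_derive_comp_partials R 4 (fun y => f (par c' y))
  (fun k y => 'D_(e k) (fun y => f (par c' y)) y) _ trans x (e b) (fun k => Jac x k b)).
- have nW : nbhs (trans x) W by exact: open_nbhs_nbhs.
  by apply: filterS nW => y Wy k; exact: (Ck_derive _ hf).
- by move=> k; exact: (Ck_continuous (CkS_D k hf)).
- apply: continuous_comp; first exact: continuous_axis.
  rewrite scale0r add0r; apply: continuous_comp.
    exact: par_continuous (overlap_img Wx).
  by case: Wx => _ [_ h]; exact: Defs.coord_continuous.
- by move=> k; exact: trans_der.
Qed.

(** The braid argument behind the uniqueness of the Levi-Civita connection: alternating the skew and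
    the symmetric exchange returns the entry with the opposite sign. *)
Lemma skew_sym_eq0 (D : 'I_4 -> 'M[R]_4) :
  (forall b, (D b)^T = - D b) -> (forall a b d, D b d a = D a d b) ->
  forall b, D b = 0.
Proof.
move=> sk sy b; apply/matrixP => d a; rewrite [RHS]mxE.
have skE i j k : D i j k = - D i k j by have /matrixP/(_ k j) := sk i; rewrite !mxE.
have : D b d a = - D b d a.
  by rewrite {1}sy skE sy skE sy opprK skE.
lra.
Qed.

Variable g : tensor2_field R M.
Hypothesis Hg : spacetime A g.

Lemma Gm_trans x : overlap x -> Gm g c x = (Jac x)^T *m Gm g c' (trans x) *m Jac x.
Proof.
move=> Wx; have [_ _ _ [_ h] _] := Hg; rewrite /Gm par_trans //.
by case: Wx => _ [h1 h2]; exact: h.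
Qed.

Lemma Jac_unit x : overlap x -> Jac x \in unitmx.
Proof.
move=> Wx; have := Gm_unit Hg Ac (overlap_img Wx); rewrite Gm_trans // unitmx_mul.
by case/andP.
Qed.

Definition pullGam (b : 'I_4) (x : 'rV[R]_4) : 'M[R]_4 :=
  \sum_j Jac x j b *: Gam g c' j (trans x).

(** The transformation law of the Christoffel symbols, obtained from uniqueness instead of from
    their formula. The lowered difference [D] of the two connections is skew, both being metric, and
    symmetric, both being torsion-free. *)
Lemma Jac_der b x : overlap x ->
  mder Jac x (e b) (Jac x *m Gam g c b x - pullGam b x *m Jac x).
Proof.
move=> Wx; have Vx := overlap_img Wx; have Vx' := trans_img Wx.
apply: mder_eq (mCk_mder b (Jac_smooth 1) Wx) _.
pose H b := pdmx b Jac x + pullGam b x *m Jac x.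
suff HE : H b = Jac x *m Gam g c b x.
  by rewrite -HE /H addrK.
pose G' := Gm g c' (trans x).
pose D b := (Jac x)^T *m G' *m H b - Gm g c x *m Gam g c b x.
suff D0 : D b = 0.
  have uJ : (Jac x)^T *m G' \in unitmx.
    by rewrite unitmx_mul unitmx_tr (Jac_unit Wx) (Gm_unit Hg Ac' Vx').
  move/eqP: D0; rewrite subr_eq0 Gm_trans // => /eqP h.
  rewrite -(mulKmx uJ (H b)) h -/G'.
  by rewrite -(mulmxA _ (Jac x)) (mulKmx uJ).
have dG' a : mder (fun y => Gm g c' (trans y)) x (e a) ((pullGam a x)^T *m G' + G' *m pullGam a x).
  move=> i j.
  have hf : Ck 1 (img c') (fun y => g c' (par c' y) i j) by exact: (Gm_smooth Hg Ac' 1 i j).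
  have h := @chain_rule (fun p => g c' p i j) (img c') x a Wx (@open_img R M c') Vx' hf.
  apply: is_derive_eq.
    apply: is_derive_near h; apply: (open_near_eq open_overlap) Wx => y Wy.
    by rewrite /Gm par_trans.
  transitivity ((\sum_k Jac x k a *: ((Gam g c' k (trans x))^T *m G' + G' *m Gam g c' k (trans x))) i j).
    rewrite summxE; apply: eq_bigr => k _; rewrite [RHS]mxE mulrC; congr (_ * _).
    by have [_ ->] := Gm_der Hg Ac' k Vx' i j.
  congr (fun_of_matrix _ i j).
  rewrite /pullGam linear_sum /= mulmx_suml mulmx_sumr -big_split /=.
  apply: eq_bigr => k _; rewrite trmxZ -scalemxAl -scalemxAr -scalerDr //.
have HS a b' d : (H b' *m ec a) d ord0 = (H a *m ec b') d ord0.
  congr (fun_of_matrix _ d ord0); rewrite /H !mulmxDl; congr (_ + _).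
    apply/matrixP => i j; rewrite ord1.
    transitivity (pdmx b' Jac x i a); first exact: mul_ecE.
    transitivity (pdmx a Jac x i b'); last by apply/esym; exact: mul_ecE.
    rewrite [LHS]mxE [RHS]mxE.
    have E y k : overlap y -> Jac y i k = 'D_(e k) (fun z => trans z ord0 i) y.
      exact: JacE.
    transitivity ('D_(e b') (fun y => 'D_(e a) (fun z => trans z ord0 i) y) x).
      by apply: near_eq_derive; apply: (open_near_eq open_overlap) Wx => y Wy; exact: E.
    rewrite (Ck_schwarz _ _ open_overlap (trans_smooth 2 i) Wx).
    by apply: near_eq_derive; apply: (open_near_eq open_overlap) Wx => y Wy; rewrite E.
  have JE k : Jac x *m ec k = \sum_j Jac x j k *: ec j.
    by rewrite mul_ec (sum_ec (col k (Jac x))); apply: eq_bigr => j _; rewrite mxE.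
  rewrite -!mulmxA !JE /pullGam !mulmx_suml.
  under eq_bigr do rewrite mulmx_sumr.
  under [RHS]eq_bigr do rewrite mulmx_sumr.
  rewrite exchange_big; apply: eq_bigr => j _; apply: eq_bigr => k _.
  rewrite -!scalemxAl -!scalemxAr (Gam_sym Hg Ac' k j Vx') !scalerA.
  by rewrite mulrC.
apply: skew_sym_eq0 => [a|a b' d].
  have D1 := Gm_der Hg Ac a Vx.
  have D2 := mderM (mderM (mderT (mCk_mder a (Jac_smooth 1) Wx)) (dG' a)) (mCk_mder a (Jac_smooth 1) Wx).
  have Nr : \forall y \near x, Gm g c y = (Jac y)^T *m Gm g c' (trans y) *m Jac y.
    by apply: (open_near_eq open_overlap) Wx => y Wy; exact: Gm_trans.
  have := mder_unique D1 (mder_near Nr D2); rewrite -/G' => D4.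
  apply/eqP; rewrite -subr_eq0 opprK; apply/eqP.
  transitivity ((pdmx a Jac x)^T *m G' *m Jac x
     + (Jac x)^T *m ((pullGam a x)^T *m G' + G' *m pullGam a x) *m Jac x
     + (Jac x)^T *m G' *m pdmx a Jac x
     - ((Gam g c a x)^T *m Gm g c x + Gm g c x *m Gam g c a x)); last first.
    by rewrite D4 mulmxDl subrr.
  rewrite /D /H; move: (Gm_sym Hg Ac Vx) (Gm_sym Hg Ac' Vx'); rewrite -/G'.
  move: (pdmx a Jac x) (pullGam a x) (Gam g c a x) (Jac x) (G') (Gm g c x) => ? ? ? ? ? ? sG sG'.
  mxexpand; rewrite sG sG'; mxexpand; mxlin.
have Dec : D b' *m ec a = D a *m ec b'.
  have Hec : H b' *m ec a = H a *m ec b'.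
    by apply/matrixP => i j; rewrite ord1; exact: HS.
  move: Hec (Gam_sym Hg Ac b' a Vx); rewrite /D.
  move: (H b') (H a) (Gam g c b' x) (Gam g c a x) => ? ? ? ? h1 h2.
  by rewrite !mulmxBl -!mulmxA h1 h2.
rewrite -[LHS](mul_ecE (D b') a d ord0) Dec; exact: mul_ecE.
Qed.

End ChartChange.

(** * Linear differential equations *)

Section LinearODE.
Variable R : realType.
Local Notation mu := (@lebesgue_measure R).

Lemma antiderivative_exists (f : R -> R) (T : R) : continuous f ->
  exists2 F : R -> R, F 0 = 0 &
    forall t : R, `|t| < T -> is_derive t 1 F (f t).
Proof.
move=> cf.
pose F0 x := (\int[mu]_(t in `[- T, x]) (f t))%R.
exists (fun x => F0 x - F0 0) => [|t tT]; first by rewrite subrr.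
have [t1 t2] : - T < t /\ t < T by move: tT; rewrite ltr_norml => /andP.
have int : mu.-integrable `[- T, T] (EFin \o f).
  apply: continuous_compact_integrable; first exact: segment_compact.
  exact: continuous_subspaceT.
have [d1 d2] := @continuous_FTC1_closed R f (- T) t T t2 int t1 (cf t).
have h : is_derive t 1 F0 (f t).
  by split; [exact: d1|rewrite -derive1E; exact: d2].
by apply: is_derive_eq (pderB h (pder_cst (F0 0) t 1)) _; rewrite subr0.
Qed.

(** The tail of the geometric series is at most twice its first term, so [u n - 2 * 2^-1 ^+ n]
    increases and [u n + 2 * 2^-1 ^+ n] decreases; the limit is the supremum of the lower
    envelope. *)
Lemma geometric_limit (u : nat -> R) :
  (forall n, `|u n.+1 - u n| <= 2^-1 ^+ n) ->
  exists l, forall n, `|u n - l| <= 2 * 2^-1 ^+ n.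
Proof.
move=> du.
pose v n := u n - 2 * 2^-1 ^+ n; pose w n := u n + 2 * 2^-1 ^+ n.
have dv n : v n <= v n.+1.
  have := du n; rewrite /v ler_norml exprS => /andP[h1 h2]; lra.
have dw n : w n.+1 <= w n.
  have := du n; rewrite /w ler_norml exprS => /andP[h1 h2]; lra.
have vmono m n : (m <= n)%N -> v m <= v n.
  by move=> mn; apply: (@homo_leq _ v (fun x y => x <= y)) mn => //; exact: le_trans.
have wmono m n : (m <= n)%N -> w n <= w m.
  by move=> mn; apply: (@homo_leq _ w (fun x y => y <= x)) mn => // x y z h1 h2; exact: le_trans h2 h1.
have p0 n : 0 <= 2^-1 ^+ n :> R by rewrite exprn_ge0 // invr_ge0.
have vw m n : v m <= w n.
  apply: le_trans (vmono _ _ (leq_maxl m n)) _; apply: le_trans (wmono _ _ (leq_maxr m n)).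
  by rewrite /v /w; have := p0 (maxn m n); lra.
have ubv n : ubound (range v) (w n) by move=> _ [m _ <-].
have sv : has_sup (range v) by split; [exists (v 0%N), 0%N|exists (w 0%N)].
exists (sup (range v)) => n.
have h1 : v n <= sup (range v) by apply: sup_upper_bound => //; exists n.
have h2 : sup (range v) <= w n by apply: ge_sup; [exact: sv.1|exact: ubv].
by rewrite ler_norml; move: h1 h2; rewrite /v /w => h1 h2; apply/andP; split; lra.
Qed.

Lemma geometric_small (eps : R) : 0 < eps -> exists n, 2 * 2^-1 ^+ n < eps.
Proof.
move=> e0; have : (2^-1 : R) ^+ n @[n --> \oo] --> (0 : R).
  by apply: cvg_expr; rewrite ger0_norm ?invr_ge0 // invf_lt1 // ltr1n.
move=> /cvgrPdist_lt/(_ (eps / 2)); rewrite divr_gt0 // => /(_ isT)[n _ /(_ n)] /=.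
rewrite leqnn => /(_ isT); rewrite sub0r normrN ger0_norm ?exprn_ge0 ?invr_ge0 // => h.
by exists n; lra.
Qed.

Lemma geometric_limit_continuous (T : topologicalType) (u : nat -> T -> R) (l : T -> R) x :
  (forall n, {for x, continuous (u n)}) ->
  (forall n y, `|u n y - l y| <= 2 * 2^-1 ^+ n) -> {for x, continuous l}.
Proof.
move=> cu ul; apply/cont_distP => eps e0.
have [n hn] := @geometric_small (eps / 3) (divr_gt0 e0 (ltr0n _ 3)).
have e3 : 0 < eps / 3 by rewrite divr_gt0.
have := (cont_distP (u n) x).1 (cu n) (eps / 3) e3.
apply: filterS => y h.
have -> : l x - l y = - (u n x - l x) + (u n x - u n y) + (u n y - l y) by ring.
have := ul n x; have := ul n y => h1 h2.
apply: le_lt_trans (ler_normD _ _) _; have := ler_normD (- (u n x - l x)) (u n x - u n y).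
rewrite normrN; lra.
Qed.

Lemma geometric_zero (z : R) : (forall n, `|z| <= 2 * (2 * 2^-1 ^+ n)) -> z = 0.
Proof.
move=> h; apply/eqP; rewrite -normr_eq0; apply/negPn/negP => z0.
have zp : 0 < `|z| / 2 by rewrite divr_gt0 // lt_neqAle eq_sym z0 normr_ge0.
have [n hn] := geometric_small zp; have := h n; lra.
Qed.

Lemma bound_from_derive (F F' : R -> R) (s K : R) :
  (forall t : R, `|t| <= `|s| -> is_derive t 1 F (F' t)) ->
  (forall t : R, `|t| <= `|s| -> `|F' t| <= K) -> F 0 = 0 -> `|F s| <= K * `|s|.
Proof.
move=> dF hF F0.
have I (t : R) : t \in `[Order.min 0 s, Order.max 0 s]%R -> `|t| <= `|s|.
  rewrite in_itv /= => /andP[]; have [s_ge0|/ltW s_le0] := leP 0 s => h1 h2.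
    by rewrite (ger0_norm h1) (ger0_norm s_ge0).
  by rewrite (ler0_norm h2) (ler0_norm s_le0) lerN2.
have dF' (t : R) : t \in `[Order.min 0 s, Order.max 0 s]%R -> is_derive t 1 F (F' t).
  by move=> /I; exact: dF.
have [t /I tI] := mvt_abs dF'; rewrite F0 !subr0 => ->.
by rewrite normrM ler_wpM2r // hF.
Qed.

Variables (n : nat) (B : R -> 'M[R]_n) (C s0 : R).
Hypothesis C0 : 0 < C.
Hypothesis s00 : 0 < s0.
Hypothesis B_cont : forall (t : R) i j, `|t| <= s0 -> {for t, continuous (fun s => B s i j)}.
Hypothesis B_bound : forall (t : R) i j, `|t| <= s0 -> `|B t i j| <= C.
Hypothesis small : n%:R * C * s0 <= 2^-1.

(** [B] is controlled only for [|s| <= s0]. Clamping the parameter gives integrands continuous on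
    the whole line, with global bounds, and changes nothing on that interval. *)
Let clamp (s : R) : R := Order.max (- s0) (Order.min s0 s).

Let clamp_le s : `|clamp s| <= s0.
Proof.
rewrite /clamp ler_norml le_max lexx /= ge_max ge_min lexx /= andbT; have := s00; lra.
Qed.

Let clamp_id s : `|s| <= s0 -> clamp s = s.
Proof.
rewrite /clamp ler_norml => /andP[h1 h2].
by rewrite (min_idPr h2) (max_idPr h1).
Qed.

Let clamp_cont : continuous clamp.
Proof.
move=> s; apply: (@continuous_max _ _ (fun=> - s0) (fun s => Order.min s0 s)).
  exact: cvg_cst.
by apply: (@continuous_min _ _ (fun=> s0) id); [exact: cvg_cst|exact: cvg_id].
Qed.

Let integrand (X : R -> 'M[R]_n) (s : R) : 'M[R]_n := B (clamp s) *m X s.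

Let anti_ex (f : R -> R) : exists F : R -> R, continuous f ->
  F 0 = 0 /\ forall t : R, `|t| < 2 * s0 -> is_derive t 1 F (f t).
Proof.
have [cf|] := pselect (continuous f); last by exists (fun=> 0).
by have [F F0 dF] := @antiderivative_exists f (2 * s0) cf; exists F.
Qed.
Let anti (f : R -> R) : R -> R := sval (cid (anti_ex f)).
Let antiP (f : R -> R) : continuous f -> anti f 0 = 0 /\ forall t : R, `|t| < 2 * s0 -> is_derive t 1 (anti f) (f t).
Proof. exact: (svalP (cid (anti_ex f))). Qed.

(** The Picard operator. By [small] it halves entrywise distances on [|s| <= s0]. The antiderivative
    is valid for [|t| < 2 * s0], which makes the derivative two-sided at the ends [-s0] and [s0]. *)
Let step (X : R -> 'M[R]_n) (s : R) : 'M[R]_n :=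
  1%:M + \matrix_(i, j) anti (fun t => integrand X t i j) s.

Let mcont (X : R -> 'M[R]_n) := forall i j, continuous (fun s => X s i j).

Let integrand_cont X : mcont X -> mcont (integrand X).
Proof.
move=> cX i j s.
have -> : (fun s => integrand X s i j) = (fun s => \sum_k B (clamp s) i k * X s k j).
  by apply/funext => t; rewrite mxE.
apply: (@continuous_big _ _ _ _ _ _ _ _ (fun k t => B (clamp t) i k * X t k j)) => [|k _ t].
  exact: add_continuous.
apply: contM; last exact: cX.
apply: (@continuous_comp _ _ _ clamp (fun s => B s i k)); first exact: clamp_cont.
exact: B_cont.
Qed.

Let step_der X (t : R) : mcont X -> `|t| <= s0 -> mder (step X) t 1 (integrand X t).
Proof.
move=> cX ts i j; have [_ /(_ t) h] := antiP (@integrand_cont X cX i j).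
have tl : `|t| < 2 * s0 by have := s00; lra.
under eq_fun do rewrite !mxE.
by apply: is_derive_eq (pderD (pder_cst _ _ _) (h tl)) _; rewrite add0r.
Qed.

Let step0 X : mcont X -> step X 0 = 1%:M.
Proof.
move=> cX; apply/matrixP => i j; rewrite [LHS]mxE [X in _ + X]mxE.
by have [-> _] := antiP (@integrand_cont X cX i j); rewrite addr0.
Qed.

Let step_clamp_cont X : mcont X -> mcont (step X \o clamp).
Proof.
move=> cX i j s.
apply: (@continuous_comp _ _ _ clamp (fun s => step X s i j)); first exact: clamp_cont.
exact: is_derive_continuous1 (@step_der X _ cX (clamp_le s) i j).
Qed.

Let step_diff X Y (d s : R) : mcont X -> mcont Y ->
  (forall (t : R) i j, `|t| <= s0 -> `|X t i j - Y t i j| <= d) -> `|s| <= s0 ->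
  forall i j, `|step X s i j - step Y s i j| <= 2^-1 * d.
Proof.
move=> cX cY XY ss i j.
have z0 : `|0 : R| <= s0 by rewrite normr0 ltW.
have d0 : 0 <= d := le_trans (normr_ge0 _) (XY 0 i j z0).
have ts (t : R) : `|t| <= `|s| -> `|t| <= s0 by move=> h; apply: le_trans ss.
have : `|step X s i j - step Y s i j| <= (n%:R * C * d) * `|s|.
  apply: (@bound_from_derive (fun s => step X s i j - step Y s i j)
    (fun t => integrand X t i j - integrand Y t i j) s).
  - by move=> t /ts tl; apply: pderB; exact: step_der.
  - move=> t /ts tl; rewrite /integrand clamp_id // !mxE -sumrB.
    apply: le_trans (ler_norm_sum _ _ _) _.
    have -> : n%:R * C * d = \sum_(k < n) (C * d).
      by rewrite sumr_const card_ord -mulrA mulr_natl.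
    apply: ler_sum => k _.
    by rewrite -mulrBr normrM; apply: ler_pM => //; [exact: B_bound|exact: XY].
  - by rewrite !step0 // subrr.
move/le_trans; apply.
have h1 : n%:R * C * d * `|s| <= n%:R * C * d * s0.
  by apply: ler_wpM2l => //; rewrite !mulr_ge0 // ltW.
apply: le_trans h1 _; have := ler_wpM2r d0 small; lra.
Qed.

Let Xs := fix Xs (m : nat) : R -> 'M[R]_n :=
  if m is m'.+1 then step (Xs m') \o clamp else fun=> 1%:M.

Let Xs_cont m : mcont (Xs m).
Proof.
elim: m => [|m IH]; last exact: step_clamp_cont.
by move=> i j s; exact: cvg_cst.
Qed.

Let Xs_step m s i j : `|Xs m.+1 s i j - Xs m s i j| <= 2^-1 ^+ m.
Proof.
elim: m s i j => [|m IH] s i j; last first.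
  rewrite exprS.
  change (`|step (Xs m.+1) (clamp s) i j - step (Xs m) (clamp s) i j| <= 2^-1 * 2^-1 ^+ m).
  refine (@step_diff (Xs m.+1) (Xs m) (2^-1 ^+ m) (clamp s) _ _ _ _ i j); try exact: Xs_cont.
    by move=> t i' j' _; exact: IH.
  exact: clamp_le.
rewrite expr0 /=.
have cl := clamp_le s; have c1 : mcont (fun=> 1%:M) by move=> ? ? ?; exact: cvg_cst.
have n0 : 1 <= n%:R :> R by rewrite ler1n; case: (n) i => // -[].
have : `|step (fun=> 1%:M) (clamp s) i j - (1%:M : 'M[R]_n) i j| <= C * `|clamp s|.
  apply: (@bound_from_derive (fun s => step (fun=> 1%:M) s i j - (1%:M : 'M[R]_n) i j)
    (fun t => integrand (fun=> 1%:M) t i j) (clamp s)).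
  - move=> t tl; have ts : `|t| <= s0 by apply: le_trans cl.
    by apply: is_derive_eq (pderB (@step_der _ _ c1 ts i j) (pder_cst _ _ _)) _; rewrite subr0.
  - move=> t tl; have ts : `|t| <= s0 by apply: le_trans cl.
    by rewrite /integrand mulmx1 clamp_id //; exact: B_bound.
  - by rewrite step0 // subrr.
move=> h; apply: le_trans h _; have h1 : C * `|clamp s| <= C * s0 by rewrite ler_wpM2l // ltW.
have h2 : C * s0 <= n%:R * (C * s0) by rewrite ler_peMl // mulr_ge0 // ltW.
have := small; rewrite -mulrA; lra.
Qed.

(** The limit of the Picard iterates. The geometric bound at index 0 puts its entries within 2 of
    those of the identity, hence below 3 in absolute value; this is the 3 in the final estimate. *)
Lemma linear_ode_exists : exists Y : R -> 'M[R]_n,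
  [/\ Y 0 = 1%:M, forall s : R, `|s| <= s0 -> mder Y s 1 (B s *m Y s) &
      forall (s : R) i j, `|s| <= s0 -> `|Y s i j - (1%:M : 'M[R]_n) i j| <= 3 * n%:R * C * `|s|].
Proof.
have lim_ex s i j : exists l, forall m, `|Xs m s i j - l| <= 2 * 2^-1 ^+ m.
  by apply: geometric_limit => m; exact: Xs_step.
pose X s : 'M[R]_n := \matrix_(i, j) sval (cid (lim_ex s i j)).
have XP s i j m : `|Xs m s i j - X s i j| <= 2 * 2^-1 ^+ m.
  by rewrite mxE; exact: (svalP (cid (lim_ex s i j))).
have cX : mcont X.
  move=> i j s; apply: (@geometric_limit_continuous _ (fun m s => Xs m s i j)) => [m|m y].
    exact: Xs_cont.
  exact: XP.
have E s : `|s| <= s0 -> step X s = X s.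
  move=> ss; apply/matrixP => i j; apply/eqP; rewrite -subr_eq0; apply/eqP.
  apply: geometric_zero => m.
  have h1 := @step_diff _ _ _ _ (@Xs_cont m) cX (fun t i j _ => XP t i j m) ss i j.
  have h2 := XP s i j m.+1; rewrite /= clamp_id // in h2.
  have -> : step X s i j - X s i j =
    - (step (Xs m) s i j - step X s i j) + (step (Xs m) s i j - X s i j) by ring.
  apply: le_trans (ler_normD _ _) _; rewrite normrN.
  move: h2; rewrite exprS; have : 0 <= 2^-1 ^+ m :> R by rewrite exprn_ge0 // invr_ge0.
  lra.
exists (step X); split; first exact: step0.
- move=> s ss; apply: mder_eq (@step_der _ _ cX ss) _.
  by rewrite /integrand clamp_id // E.
- move=> s i j ss; have ts (t : R) : `|t| <= `|s| -> `|t| <= s0 by move=> h; apply: le_trans ss.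
  apply: (@bound_from_derive (fun s => step X s i j - (1%:M : 'M[R]_n) i j) (fun t => integrand X t i j)).
  + by move=> t /ts tl; apply: is_derive_eq (pderB (@step_der _ _ cX tl i j) (pder_cst _ _ _)) _; rewrite subr0.
  + move=> t /ts tl; rewrite /integrand clamp_id // mxE.
    apply: le_trans (ler_norm_sum _ _ _) _.
    have -> : 3 * n%:R * C = \sum_(k < n) (C * 3).
      by rewrite sumr_const card_ord -(mulr_natl (C * 3) n); ring.
    apply: ler_sum => k _.
    rewrite normrM; apply: ler_pM => //; first exact: B_bound.
    have := XP t k j 0%N; rewrite /= expr0 mulr1 => h.
    have h1 : `|(1%:M : 'M[R]_n) k j| <= 1 by rewrite mxE; case: (k == j); rewrite ?normr1 ?normr0.
    have -> : X t k j = (1%:M : 'M[R]_n) k j - ((1%:M : 'M[R]_n) k j - X t k j) by ring.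
    by apply: le_trans (ler_normB _ _) _; lra.
  + by rewrite step0 // subrr.
Qed.

End LinearODE.

(** * Parallel transport along coordinate axes *)

Section IteratedDerivatives.
Variables (R : realType) (O : set R).
Hypothesis oO : open O.

(** Repeated differentiability with an existential derivative: sums, products and restrictions to a
    curve are handled without computing [derive1n]. *)
Fixpoint dk (k : nat) (h : R -> R) : Prop :=
  if k is k'.+1 then exists h' : R -> R,
    (forall t : R, O t -> is_derive t 1 h (h' t)) /\ dk k' h' else True.

Lemma dk_ext k h1 h2 : (forall t, O t -> h1 t = h2 t) -> dk k h1 -> dk k h2.
Proof.
case: k => // k E [h' [d1 d2]]; exists h'; split=> // t Ot.
apply: is_derive_near (d1 t Ot).
have : nbhs t O by exact: open_nbhs_nbhs.
by apply: filterS => u /E ->.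
Qed.

Lemma dkW k h : dk k.+1 h -> dk k h.
Proof.
by elim: k h => // k IH h [h' [d1 d2]]; exists h'; split=> //; exact: IH.
Qed.

Lemma dk_cst k (z : R) : dk k (fun=> z).
Proof.
elim: k z => // k IH z; exists (fun=> 0); split; last exact: IH.
by move=> t _; exact: pder_cst.
Qed.

Lemma dkD k f g : dk k f -> dk k g -> dk k (fun t => f t + g t).
Proof.
elim: k f g => // k IH f g [f' [df hf]] [g' [dg hg]].
exists (fun t => f' t + g' t); split; last exact: IH.
by move=> t Ot; apply: pderD; [exact: df|exact: dg].
Qed.

Lemma dkM k f g : dk k f -> dk k g -> dk k (fun t => f t * g t).
Proof.
elim: k f g => // k IH f g hf hg; have := hf; have := hg.
move=> [g' [dg hg']] [f' [df hf']].
exists (fun t => f' t * g t + f t * g' t); split.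
  by move=> t Ot; apply: pderM; [exact: df|exact: dg].
by apply: dkD; apply: IH => //; exact: dkW.
Qed.

Lemma dk_derive1n k h t : dk k.+1 h -> O t -> derivable (derive1n k h) t 1.
Proof.
elim: k h => [|k IH] h [h' [dh hh']] Ot; first by have [] := dh t Ot.
rewrite derive1Sn; apply: IH Ot; apply: (@dk_ext k.+1 h') => [u Ou|//].
by rewrite derive1E; have [_ ->] := dh u Ou.
Qed.

End IteratedDerivatives.

Section SineCurve.
Variable R : realType.

(** Curves have to be smooth on the whole line and stay in the chart, so an axis segment is swept
    with amplitude [sine], bounded by 1. Between times 0 and 1 the phase 0 runs from 0 to 1 and the
    phase [pi / 2] runs back. *)
Definition sine (th t : R) : R := sin (t * (pi / 2) + th).

Lemma sine_der (th t : R) : is_derive t 1 (sine th) (pi / 2 * sine (th + pi / 2) t).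
Proof.
have h : is_derive t 1 (fun t : R => t * (pi / 2) + th) (pi / 2).
  have := pderD (pderM (is_derive_id t 1) (pder_cst (pi / 2) t 1)) (pder_cst th t 1).
  by move/is_derive_eq; apply; rewrite mul1r mulr0 !addr0.
apply: is_derive_eq (pder_comp h (is_derive_sin _)) _.
by rewrite /sine addrA sinDpihalf mulrC.
Qed.

Lemma dk_sine O k th : dk O k (sine th).
Proof.
elim: k th => // k IH th; exists (fun t => pi / 2 * sine (th + pi / 2) t); split.
  by move=> t _; exact: sine_der.
by apply: dkM; [exact: dk_cst|exact: IH].
Qed.

Lemma sine_le th t : `|sine th t| <= 1.
Proof. exact: sin_max. Qed.

Variables (n : nat) (y : 'rV[R]_n) (a : 'I_n) (s th : R).
Local Notation e a := (delta_mx ord0 a : 'rV[R]_n).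

Definition axis_curve (t : R) : 'rV[R]_n := y + (s * sine th t) *: e a.
Definition axis_speed (t : R) : R := s * (pi / 2 * sine (th + pi / 2) t).

Lemma amplitude_der (t : R) : is_derive t 1 (fun t : R => s * sine th t) (axis_speed t).
Proof.
have := pderM (pder_cst s t 1) (sine_der th t).
by move/is_derive_eq; apply; rewrite mul0r add0r.
Qed.

Lemma axis_curve_continuous : continuous axis_curve.
Proof.
move=> t; apply: (@cvgD R 'rV[R]_n _ (nbhs t)); first exact: cvg_cst.
apply: (@cvgZr_tmp R 'rV[R]_n _ (nbhs t)).
exact: is_derive_continuous1 (amplitude_der t).
Qed.

Lemma axis_curve_der (f : 'rV[R]_n -> R) f' (t : R) :
  is_derive (axis_curve t) (e a) f f' ->
  is_derive t 1 (fun t : R => f (axis_curve t)) (f' * axis_speed t).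
Proof.
move=> h; apply: (@pder_comp _ _ (fun u => f (y + u *: e a))) (amplitude_der t) _.
exact: is_derive_line h.
Qed.

Lemma axis_curve_mder m p (X : 'rV[R]_n -> 'M[R]_(m, p)) X' (t : R) :
  mder X (axis_curve t) (e a) X' ->
  mder (fun t : R => X (axis_curve t)) t 1 (axis_speed t *: X').
Proof.
move=> h i j; rewrite mxE mulrC.
exact: (@axis_curve_der (fun z => X z i j)).
Qed.

Lemma dk_axis_curve (W : set 'rV[R]_n) (O : set R) k f : open O ->
  (forall t, O t -> W (axis_curve t)) -> Ck k W f ->
  dk O k (fun t => f (axis_curve t)).
Proof.
move=> oO OW; elim: k f => // k IH f hf.
exists (fun t => 'D_(e a) f (axis_curve t) * axis_speed t); split.
  by move=> t /OW Wt; apply: axis_curve_der; exact: (Ck_derive _ hf).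
apply: dkM; first exact: (IH (fun x => 'D_(e a) f x) (CkS_D a hf)).
apply: dkM; first exact: dk_cst.
by apply: dkM; [exact: dk_cst|exact: dk_sine].
Qed.

End SineCurve.

Section JacobianCocycle.
Variables (R : realType) (M : topologicalType) (A : set (chart R M)).
Hypothesis HA : is_atlas A.
Local Notation e a := (delta_mx ord0 a : 'rV[R]_4).

Lemma jac_cocycle (c c' c'' : chart R M) p : A c -> A c' -> A c'' ->
  dom c p -> dom c' p -> dom c'' p ->
  jac c c'' p = jac c' c'' p *m jac c c' p.
Proof.
move=> Ac Ac' Ac'' cp cp' cp''.
have Vx := img_coord cp.
have Ox : overlap c c' (coord c p) by split; [|rewrite coordK].
have tx : trans c c' (coord c p) = coord c' p by rewrite /trans coordK.
have Ox' : overlap c' c'' (coord c' p).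
  by split; [exact: img_coord|rewrite coordK].
apply/matrixP => i b; rewrite [LHS]mxE.
have hf := trans_smooth HA Ac' Ac'' 1 i.
have oO := @open_overlap R M c' c''.
have WO : overlap c' c'' (trans c c' (coord c p)) by rewrite tx.
have [_ h] := @chain_rule R M A HA c c' Ac Ac' (fun q => coord c'' q ord0 i) _ _ b Ox oO WO hf.
rewrite /pd [LHS]h tx [RHS]mxE; apply: eq_bigr => k _.
by rewrite [jac _ _ _ i k]mxE /Jac coordK.
Qed.

Lemma jac_id (c : chart R M) p : dom c p -> jac c c p = 1%:M.
Proof.
move=> cp; apply/matrixP => i b; rewrite [LHS]mxE /pd.
have d : is_derive (coord c p) (e b) (fun x : 'rV[R]_4 => x ord0 i) ((i == b)%:R).
  apply: is_derive_line0.
  have := pderD (pder_cst (coord c p ord0 i) (0 : R) 1)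
    (pderM (is_derive_id (0 : R) 1) (pder_cst ((i == b)%:R : R) (0 : R) 1)).
  move/is_derive_eq => /(_ ((i == b)%:R)); rewrite mul1r mulr0 addr0 add0r => /(_ erefl).
  suff -> : (fun s : R => (coord c p + s *: e b) ord0 i) =
    (fun s : R => coord c p ord0 i + s * (i == b)%:R) by [].
  by apply/funext => s; rewrite !mxE eqxx.
have := @is_derive_near _ _ ((fun q => coord c q ord0 i) \o par c) _ _ _ _ _ d.
case; last by move=> _ ->; rewrite mxE.
apply: (open_near_eq (@open_img R M c)) (img_coord cp) => y Vy /=.
by rewrite parK.
Qed.

End JacobianCocycle.

Section AxisTransport.
Variables (R : realType) (M : topologicalType) (A : set (chart R M)).
Variable g : tensor2_field R M.
Hypothesis Hg : spacetime A g.
Variable c : chart R M.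
Hypothesis Ac : A c.
Local Notation e a := (delta_mx ord0 a : 'rV[R]_4).
Variables (y : 'rV[R]_4) (a : 'I_4) (s0 : R) (Y : R -> 'M[R]_4).
Hypothesis Hseg : forall s : R, `|s| <= s0 -> img c (y + s *: e a).
Hypothesis HY : forall s : R, `|s| <= s0 ->
  mder Y s 1 (- Gam g c a (y + s *: e a) *m Y s).

Let HA : is_atlas A.
Proof. by case: Hg. Qed.

(* Parallel transport preserves the metric, so the frame stays invertible. *)
Lemma axis_frame_unit s : Y 0 = 1%:M -> `|s| <= s0 -> Y s \in unitmx.
Proof.
move=> Y0 ss.
pose Q t := (Y t)^T *m Gm g c (y + t *: e a) *m Y t.
have le_s (t : R) : `|t| <= `|s| -> `|t| <= s0 by move=> h; exact: le_trans ss.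
have dQ (t : R) : `|t| <= s0 -> mder Q t 1 0.
  move=> ts; have Vt := Hseg ts.
  have := mderM (mderM (mderT (HY ts)) (mder_line (Gm_der Hg Ac a Vt))) (HY ts).
  move/mder_eq; apply.
  by move: (Gam g c a _) (Gm g c _) (Y t) => ? ? ?; mxexpand; mxlin.
have QE : Q s = Q 0.
  apply/matrixP => i j; apply/eqP; rewrite -subr_eq0 -normr_le0.
  have := @bound_from_derive R (fun t => Q t i j - Q 0 i j) (fun=> 0) s 0.
  rewrite mul0r; apply; last by rewrite subrr.
  - move=> t /le_s ts; have := pderB (dQ t ts i j) (pder_cst (Q 0 i j) t 1).
    by move/is_derive_eq; apply; rewrite [X in X - _]mxE subr0.
  - by move=> t _; rewrite normr0.
have z0 : `|0 : R| <= s0 by rewrite normr0; apply: le_trans ss.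
have : Q 0 \in unitmx.
  by rewrite /Q Y0 trmx1 mul1mx mulmx1; exact: (Gm_unit Hg Ac (Hseg z0)).
by rewrite -QE /Q unitmx_mul => /andP[].
Qed.

Variables (s th : R).
Hypothesis ss0 : `|s| <= s0.

Let crv := axis_curve y a s th.
Definition axis_gam (t : R) : M := par c (crv t).

Let amp_le t : `|s * sine th t| <= s0.
Proof.
rewrite normrM; apply: le_trans ss0; rewrite ler_piMr //; exact: sine_le.
Qed.

Let crv_img t : img c (crv t).
Proof. exact: Hseg. Qed.

Lemma axis_gam_continuous : continuous axis_gam.
Proof.
move=> t; apply: (@continuous_comp _ _ _ crv (par c)).
  exact: axis_curve_continuous.
exact: par_continuous (crv_img t).
Qed.

Let crv_overlap c' t : dom c' (axis_gam t) -> overlap c c' (crv t).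
Proof. by move=> h; split; [exact: crv_img|split=> //; exact: dom_par]. Qed.

Lemma axis_gam_smooth : smooth_curve A axis_gam.
Proof.
split=> [|c' t Ac' ct i k]; first exact: axis_gam_continuous.
pose O := axis_gam @^-1` dom c'.
have oO : open O.
  apply: open_comp; last exact: dom_open.
  by move=> u _; exact: axis_gam_continuous.
apply: (@dk_derive1n _ O oO) => //.
apply: (@dk_axis_curve R 4 y a s th (overlap c c') O _ (fun x => trans c c' x ord0 i)) => //.
  by move=> u; exact: crv_overlap.
exact: (trans_smooth HA Ac Ac').
Qed.

Lemma axis_velocity c' t : A c' -> dom c' (axis_gam t) ->
  velocity c' axis_gam t = axis_speed s th t *: col a (Jac c c' (crv t)).
Proof.
move=> Ac' ct; apply/matrixP => i j; rewrite mxE derive1E.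
have := axis_curve_der (trans_der HA Ac Ac' i a (crv_overlap ct)).
by case=> _; rewrite /axis_gam => ->; rewrite !mxE mulrC.
Qed.

(** The solution [Y] in the chart [c], carried to [c'] by the Jacobian. The constant right factor
    [Z] preserves parallelism and serves to make the frame the identity at time 0. *)
Definition axis_frame (Z : 'M[R]_4) (c' : chart R M) (t : R) : 'M[R]_4 :=
  jac c c' (axis_gam t) *m Y (s * sine th t) *m Z.

Lemma axis_frame_der Z c' t : A c' -> dom c' (axis_gam t) ->
  mder (axis_frame Z c') t 1
    (- axis_speed s th t *: (pullGam c c' g a (crv t) *m axis_frame Z c' t)).
Proof.
move=> Ac' ct; have Ot := crv_overlap ct.
have dJ := axis_curve_mder (Jac_der HA Ac Ac' Hg a Ot).
have dY : mder (fun t : R => Y (s * sine th t)) t 1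
    (axis_speed s th t *: (- Gam g c a (crv t) *m Y (s * sine th t))).
  move=> i j; rewrite mxE mulrC.
  exact: (@pder_comp _ _ (fun u => Y u i j)) (amplitude_der s th t) (HY (amp_le t) i j).
have := mderM (mderM dJ dY) (mder_cst Z t 1).
rewrite /axis_frame -/(Jac c c' (crv t)) -/crv; move/mder_eq; apply.
move: (Jac c c' _) (Gam g c a _) (Y _) (pullGam _ _ _ _ _) (axis_speed _ _ _) => ? ? ? ? ?.
by mxexpand; mxlin.
Qed.

Lemma axis_parallel_frame Z : parallel_frame A g axis_gam (axis_frame Z).
Proof.
split=> [c1 c2 t Ac1 Ac2 ct1 ct2|c' t Ac' ct k].
  rewrite /axis_frame (jac_cocycle HA (c' := c1) Ac) ?mulmxA //.
  exact: dom_par (crv_img t).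
have dX := axis_frame_der Z Ac' ct.
split=> [i|]; first by have [] := dX i k.
apply/matrixP => i j; rewrite [LHS]mxE [RHS]mxE derive1E.
have -> : (fun s1 => col k (axis_frame Z c' s1) i ord0) = (fun s1 => axis_frame Z c' s1 i k).
  by apply/funext => u; rewrite mxE.
have [_ ->] := dX i k; rewrite axis_velocity //.
have Ot := crv_overlap ct.
apply/eqP; rewrite addrC addr_eq0; apply/eqP.
transitivity ((axis_speed s th t *: (pullGam c c' g a (crv t) *m axis_frame Z c' t)) i k); last first.
  by rewrite scaleNr [in RHS]mxE opprK.
rewrite /pullGam mulmx_suml scaler_sumr summxE; apply: eq_bigr => b _.
rewrite -scalemxAl scalerA [RHS]mxE [X in _ = _ * X]mxE mulr_sumr; apply: eq_bigr => d _.
rewrite [(_ *: col a _) b ord0]mxE [col a _ b ord0]mxE [col k _ d ord0]mxE.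
rewrite [Gam _ _ _ _ i d]mxE par_trans // -/(axis_gam t).
by move: (christoffel _ _ _ _ _ _) (axis_speed _ _ _) (Jac _ _ _ _ _) (axis_frame _ _ _ d k)
  => ? ? ? ?; ring.
Qed.

Lemma axis_smooth_transport c1 c2 :
  Y (s * sine th 0) \in unitmx -> A c1 -> A c2 ->
  dom c1 (axis_gam 0) -> dom c2 (axis_gam 1) ->
  smooth_transport A g c1 (axis_gam 0) c2 (axis_gam 1)
    (jac c c2 (axis_gam 1) *m Y (s * sine th 1)
     *m (invmx (Y (s * sine th 0)) *m invmx (jac c c1 (axis_gam 0)))).
Proof.
move=> uY Ac1 Ac2 d1 d2.
exists axis_gam, (axis_frame (invmx (Y (s * sine th 0)) *m invmx (jac c c1 (axis_gam 0)))).
split=> //; first by split=> //; exact: axis_gam_smooth.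
- exact: axis_parallel_frame.
split=> //; rewrite /axis_frame mulmxA mulmxK //.
by rewrite mulmxV //; exact: (Jac_unit Ac Ac1 Hg (crv_overlap d1)).
Qed.

End AxisTransport.

(** * Matrix exponential and conjugation *)

Section MatrixExponential.
Variable R : realType.
Implicit Types E P : 'M[R]_4.

Lemma cvg_mx_entries m p (u : nat -> 'M[R]_(m, p)) (l : 'M[R]_(m, p)) :
  (forall i j, u n i j @[n --> \oo] --> l i j) -> u @ \oo --> l.
Proof.
move=> h; apply/cvgrPdist_lt => eps e0; near=> n.
rewrite /Num.Def.normr /= mx_normrE; apply/bigmax_ltP; split=> // -[i j] _ /=.
rewrite !mxE; move: i j; near: n; apply: filter_forall => i; apply: filter_forall => j.
by have /cvgrPdist_lt/(_ _ e0) := h i j.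
Unshelve. all: by end_near. Qed.

Lemma cvg_mx_entry m p (u : nat -> 'M[R]_(m, p)) (l : 'M[R]_(m, p)) i j :
  u @ \oo --> l -> u n i j @[n --> \oo] --> l i j.
Proof.
move=> h; apply: (@cvg_comp _ _ _ u (fun B : 'M[R]_(m, p) => B i j) _ _ _ h).
exact: (@coord_continuous R m p i j l).
Qed.

Definition exp_term E (k : nat) : 'M[R]_4 := (k`!%:R : R)^-1 *: E ^+ k.

Lemma exp_term_bound E (m : R) k i j : 0 <= m -> (forall i j, `|E i j| <= m) ->
  `|exp_term E k i j| <= exp_coeff (4 * m) k.
Proof.
move=> m0 hE; rewrite /exp_term /exp_coeff /= mxE normrM ger0_norm ?invr_ge0 // mulrC.
rewrite ler_wpM2r ?invr_ge0 //.
elim: k i j => [|k IH] i j.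
  by rewrite !expr0 mxE; case: (i == j); rewrite ?normr1 ?normr0.
rewrite exprS [in leRHS]exprS mxE; apply: le_trans (ler_norm_sum _ _ _) _.
have -> : 4 * m * (4 * m) ^+ k = \sum_(l < 4) (m * (4 * m) ^+ k).
  by rewrite sumr_const card_ord -(mulr_natl (m * _) 4) mulrA.
by apply: ler_sum => l _; rewrite normrM ler_pM.
Qed.

Lemma expmx_cvg E : series (exp_term E) @ \oo --> expmx E.
Proof.
suff : cvgn (series (exp_term E)) by [].
pose m := \sum_i \sum_j `|E i j|.
have m0 : 0 <= m by apply: sumr_ge0 => i _; exact: sumr_ge0.
have hE i j : `|E i j| <= m.
  rewrite /m (bigD1 i) //= (bigD1 j) //= -addrA lerDl addr_ge0 ?sumr_ge0 // => k _.
  exact: sumr_ge0.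
have c i j : cvgn (series (fun k => exp_term E k i j)).
  apply: normed_cvg; apply: (@series_le_cvg _ _ (exp_coeff (4 * m))).
  - by move=> n; exact: normr_ge0.
  - by move=> n; apply: exp_coeff_ge0; rewrite mulr_ge0.
  - by move=> n; exact: exp_term_bound.
  - exact: is_cvg_series_exp_coeff.
apply/cvg_ex; exists (\matrix_(i, j) limn (series (fun k => exp_term E k i j))).
apply: cvg_mx_entries => i j; rewrite mxE.
have -> : (fun n => series (exp_term E) n i j) = series (fun k => exp_term E k i j).
  by apply/funext => n; rewrite /series /= summxE.
exact: c.
Qed.

(** Conjugation commutes with powers and passes to the limit entry by entry. It turns a conjugate of
    an element of the holonomy algebra into one whose exponentials are transports around loops. *)
Lemma expmx_conj E P : P \in unitmx ->
  expmx (invmx P *m E *m P) = invmx P *m expmx E *m P.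
Proof.
move=> uP; rewrite {1}/expmx -/(exp_term _).
apply: cvg_lim; first exact: norm_hausdorff.
have pw k : (invmx P *m E *m P) ^+ k = invmx P *m E ^+ k *m P.
  elim: k => [|k IH]; first by rewrite !expr0 mulmx1 mulVmx.
  by rewrite !exprS IH -![_ * _]/(_ *m _) !mulmxA mulmxK.
have -> : series (exp_term (invmx P *m E *m P)) =
    (fun n => invmx P *m series (exp_term E) n *m P).
  apply/funext => n; rewrite /series /= mulmx_sumr mulmx_suml.
  by apply: eq_bigr => k _; rewrite /exp_term pw -scalemxAr -scalemxAl.
have ce := @expmx_cvg E.
apply: cvg_mx_entries => i j.
have -> : (fun n => (invmx P *m series (exp_term E) n *m P) i j) =
    (fun n => \sum_k (\sum_l invmx P i l * series (exp_term E) n l k) * P k j).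
  by apply/funext => n; rewrite mxE; apply: eq_bigr => k _; rewrite mxE.
rewrite mxE; under [in X in _ --> X]eq_bigr do rewrite mxE.
apply: cvg_big => [|k _]; first exact: add_continuous.
apply: cvgM; last exact: cvg_cst.
apply: cvg_big => [|l _]; first exact: add_continuous.
by apply: cvgM; [exact: cvg_cst|exact: cvg_mx_entry].
Qed.

End MatrixExponential.

(** * Reversible parallel transports reach every point *)

Section Reversible.
Variables (R : realType) (M : topologicalType) (A : set (chart R M)).
Variable g : tensor2_field R M.
Hypothesis Hg : spacetime A g.
Implicit Types (c : chart R M) (p : M) (P Q : 'M[R]_4).
Local Notation e a := (delta_mx ord0 a : 'rV[R]_4).

Let HA : is_atlas A.
Proof. by case: Hg. Qed.

Lemma transport_trans c1 p1 c2 p2 c3 p3 P Q :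
  transport A g c1 p1 c2 p2 P -> transport A g c2 p2 c3 p3 Q ->
  transport A g c1 p1 c3 p3 (Q *m P).
Proof.
move=> h1; elim=> [|c' p' c'' p'' P' Q' _ IH h2]; first by rewrite mul1mx.
by rewrite -mulmxA; exact: transport_rcons IH h2.
Qed.

Lemma transport_smooth c1 p1 c2 p2 P :
  smooth_transport A g c1 p1 c2 p2 P -> transport A g c1 p1 c2 p2 P.
Proof. by move=> h; rewrite -[P]mulmx1; exact: transport_rcons (transport_nil _ _ _ _) h. Qed.

(** Closure of [transport] under inversion is not built into its definition. The inverse is carried
    along as data, available because axis segments can be swept both ways. *)
Definition reversible c1 p1 c2 p2 P := [/\ P \in unitmx,
  transport A g c1 p1 c2 p2 P & transport A g c2 p2 c1 p1 (invmx P)].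

Lemma reversible_refl c p : reversible c p c p 1%:M.
Proof. by split; rewrite ?unitmx1 ?invmx1; try exact: transport_nil. Qed.

Lemma reversible_sym c1 p1 c2 p2 P :
  reversible c1 p1 c2 p2 P -> reversible c2 p2 c1 p1 (invmx P).
Proof. by move=> [uP h1 h2]; split; rewrite ?unitmx_inv ?invmxK. Qed.

Lemma invmxM P Q : P \in unitmx -> Q \in unitmx ->
  invmx (Q *m P) = invmx P *m invmx Q.
Proof.
move=> uP uQ; have uQP : Q *m P \in unitmx by rewrite unitmx_mul uQ.
rewrite -[RHS](mulmxK uQP) -(mulmxA (invmx P)) (mulmxA (invmx Q)) mulVmx // mul1mx.
by rewrite mulVmx // mul1mx.
Qed.

Lemma reversible_trans c1 p1 c2 p2 c3 p3 P Q :
  reversible c1 p1 c2 p2 P -> reversible c2 p2 c3 p3 Q ->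
  reversible c1 p1 c3 p3 (Q *m P).
Proof.
move=> [uP h1 h2] [uQ h3 h4]; split; first by rewrite unitmx_mul uQ.
- exact: transport_trans h1 h3.
- by rewrite invmxM //; exact: transport_trans h4 h2.
Qed.

Section AxisMoves.
Variable c : chart R M.
Hypothesis Ac : A c.

(** The range [2 * r] is uniform over the cube and suffices because two of its points differ by less
    than that in each coordinate. The Lipschitz constant [K] later yields continuity of the line
    field. *)
Definition axis_moves (x : 'rV[R]_4) (r K : R) :=
  [/\ 0 < r, 0 < K, cube x r `<=` img c &
    forall y a, cube x r y -> exists Y : R -> 'M[R]_4, [/\ Y 0 = 1%:M,
      forall s : R, `|s| <= 2 * r -> img c (y + s *: e a),
      forall s : R, `|s| <= 2 * r -> mder Y s 1 (- Gam g c a (y + s *: e a) *m Y s) &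
      forall (s : R) i j, `|s| <= 2 * r ->
        `|Y s i j - (1%:M : 'M[R]_4) i j| <= K * `|s|]].

Lemma axis_moves_ex x : img c x -> exists r K, axis_moves x r K.
Proof.
move=> Vx.
have [C [r0 [C0 r00 rV hC]]] := bounded_cube (@open_img R M c) (Gam_smooth Hg Ac 0) Vx.
(* A third of [r0] keeps moves of length [2 * r] inside the cube of radius [r0]; the other bound
   gives [4 * C * (2 * r) <= 1 / 2], as [linear_ode_exists] requires in dimension 4. *)
pose r := Order.min (r0 / 3) (16 * C)^-1.
have rr0 : r <= r0 / 3 by rewrite ge_min lexx.
have rC : r <= (16 * C)^-1 by rewrite ge_min lexx orbT.
have r_gt0 : 0 < r by rewrite lt_min divr_gt0 // invr_gt0 mulr_gt0.
exists r, (3 * 4%:R * C); split=> //; first by rewrite !mulr_gt0.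
  by move=> y cy; apply: rV => i; apply: lt_le_trans (cy i) _; lra.
move=> y a cy.
have seg (s : R) : `|s| <= 2 * r -> cube x r0 (y + s *: e a).
  move=> sr i; have := cy i; rewrite !mxE eqxx /= addrAC => h.
  apply: le_lt_trans (ler_normD _ _) _.
  have : `|s * (i == a)%:R| <= `|s|.
    by case: (i == a); rewrite ?mulr1 ?mulr0 ?normr0.
  by move: h; move: (_ - _) => z; lra.
have [|||||Y [Y0 Yd Yb]] := @linear_ode_exists R 4 (fun s => - Gam g c a (y + s *: e a)) C (2 * r).
- exact: C0.
- by rewrite mulr_gt0.
- move=> t i j tr; have Vt := rV _ (seg t tr).
  have := mder_line (mderN (mCk_mder a (Gam_smooth Hg Ac 1 a) Vt)) => /(_ i j).
  by move/is_derive_continuous1.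
- move=> t i j tr; rewrite mxE normrN; apply: hC; exact: seg.
- have : 16 * C * r <= 16 * C * (16 * C)^-1 by rewrite ler_wpM2l // mulr_ge0 // ltW.
  by rewrite mulfV ?gt_eqF ?mulr_gt0 //; lra.
by exists Y; split=> // s sr; exact: rV (seg s sr).
Qed.

Lemma axis_reversible y a (s0 : R) (Y : R -> 'M[R]_4) s c1 c2 :
  Y 0 = 1%:M ->
  (forall s : R, `|s| <= s0 -> img c (y + s *: e a)) ->
  (forall s : R, `|s| <= s0 -> mder Y s 1 (- Gam g c a (y + s *: e a) *m Y s)) ->
  `|s| <= s0 -> A c1 -> A c2 ->
  dom c1 (par c y) -> dom c2 (par c (y + s *: e a)) ->
  reversible c1 (par c y) c2 (par c (y + s *: e a))
    (jac c c2 (par c (y + s *: e a)) *m Y s *m invmx (jac c c1 (par c y))).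
Proof.
move=> Y0 Hseg HY ss Ac1 Ac2 d1 d2.
have s0_ge0 : 0 <= s0 by exact: le_trans ss.
have Vy : img c y by have := Hseg 0; rewrite normr0 scale0r addr0; apply.
have uY := axis_frame_unit Hg Ac Hseg HY Y0 ss.
have J1 : jac c c1 (par c y) \in unitmx.
  by apply: (Jac_unit Ac Ac1 Hg); split=> //; split=> //; exact: dom_par.
have J2 : jac c c2 (par c (y + s *: e a)) \in unitmx.
  have V2 := Hseg s ss.
  by apply: (Jac_unit Ac Ac2 Hg); split=> //; split=> //; exact: dom_par.
have sine00 : sine 0 0 = 0 :> R by rewrite /sine mul0r addr0 sin0.
have sine01 : sine 0 1 = 1 :> R by rewrite /sine mul1r addr0 sin_pihalf.
have sine10 : sine (pi / 2) 0 = 1 :> R by rewrite /sine mul0r add0r sin_pihalf.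
have sine11 : sine (pi / 2) 1 = 0 :> R by rewrite /sine mul1r sinDpihalf cos_pihalf.
have g00 : axis_gam c y a s 0 0 = par c y.
  by rewrite /axis_gam /axis_curve sine00 mulr0 scale0r addr0.
have g01 : axis_gam c y a s 0 1 = par c (y + s *: e a).
  by rewrite /axis_gam /axis_curve sine01 mulr1.
have g10 : axis_gam c y a s (pi / 2) 0 = par c (y + s *: e a).
  by rewrite /axis_gam /axis_curve sine10 mulr1.
have g11 : axis_gam c y a s (pi / 2) 1 = par c y.
  by rewrite /axis_gam /axis_curve sine11 mulr0 scale0r addr0.
split.
- by rewrite !unitmx_mul unitmx_inv J1 J2 uY.
- have := @axis_smooth_transport R M A g Hg c Ac y a s0 Y Hseg HY s 0 ss c1 c2.
  rewrite g00 g01 sine00 sine01 mulr0 mulr1 Y0 invmx1 mul1mx unitmx1.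
  by move=> h; apply: transport_smooth; exact: h.
- have := @axis_smooth_transport R M A g Hg c Ac y a s0 Y Hseg HY s (pi / 2) ss c2 c1.
  rewrite g10 g11 sine10 sine11 mulr0 mulr1 Y0 mulmx1 uY.
  rewrite invmxM ?unitmx_mul ?unitmx_inv ?J2 // invmxK invmxM //.
  by move=> h; apply: transport_smooth; exact: h.
Qed.

End AxisMoves.

Lemma chart_reversible c1 c2 p : A c1 -> A c2 -> dom c1 p -> dom c2 p ->
  exists P, reversible c1 p c2 p P.
Proof.
move=> A1 A2 d1 d2; have Vx := img_coord d1.
have [r [K [r0 K0 rV H]]] := axis_moves_ex A1 Vx.
have [Y [Y0 Yi Yd Yb]] := H _ ord0 (cube_refl _ r0).
have z : `|0 : R| <= 2 * r by rewrite normr0 mulr_ge0 // ltW.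
have := axis_reversible A1 Y0 Yi Yd z A1 A2; rewrite scale0r addr0 coordK // => h.
by eexists; exact: h.
Qed.

Lemma cube_reversible c x (r K : R) : A c -> axis_moves c x r K ->
  forall y z, cube x r y -> cube x r z ->
  exists P, reversible c (par c y) c (par c z) P.
Proof.
move=> Ac [r0 K0 rV H] y z cy cz.
apply: (@cube_ind R 4 (fun z => exists P, reversible c (par c y) c (par c z) P) x r _ y) => //.
  move=> w a s cw cws [P hP].
  have [Y [Y0 Yi Yd Yb]] := H w a cw.
  have sr : `|s| <= 2 * r.
    have := cw a; have := cws a; rewrite !mxE !eqxx /= mulr1 !ltr_norml.
    by move=> /andP[h1 h2] /andP[h3 h4]; rewrite ler_norml; apply/andP; split; lra.
  have d1 := dom_par (rV _ cw); have d2 := dom_par (rV _ cws).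
  have h := axis_reversible Ac Y0 Yi Yd sr Ac Ac d1 d2.
  by eexists; exact: reversible_trans hP h.
by exists 1%:M; exact: reversible_refl.
Qed.

(** The set of points reached is open by moves inside a cube and closed because such moves can be
    undone; connectedness gives all of the manifold. *)
Lemma reach c0 m c p : A c0 -> dom c0 m -> A c -> dom c p ->
  exists P, reversible c0 m c p P.
Proof.
move=> A0 d0 Ac cp.
have [_ cM [atlas _] _ _] := Hg.
pose W := [set q | exists c, [/\ A c, dom c q & exists P, reversible c0 m c q P]].
have step c' q q' (r K : R) : A c' -> axis_moves c' (coord c' q) r K ->
    dom c' q -> dom c' q' -> cube (coord c' q) r (coord c' q') ->
    exists P, reversible c' q c' q' P.
  move=> A' mv dq dq' cq'.
  have [P hP] := cube_reversible A' mv (cube_refl _ (let: And4 h _ _ _ := mv in h)) cq'.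
  by exists P; move: hP; rewrite !coordK.
have near_cube c' q r : dom c' q -> 0 < r ->
    nbhs q [set q' | dom c' q' /\ cube (coord c' q) r (coord c' q')].
  move=> dq r0.
  have h1 : nbhs q (dom c') by apply: open_nbhs_nbhs; split=> //; exact: dom_open.
  have h2 : nbhs q (coord c' @^-1` cube (coord c' q) r).
    by apply: (Defs.coord_continuous dq); exact: cube_nbhs.
  by move: h1 h2; exact: filterS2.
have oW : open W.
  rewrite openE => q [c' [A' dq [P hP]]].
  have [r [K mv]] := axis_moves_ex A' (img_coord dq).
  have r0 : 0 < r by case: mv.
  have := near_cube c' q r dq r0; apply: filterS => q' [dq' cq'].
  have [Q hQ] := step c' q q' r K A' mv dq dq' cq'.
  exists c'; split=> //; exists (Q *m P); exact: reversible_trans hP hQ.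
have cW : closed W.
  rewrite -[W]setCK; apply: open_closedC; rewrite openE => q nq.
  have [c' A' dq] := atlas q.
  have [r [K mv]] := axis_moves_ex A' (img_coord dq).
  have r0 : 0 < r by case: mv.
  have := near_cube c' q r dq r0; apply: filterS => q' [dq' cq'] [c1 [A1 dq1 [P hP]]].
  apply: nq; exists c'; split=> //.
  have [Q hQ] := step c' q q' r K A' mv dq dq' cq'.
  have [P' hP'] := chart_reversible A1 A' dq1 dq'.
  by eexists; exact: reversible_trans (reversible_trans hP hP') (reversible_sym hQ).
have WT : W = setT.
  apply: cM.
  - by exists m, c0; split=> //; exists 1%:M; exact: reversible_refl.
  - by exists W => //; rewrite setTI.
  - by exists W => //; rewrite setTI.
have [c' [A' dq [P hP]]] : W p by rewrite WT.
have [Q hQ] := chart_reversible A' Ac dq cp.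
by exists (Q *m P); exact: reversible_trans hP hQ.
Qed.

End Reversible.

(** * The holonomy-invariant line field *)

Section HolonomyLine.
Variables (R : realType) (M : topologicalType) (A : set (chart R M)).
Variable g : tensor2_field R M.
Hypothesis Hg : spacetime A g.

Definition annihilated (S : set 'M[R]_4) (k : 'cV[R]_4) :=
  forall E, S E -> E *m k = 0.

Lemma span3_annihilated (E1 E2 E3 : 'M[R]_4) k :
  annihilated (span3 E1 E2 E3) k <-> [/\ E1 *m k = 0, E2 *m k = 0 & E3 *m k = 0].
Proof.
split=> [h|[h1 h2 h3] E [a [b [d ->]]]]; last first.
  by rewrite !mulmxDl -!scalemxAl h1 h2 h3 !scaler0 !addr0.
split; apply: h.
- by exists 1, 0, 0; rewrite scale1r !scale0r !addr0.
- by exists 0, 1, 0; rewrite scale1r !scale0r add0r addr0.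
- by exists 0, 0, 1; rewrite scale1r !scale0r !add0r.
Qed.

Definition spans_line (S : set 'M[R]_4) (k0 : 'cV[R]_4) :=
  [/\ k0 != 0, annihilated S k0 & forall k, annihilated S k -> exists t : R, k = t *: k0].

Lemma wedge_ip0 (G : 'M[R]_4) v w k z : wedge v w *m G *m k = 0 ->
  ip G w k * ip G z v = ip G v k * ip G z w.
Proof.
rewrite mul_wedge => /(congr1 (ip G z)); rewrite ip0r ipDr ipNr !ipZr => /eqP.
by rewrite subr_eq0 => /eqP.
Qed.

Lemma ip1_neq0 (G : 'M[R]_4) k1 k2 : ip G k1 k2 = 1 -> k2 != 0.
Proof. by move=> h; apply/eqP => k0; move/eqP: h; rewrite k0 ip0r eq_sym oner_eq0. Qed.

(** The algebra consists of the infinitesimal Lorentz maps fixing the spacelike [y]. In the next two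
    lemmas the fixed vector is the null [l] and the timelike [u]. *)
Lemma R10_line (G : 'M[R]_4) l n x y : G^T = G -> null_tetrad G l n x y ->
  spans_line (span3 (endo_of G (wedge l n)) (endo_of G (wedge l x))
    (endo_of G (wedge n x))) y.
Proof.
move=> sG T; have ug := gram_null sG T.
have [[ln xx yy] [[ll nn lx ly] [nx ny xy]]] := T.
split; first exact: ip1_neq0 yy.
  by apply/span3_annihilated; rewrite /endo_of !mul_wedge ly ny xy !scale0r subrr.
move=> k /span3_annihilated[h1 h2 h3]; exists (ip G y k).
have nk : ip G n k = 0.
  by have := wedge_ip0 n h1; rewrite nn mulr0 (ipC n l) // ln mulr1.
have lk : ip G l k = 0.
  by have := wedge_ip0 l h1; rewrite ll mulr0 ln mulr1 => <-.
have xk : ip G x k = 0.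
  by have := wedge_ip0 n h2; rewrite (ipC n l) // ln mulr1 lk mul0r.
apply: (gram_ext ug) => i; rewrite ipZr.
by case: i => [[|[|[|[|i]]]] hi] //=; rewrite /four /= ?lk ?nk ?xk ?ly ?ny ?xy ?yy ?mulr0 ?mulr1.
Qed.

Lemma R11_line (G : 'M[R]_4) l n x y : G^T = G -> null_tetrad G l n x y ->
  spans_line (span3 (endo_of G (wedge l x)) (endo_of G (wedge l y))
    (endo_of G (wedge x y))) l.
Proof.
move=> sG T; have ug := gram_null sG T.
have [[ln xx yy] [[ll nn lx ly] [nx ny xy]]] := T.
have nl : ip G n l = 1 by rewrite ipC.
have [xl yl] : ip G x l = 0 /\ ip G y l = 0 by split; rewrite ipC.
split; first exact: ip1_neq0 nl.
  by apply/span3_annihilated; rewrite /endo_of !mul_wedge ll xl yl !scale0r subrr.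
move=> k /span3_annihilated[h1 h2 h3]; exists (ip G n k).
have lk : ip G l k = 0.
  by have := wedge_ip0 x h1; rewrite xl mulr0 xx mulr1 => <-.
have xk : ip G x k = 0.
  by have := wedge_ip0 n h1; rewrite nl mulr1 lk mul0r.
have yk : ip G y k = 0.
  by have := wedge_ip0 n h2; rewrite nl mulr1 lk mul0r.
apply: (gram_ext ug) => i; rewrite ipZr.
by case: i => [[|[|[|[|i]]]] hi] //=; rewrite /four /= ?lk ?xk ?yk ?ll ?nl ?xl ?yl ?mulr0 ?mulr1.
Qed.

Lemma R13_line (G : 'M[R]_4) u x y z : G^T = G -> orthonormal_tetrad G u x y z ->
  spans_line (span3 (endo_of G (wedge x y)) (endo_of G (wedge y z))
    (endo_of G (wedge x z))) u.
Proof.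
move=> sG T; have ug := gram_orthonormal sG T.
have [[uu xx yy zz] [[ux uy uz] [xy yz xz]]] := T.
have [xu yu zu] : [/\ ip G x u = 0, ip G y u = 0 & ip G z u = 0] by split; rewrite ipC.
split.
- apply/eqP => u0; move/eqP: uu; rewrite u0 ip0r eq_sym oppr_eq0 oner_eq0 //.
- by apply/span3_annihilated; rewrite /endo_of !mul_wedge xu yu zu !scale0r subrr.
move=> k /span3_annihilated[h1 h2 h3]; exists (- ip G u k).
have yk : ip G y k = 0.
  by have := wedge_ip0 x h1; rewrite xx mulr1 xy mulr0.
have xk : ip G x k = 0.
  by have := wedge_ip0 y h1; rewrite yy mulr1 (ipC y x) // xy mulr0.
have zk : ip G z k = 0.
  by have := wedge_ip0 y h2; rewrite yy mulr1 yz mulr0.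
apply: (gram_ext ug) => i; rewrite ipZr.
case: i => [[|[|[|[|i]]]] hi] //=; rewrite /four /= ?xk ?yk ?zk ?uu ?xu ?yu ?zu ?mulr0 //.
by rewrite mulrN1 opprK.
Qed.

Lemma holonomy_kernel_line :
  holonomy_type_R10 A g \/ holonomy_type_R11 A g \/ holonomy_type_R13 A g ->
  exists c0 m k0, [/\ A c0, dom c0 m & spans_line (holonomy_algebra A g c0 m) k0].
Proof.
have sG c0 m : A c0 -> dom c0 m -> (g c0 m)^T = g c0 m.
  by move=> A0 d0; have [_ _ _ _ lg] := Hg; have [] := lg c0 m A0 d0.
case=> [|[]] [c0 [m [v1 [v2 [v3 [v4 [A0 d0 T /= hE]]]]]]].
- by exists c0, m, v4; split=> //; rewrite hE; apply: R10_line T; exact: sG.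
- by exists c0, m, v1; split=> //; rewrite hE; apply: R11_line T; exact: sG.
- by exists c0, m, v1; split=> //; rewrite hE; apply: R13_line T; exact: sG.
Qed.

(* The holonomy group normalises its Lie algebra, hence preserves the common
   kernel of the latter. *)
Lemma loop_preserves_line c0 m k0 P : spans_line (holonomy_algebra A g c0 m) k0 ->
  reversible A g c0 m c0 m P -> exists t : R, P *m k0 = t *: k0.
Proof.
move=> [_ ann uniq_line] [uP h1 h2]; apply: uniq_line => E hE.
have hconj : holonomy_algebra A g c0 m (invmx P *m E *m P).
  move=> t; rewrite scalemxAl scalemxAr expmx_conj // -mulmxA.
  exact: transport_trans (transport_trans h1 (hE t)) h2.
have := ann _ hconj; rewrite -!mulmxA => /(congr1 (mulmx P)).
by rewrite mulmx0 mulKVmx.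
Qed.

End HolonomyLine.

(** * The normalised section of the invariant line field *)

Section LineField.
Variables (R : realType) (M : topologicalType) (A : set (chart R M)).
Variables (g g' : tensor2_field R M).
Hypothesis Hg : spacetime A g.
Hypothesis Hg' : spacetime A g'.
Hypothesis HN : forall c p, A c -> dom c p -> curvature_nature g c p Null.
Variables (psi : covector_field R M) (chi : M -> R).
Hypothesis Hpsi : smooth_covector A psi.
Hypothesis Hgam : forall c p, A c -> dom c p -> forall a b d : 'I_4,
  christoffel g' c a b d p - christoffel g c a b d p =
  (a == b)%:R * psi c p ord0 d + (a == d)%:R * psi c p ord0 b.
Hypothesis Hchi : smooth_fun A chi.
Hypothesis Hdchi : forall c p, A c -> dom c p -> psi c p = differential chi c p.
Variables (c0 : chart R M) (m : M) (k0 : 'cV[R]_4).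
Hypothesis A0 : A c0.
Hypothesis d0 : dom c0 m.
Hypothesis k0_neq0 : k0 != 0.
Hypothesis loops : forall P, reversible A g c0 m c0 m P -> exists t : R, P *m k0 = t *: k0.
Variable c : chart R M.
Hypothesis Ac : A c.
Local Notation e a := (delta_mx ord0 a : 'rV[R]_4).
Local Notation ec := (@ec R).
Local Notation ell := (ell g' psi chi c).
Local Notation dil := (dil g g' psi chi c).

Definition in_line (y : 'rV[R]_4) (v : 'cV[R]_4) :=
  exists2 P, reversible A g c0 m c (par c y) P & v = P *m k0.

Lemma in_line_neq0 y v : in_line y v -> v != 0.
Proof.
move=> [P [uP _ _] ->]; apply: contra k0_neq0 => /eqP h.
by rewrite -(mulKmx uP k0) h mulmx0.
Qed.

Lemma in_line_ex y : img c y -> exists v, in_line y v.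
Proof.
move=> Vy; have [P hP] := reach Hg A0 d0 Ac (dom_par Vy).
by exists (P *m k0), P.
Qed.

Lemma in_line_prop y v w : in_line y v -> in_line y w -> exists t : R, v = t *: w.
Proof.
move=> [P hP ->] [Q hQ ->]; have [uQ _ _] := hQ.
have [t ht] := loops (reversible_trans hP (reversible_sym hQ)); exists t.
by rewrite -(mulKVmx uQ (P *m k0)) (mulmxA (invmx Q)) ht -scalemxAr.
Qed.

Lemma in_line_axis y a (s0 s : R) (Y : R -> 'M[R]_4) v :
  Y 0 = 1%:M ->
  (forall s : R, `|s| <= s0 -> img c (y + s *: e a)) ->
  (forall s : R, `|s| <= s0 -> mder Y s 1 (- Gam g c a (y + s *: e a) *m Y s)) ->
  `|s| <= s0 -> in_line y v -> in_line (y + s *: e a) (Y s *m v).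
Proof.
move=> Y0 Yi Yd ss [P hP ->].
have Vy : img c y.
  by have := Yi 0; rewrite normr0 scale0r addr0; apply; exact: le_trans ss.
have d1 := dom_par Vy; have d2 := dom_par (Yi s ss).
have := axis_reversible Hg Ac Y0 Yi Yd ss Ac Ac d1 d2.
rewrite !jac_id // mul1mx invmx1 mulmx1 => h.
by exists (Y s *m P); [exact: reversible_trans hP h|rewrite mulmxA].
Qed.

Definition lam (y : 'rV[R]_4) (v : 'cV[R]_4) : R := ip (Gm g c y) (ell y) v.

(** [Y s *m v] is parallel along the axis, so only [ell] contributes, and its covariant derivative
    is [dil] times the basis vector. *)
Lemma lam_axis_der y a (s0 s : R) (Y : R -> 'M[R]_4) v :
  (forall s : R, `|s| <= s0 -> img c (y + s *: e a)) ->
  (forall s : R, `|s| <= s0 -> mder Y s 1 (- Gam g c a (y + s *: e a) *m Y s)) ->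
  `|s| <= s0 ->
  is_derive s 1 (fun s : R => lam (y + s *: e a) (Y s *m v))
    (dil (y + s *: e a) * ip (Gm g c (y + s *: e a)) (ec a) (Y s *m v)).
Proof.
move=> Yi Yd ss; have Vs := Yi s ss.
have dl := mder_line (ell_der Hg Hg' HN Hpsi Hgam Hchi Hdchi Ac a Vs).
have dG := mder_line (Gm_der Hg Ac a Vs).
have dY := mderM (Yd s ss) (mder_cst v s 1).
have := mderM (mderM (mderT dl) dG) dY => /(_ ord0 ord0).
move/is_derive_eq; apply.
rewrite -ipZl /ip; congr (fun_of_matrix _ ord0 ord0).
move: (ell _) (Gm g c _) (Gam g c a _) (Y s) => ? ? ? ?; rewrite mulmx0 addr0.
by mxexpand; mxlin.
Qed.

Section Cube.
Variables (x : 'rV[R]_4) (r K : R).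
Hypothesis mv : axis_moves g c x r K.

Let r0 : 0 < r. Proof. by case: mv. Qed.
Let K0 : 0 < K. Proof. by case: mv. Qed.
Let rV : cube x r `<=` img c. Proof. by case: mv. Qed.

(** Transport along the staircase from [y] to [z], by induction on its corners: each step moves the
    vector by an amount proportional to the change of one coordinate. *)
Lemma in_line_close y v (eps : R) : cube x r y -> in_line y v -> 0 < eps ->
  exists2 d : R, 0 < d & forall z, cube x r z -> cube y d z ->
    exists2 w, in_line z w & forall i, `|w i ord0 - v i ord0| < eps.
Proof.
move=> cy hv.
suff H k : (k <= 4)%N -> forall eps : R, 0 < eps ->
    exists2 d : R, 0 < d & forall z, cube x r z -> cube y d z ->
    exists2 w, in_line (stair y z k) w & forall i, `|w i ord0 - v i ord0| < eps.
  move=> eps0; have [d d_gt0 hd] := H 4%N isT eps eps0.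
  by exists d => // z cz cyz; have := hd z cz cyz; rewrite stairn.
elim: k => [|k IH] k4 {}eps eps0.
  by exists 1 => // z _ _; exists v; rewrite ?stair0 // => i; rewrite subrr normr0.
pose B := \sum_i `|v i ord0| + 1.
have B0 : 0 < B by rewrite ltr_wpDl // sumr_ge0.
have vB i : `|v i ord0| + 1 <= B by rewrite lerD2r (bigD1 i) //= lerDl sumr_ge0.
have e1 : 0 < Order.min (eps / 2) 1 by rewrite lt_min divr_gt0 //=.
have [d1 d10 hd1] := IH (ltnW k4) _ e1.
(* A step of length [|s| < d2] changes entries by at most [4 * K * |s| * B], where [B] bounds the
   current vector and 4 counts the summands; this is at most [eps / 2]. *)
pose d2 := eps / (8 * K * B + 1).
have D0 : 0 < 8 * K * B + 1 by rewrite ltr_wpDl // !mulr_ge0 // ltW.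
have d20 : 0 < d2 by rewrite divr_gt0.
exists (Order.min d1 (Order.min d2 (2 * r))); first by rewrite !lt_min d10 d20 mulr_gt0 //.
move=> z cz cyz.
have cyz1 : cube y d1 z.
  by move=> i; apply: lt_le_trans (cyz i) _; rewrite ge_min lexx.
have [w hw wv] := hd1 z cz cyz1.
pose j := Ordinal k4; pose s := z ord0 j - y ord0 j.
have sd : `|s| < Order.min d1 (Order.min d2 (2 * r)) := cyz j.
have [sd2 sr] : `|s| < d2 /\ `|s| <= 2 * r.
  by move: sd; rewrite !lt_min => /and3P[_ h1 h2]; split=> //; exact: ltW.
have cst : cube x r (stair y z k) by exact: stair_cube.
have [_ _ _ /(_ _ j cst)[Y [Y0 Yi Yd Yb]]] := mv.
exists (Y s *m w); first by rewrite (stairS y z j); exact: in_line_axis Y0 Yi Yd sr hw.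
have wB i : `|w i ord0| <= B.
  apply: le_trans (vB i); have -> : w i ord0 = v i ord0 + (w i ord0 - v i ord0) by ring.
  apply: le_trans (ler_normD _ _) _; rewrite lerD2l ltW //.
  by apply: lt_le_trans (wv i) _; rewrite ge_min lexx orbT.
have wYw i : `|(Y s *m w) i ord0 - w i ord0| <= 4 * (K * `|s| * B).
  have -> : (Y s *m w) i ord0 - w i ord0 =
      \sum_l (Y s i l - (1%:M : 'M[R]_4) i l) * w l ord0.
    have E : w i ord0 = (1%:M *m w) i ord0 by rewrite mul1mx.
    rewrite [in LHS]E !mxE -sumrB; apply: eq_bigr => l _; rewrite [1%:M i l]mxE; ring.
  apply: le_trans (ler_norm_sum _ _ _) _.
  have -> : 4 * (K * `|s| * B) = \sum_(l < 4) (K * `|s| * B).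
    by rewrite sumr_const card_ord -(mulr_natl (_ * B) 4).
  by apply: ler_sum => l _; rewrite normrM; apply: ler_pM => //; exact: Yb.
move=> i.
have -> : (Y s *m w) i ord0 - v i ord0 = ((Y s *m w) i ord0 - w i ord0) + (w i ord0 - v i ord0) by ring.
apply: le_lt_trans (ler_normD _ _) _.
have h1 : `|w i ord0 - v i ord0| < eps / 2.
  by apply: lt_le_trans (wv i) _; rewrite ge_min lexx.
have h2 : 4 * (K * `|s| * B) <= eps / 2.
  have : `|s| * (8 * K * B + 1) <= eps.
    by rewrite -ler_pdivlMr // ltW.
  by have := normr_ge0 s; move: (`|s|) => q; lra.
by have := wYw i; lra.
Qed.

Definition good : set 'rV[R]_4 :=
  [set y | cube x r y /\ exists2 v, in_line y v & lam y v != 0].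

Definition line_vector (y : 'rV[R]_4) : 'cV[R]_4 :=
  if pselect (exists v, in_line y v) is left h then sval (cid h) else 0.

(** The quotient has degree zero in the chosen vector, so [kfE] may replace [line_vector y] by any
    transport convenient at hand. *)
Definition kf (y : 'rV[R]_4) : 'cV[R]_4 := (lam y (line_vector y))^-1 *: line_vector y.

Lemma kfE y v : in_line y v -> lam y v != 0 -> kf y = (lam y v)^-1 *: v.
Proof.
move=> hv lv; rewrite /kf /line_vector; case: pselect => [h|[]]; last by exists v.
have hw := svalP (cid h); set w := sval _ in hw *.
have [t vE] := in_line_prop hv hw.
have t0 : t != 0 by apply/eqP => t0; move/eqP: (in_line_neq0 hv); rewrite vE t0 scale0r.
have lE : lam y v = t * lam y w by rewrite vE /lam ipZr.
rewrite lE vE scalerA invfM mulrAC mulVf // mul1r //.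
Qed.

Lemma lam_kf y : good y -> lam y (kf y) = 1.
Proof.
move=> [_ [v hv lv]]; rewrite (kfE hv lv) /lam ipZr mulVf //.
Qed.

Let T := ('rV[R]_4 * 'cV[R]_4)%type.

Let lam_cont (y : 'rV[R]_4) (v : 'cV[R]_4) : img c y ->
  {for ((y, v) : T), continuous (fun q : T => lam q.1 q.2)}.
Proof.
move=> Vy.
have -> : (fun q : T => lam q.1 q.2) =
    (fun q : T => \sum_i (\sum_j ell q.1 j ord0 * Gm g c q.1 j i) * q.2 i ord0).
  apply/funext => q; rewrite /lam /ip mxE; apply: eq_bigr => i _; congr (_ * _).
  by rewrite mxE; apply: eq_bigr => j _; rewrite mxE.
have c1 (f : 'rV[R]_4 -> R) : {for y, continuous f} ->
    {for ((y, v) : T), continuous (fun q : T => f q.1)}.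
  move=> cf; apply: (@continuous_comp _ _ _ fst f); [exact: cvg_fst|exact: cf].
have c2 i : {for ((y, v) : T), continuous (fun q : T => q.2 i ord0)}.
  apply: (@continuous_comp _ _ _ snd (fun w : 'cV[R]_4 => w i ord0)); first exact: cvg_snd.
  exact: coord_continuous.
have csum (f : 'I_4 -> T -> R) : (forall i, {for ((y, v) : T), continuous (f i)}) ->
    {for ((y, v) : T), continuous (fun q : T => \sum_i f i q)}.
  move=> cf; rewrite /prop_for /continuous_at; apply: cvg_big => [|i _]; last exact: cf.
  exact: add_continuous.
apply: (csum _) => i; apply: contM; last exact: c2.
apply: (csum _) => j; apply: contM.
- apply: (c1 (fun z => ell z j ord0)).
  exact: (Ck_continuous (ell_smooth Hg' Hpsi Hchi Ac 0 j ord0)).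
- apply: (c1 (fun z => Gm g c z j i)).
  exact: (Ck_continuous (Gm_smooth Hg Ac 0 j i)).
Qed.

(* Joint continuity in the base point and the vector turns [in_line_close] into
   continuity of the normalised field. *)
Let near_line (y : 'rV[R]_4) v (S : set T) (Q : set 'rV[R]_4) :
  cube x r y -> in_line y v -> nbhs ((y, v) : T) S ->
  (forall z w, cube x r z -> in_line z w -> S (z, w) -> Q z) -> nbhs y Q.
Proof.
move=> cy hv [[S1 S2] /= [h1 h2] S12] SQ.
have /nbhs_ballP[eps /= eps0 epsS] := h2.
have [d d_gt0 hd] := in_line_close cy hv eps0.
have n1 : nbhs y (cube x r) by apply: open_nbhs_nbhs; split=> //; exact: (@cube_open R 4 x r r0).
have n2 := cube_nbhs y d_gt0.
near=> z.
have cz : cube x r z by near: z.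
have cyz : cube y d z by near: z.
have [w hw wv] := hd z cz cyz.
apply: (SQ z w) => //; apply: S12; split=> /=; first by near: z.
apply: epsS; split=> // i j; rewrite ord1 /ball /= distrC; exact: wv.
Unshelve. all: by end_near. Qed.

Lemma good_open : open good.
Proof.
rewrite openE => y [cy [v hv lv]].
have n := cont_neq0 (lam_cont (rV cy)) lv.
apply: (near_line cy hv n) => z w cz hw lw.
by split=> //; exists w.
Qed.

Lemma kf_cont : mCk good 0 kf.
Proof.
move=> i j; rewrite ord1; split=> // y [cy [v hv lv]].
have cl := lam_cont (v := v) (rV cy).
have cF : {for ((y, v) : T), continuous (fun q : T => (lam q.1 q.2)^-1 * q.2 i ord0)}.
  apply: contM; first exact: (@contV R T (fun q : T => lam q.1 q.2) (y, v) lv cl).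
  apply: (@continuous_comp _ _ _ snd (fun w : 'cV[R]_4 => w i ord0)); first exact: cvg_snd.
  exact: coord_continuous.
apply/(@cont_distP R _ (fun z => kf z i ord0)) => eps eps0.
have n1 := (@cont_distP R _ _ _).1 cF eps eps0.
have n2 := cont_neq0 cl lv.
apply: (near_line cy hv (filterI n1 n2)) => z w cz hw [/= h1 h2].
by rewrite (kfE hv lv) (kfE hw h2) !mxE.
Qed.

Lemma kf_der a y : good y -> mder kf y (e a) (- Gam g c a y *m kf y
  - (dil y * ip (Gm g c y) (kf y) (ec a)) *: kf y).
Proof.
move=> [cy [v hv lv]].
have [_ _ _ /(_ y a cy)[Y [Y0 Yi Yd Yb]]] := mv.
have z0 : `|0 : R| <= 2 * r by rewrite normr0 mulr_ge0 // ltW.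
have Vy := rV cy.
pose f (s : R) := lam (y + s *: e a) (Y s *m v).
have df := lam_axis_der v Yi Yd z0.
have f0 : f 0 = lam y v by rewrite /f scale0r addr0 Y0 mul1mx.
have fn0 : f 0 != 0 by rewrite f0.
have dY := mderM (Yd 0 z0) (mder_cst v (0 : R) 1).
have dk := mderZ (pderV fn0 df) dY.
have N : \forall s \near (0 : R), kf (y + s *: e a) = (f s)^-1 *: (Y s *m v).
  have n1 := cont_neq0 (is_derive_continuous1 df) fn0.
  have n2 : \forall s \near (0 : R), `|s| < 2 * r.
    by apply: (@nbhs0_lt R R^o); rewrite mulr_gt0.
  move: n1 n2; apply: filterS2 => s fs sr.
  by rewrite (kfE (in_line_axis Y0 Yi Yd (ltW sr) hv)).
have D := mder_near N dk.
move=> i j; apply: is_derive_line0.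
apply: is_derive_eq (D i j) _; congr (fun_of_matrix _ i j).
rewrite f0 (kfE hv lv) Y0 scale0r addr0 !mul1mx ?mulmx0 addr0 mulmx1 ipZl.
rewrite (ipC (ec a)) ?(Gm_sym Hg Ac Vy) //.
move: (lam y v) lv (dil y) (ip _ _ _) (Gam g c a y) => q q0 p t B.
rewrite -!scalemxAr scalerA; apply/matrixP => i' j'; rewrite !mxE.
by move: (\sum_j0 _) (v i' j') => S z; field.
Qed.

Lemma no_good x' : good x' -> dil x' != 0 -> False.
Proof.
move=> gx dx.
have gV : good `<=` img c by move=> y [cy _]; exact: rV.
apply: (@no_invariant_field R M A g g' Null Hg Hg' HN psi chi Hpsi Hgam Hchi Hdchi c Ac
  (erefl Null) good kf good_open gV kf_cont kf_der x' gx dx) => y gy.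
exact: lam_kf.
Qed.

End Cube.

(** Were [dil] nonzero, [no_good] would force [lam] to vanish on the line near [x]. By
    [lam_axis_der] its derivative along the axis [a] is [dil] times a component of the transported
    vector, and some component is nonzero. *)
Lemma dil_zero x : img c x -> dil x = 0.
Proof.
move=> Vx; apply/eqP/negPn/negP => dx.
have bad y : img c y -> dil y != 0 -> forall v, in_line y v -> lam y v = 0.
  move=> Vy dy v hv; apply/eqP/negPn/negP => lv.
  have [r [K mv]] := axis_moves_ex Hg Ac Vy.
  apply: (no_good mv (x' := y)) => //; split; last by exists v.
  by apply: cube_refl; case: mv.
have [v hv] := in_line_ex Vx.
have [a va] : exists a, ip (Gm g c x) (ec a) v != 0.
  apply: contrapT => h; move/eqP: (in_line_neq0 hv); apply.
  apply: (ip_eq0 (Gm_unit Hg Ac Vx)) => p; rewrite (sum_ec p).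
  elim/big_rec: _ => [|a z _ IH]; first by rewrite ip0l.
  rewrite ipDl ipZl IH addr0; have [->|] := eqVneq (ip (Gm g c x) (ec a) v) 0.
    by rewrite mulr0.
  by move=> ha; case: h; exists a.
have [r [K mv]] := axis_moves_ex Hg Ac Vx.
have [r0 K0 rV /(_ x a (cube_refl x r0))[Y [Y0 Yi Yd Yb]]] := mv.
have z0 : `|0 : R| <= 2 * r by rewrite normr0 mulr_ge0 // ltW.
have df := lam_axis_der v Yi Yd z0.
have D0 : is_derive (0 : R) 1 (fun s : R => lam (x + s *: e a) (Y s *m v)) 0.
  apply: is_derive_near (pder_cst 0 (0 : R) 1).
  have n1 := near_axis a (cube_nbhs x r0).
  have n2 : \forall s \near (0 : R), `|s| < 2 * r.
    by apply: (@nbhs0_lt R R^o); rewrite mulr_gt0.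
  move: n1 n2; apply: filterS2 => s cs sr.
  apply: bad; first exact: rV.
    by rewrite (dil_const Hg Hg' HN Hpsi Hgam Hchi Hdchi Ac r0 rV cs).
  exact: in_line_axis Y0 Yi Yd (ltW sr) hv.
have := is_derive_unique df D0; rewrite scale0r addr0 Y0 mul1mx => /eqP.
by rewrite mulf_eq0 (negbTE dx) (negbTE va).
Qed.

End LineField.

Theorem mainTheorem6 (R : realType) (M : topologicalType)
    (A : set (chart R M)) (g g' : tensor2_field R M) (N : nature)
    (lambda : covector_field R M)
    (Hg : spacetime A g) (Hg' : spacetime A g')
    (Hhol : holonomy_type_R10 A g \/ holonomy_type_R11 A g
            \/ holonomy_type_R13 A g)
    (HD : forall c p, A c -> dom c p -> curvature_class_D g c p)
    (HN : forall c p, A c -> dom c p -> curvature_nature g c p N)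
    (Hproj : projectively_related A g g')
    (Hlambda : associated_form A g g' lambda) :
  (N = Timelike \/ N = Spacelike ->
     vanishes_everywhere A lambda \/ vanishes_nowhere A lambda) /\
  (N = Null -> vanishes_everywhere A lambda).
Proof.
have [psi [chi [[Hpsi Hgam] Hchi Hdchi Hl]]] := Hlambda.
have lam0 := lambda_eq0 Hg Hg' Hl.
have dich : vanishes_everywhere A lambda \/ vanishes_nowhere A lambda.
  case: (psi_zero_dichotomy Hg Hg' HN Hpsi Hgam Hchi Hdchi) => Z; [left|right] => c p Ac cp.
    apply/eqP; rewrite lam0 //; apply/eqP/(psi_zeroE Hpsi Ac cp).
    by rewrite Z.
  rewrite lam0 //; apply/eqP => /(psi_zeroE Hpsi Ac cp).
  by rewrite Z.
(* In the null case a nowhere zero [lambda] makes [ell] nonzero, so [parallel_ell_eq0] gives a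
   nonzero [dil], against [dil_zero]. *)
split=> [_ //|NN]; case: dich => // nowhere c p Ac cp; exfalso.
have [c0 [m [k0 [A0 d0 line]]]] := holonomy_kernel_line Hg Hhol.
have [k0_neq0 _ _] := line.
have loops P := @loop_preserves_line R M A g c0 m k0 P line.
rewrite NN in HN.
have Vx := img_coord cp.
have dil0 := dil_zero Hg Hg' HN Hpsi Hgam Hchi Hdchi A0 d0 k0_neq0 loops Ac Vx.
have ell0 : ell g' psi chi c (coord c p) != 0.
  by rewrite (ell_psi Hg' psi chi Ac Vx) coordK // -lam0 //; exact: nowhere.
have := parallel_ell_eq0 Hg Hg' HN Hpsi Hgam Hchi Hdchi Ac erefl Vx ell0.
by rewrite dil0 eqxx.
Qed.
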